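(* Let $1<p\le q<\infty$ and let $W_{\psi,\varphi}:\mathcal F^p(\mathbb C)\to\mathcal F^q(\mathbb C)$ be a bounded weighted composition operator induced by a nonzero entire function $\psi\in\mathcal F^q(\mathbb C)$ and an affine function $\varphi(z)=az+b$ with $a,b\in\mathbb C$, $0<|a|\le1$. Then $\|W_{\psi,\varphi}\|_e$ is comparable to $\limsup_{|z|\to\infty}m_z(\psi,\varphi)$; more precisely, $$\limsup_{|z|\to\infty}m_z(\psi,\varphi)\le\|W_{\psi,\varphi}\|_e\le2\left(\frac{q}{p|a|^2}\right)^{1/q}\limsup_{|z|\to\infty}m_z(\psi,\varphi).$$
   Context: $dA$ is Lebesgue measure on $\mathbb C$. For $0<p<\infty$, the Fock space $\mathcal F^p(\mathbb C)$ is the set of entire functions $f$ with $\|f\|_p=\left(\frac{p}{2\pi}\int_{\mathbb C}|f(z)|^pe^{-\frac{p|z|^2}{2}}\,dA(z)\right)^{1/p}<\infty$ (a Banach space if $p\ge1$). For entire functions $\psi,\varphi$, the weighted composition operator is $W_{\psi,\varphi}f=\psi\cdot(f\circ\varphi)$. The operator norm is $\|T\|=\sup_{\|f\|_p\le1}\|Tf\|_q$. For $z\in\mathbb C$, $m_z(\psi,\varphi)=|\psi(z)|e^{\frac{|\varphi(z)|^2-|z|^2}{2}}$. The essential norm of a bounded linear operator $L:X\to Y$ between Banach spaces is $\|L\|_e=\inf\{\|L-K\|:K:X\to Y\text{ a compact linear operator}\}$. *)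

(* Defs.v *)
From HB Require Import structures.
From mathcomp Require Import all_boot all_order all_algebra.
From mathcomp Require Import all_classical all_reals all_analysis.
From mathcomp Require Import measurable_realfun lebesgue_integral_fubini.
From mathcomp Require Import complex.

Set Implicit Arguments.
Unset Strict Implicit.
Unset Printing Implicit Defensive.

Import Order.TTheory GRing.Theory Num.Theory.
Import numFieldNormedType.Exports.
Import Normc.

Local Open Scope classical_set_scope.
Local Open Scope ring_scope.
Local Open Scope complex_scope.

(* The normed-module structure of the complex field over itself is carried by
   the alias [R[i]^o]; its norm is [`|z| = (normc z)%:C]. *)
Notation cplx R := (R[i]^o).

Section fock.
Variable R : realType.
Local Notation C := (cplx R).

Lemma continuous_measurable_plane (h : R * R -> R) : continuous h ->
  measurable_fun [set: measurableTypeR R * measurableTypeR R] h.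
Proof.
move=> ch; pose s (n : nat) (x : R) : R := (Num.floor (x * n.+1%:R))%:~R / n.+1%:R.
apply: (@measurable_fun_cvg _ _ _ _ (fun n w => h (s n w.1, w.2))); last first.
  move=> [x y] _ /=.
  suff c : (s n x, y) @[n --> \oo] --> (x, y).
    by apply: (cvg_comp (fun n => (s n x, y)) h c); exact: ch.
  apply: (@cvg_pair _ _ _ _ (nbhs x) (nbhs y)); last exact: cvg_cst.
  apply/cvgrPdist_le => e e0; near=> n.
  have n0 : 0 < n.+1%:R :> R by [].
  rewrite /s -[X in X - _](mulfK (lt0r_neq0 n0)) /=.
  rewrite -mulrBl normrM normfV (ger0_norm (ltW n0)) ler_pdivrMr//.
  have /andP[f1 f2] := floor_itv (x * n.+1%:R).
  rewrite ger0_norm ?subr_ge0// (@le_trans _ _ 1)//.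
    by move: f2; rewrite intrD lerBlDl => /ltW.
  rewrite -ler_pdivrMl// mulr1.
  near: n; exists (Num.truncn e^-1) => // n /= en.
  by apply: (le_trans (ltW (truncnS_gt _))); rewrite ler_nat ltnS.
move=> n _ A mA; rewrite setTI.
rewrite [X in measurable X](_ : _ = \bigcup_(k : int)
   ([set x : R | Num.floor (x * n.+1%:R) = k] `*`
    [set y | A (h (k%:~R / n.+1%:R, y))])).
  apply: countable_bigcupT_measurable => // k; apply: measurableX.
    rewrite [X in measurable X](_ : _ = `[k%:~R / n.+1%:R, (k + 1)%:~R / n.+1%:R[%classic).
      exact: measurable_itv.
    apply/seteqP; split => x /=; rewrite in_itv /= ler_pdivrMr// ltr_pdivlMr//.
      by move=> <-; exact: floor_itv.
    exact: floor_def.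
  have : measurable_fun [set: R] (fun y => h (k%:~R / n.+1%:R, y)).
    apply: continuous_measurable_fun => y.
    have c : (k%:~R / n.+1%:R, z) @[z --> y] --> (k%:~R / n.+1%:R : R, y).
      by apply: (@cvg_pair _ _ _ _ (nbhs _) (nbhs y)); [exact: cvg_cst|exact: cvg_id].
    by apply: (cvg_comp (fun y => (k%:~R / n.+1%:R, y)) h c); exact: ch.
  by move=> /(_ measurableT A mA); rewrite setTI.
apply/seteqP; split => [[x y] /= Ah|[x y] [k _ [/= xk]]].
  by exists (Num.floor (x * n.+1%:R)).
by rewrite /s xk.
Unshelve. all: by end_near.
Qed.

Lemma complex_normE (z : C) : `|z| = (normc z)%:C.
Proof. by []. Qed.

Lemma normc_ge0 (z : C) : 0 <= normc z.
Proof. by case: z => x y; exact: sqrtr_ge0. Qed.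

Lemma continuous_complex_of_pair :
  continuous (fun w : R * R => (w.1 +i* w.2) : C).
Proof.
move=> [x y]; apply/cvgrPdist_le => -[a b] /=.
rewrite ltcE /= => /andP[/eqP -> a0]; near=> w.
have /= h1 : `|x - w.1| <= a / 2.
  near: w; have /cvgrPdist_le : w.1 @[w --> (x, y)] --> x by exact: cvg_fst.
  by apply; rewrite divr_gt0.
have /= h2 : `|y - w.2| <= a / 2.
  near: w; have /cvgrPdist_le : w.2 @[w --> (x, y)] --> y by exact: cvg_snd.
  by apply; rewrite divr_gt0.
rewrite lecE /= eqxx/= (@le_trans _ _ (`|x - w.1| + `|y - w.2|))//; last first.
  by rewrite (splitr a) lerD.
rewrite -[leRHS]ger0_norm ?addr_ge0// -sqrtr_sqr ler_wsqrtr//.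
by rewrite [leRHS]sqrrD !real_normK ?num_real// addrAC lerDl mulrn_wge0 ?mulr_ge0.
Unshelve. all: by end_near. Qed.

Lemma normc_lerB (z w : C) : `|normc z - normc w| <= normc (z - w).
Proof.
have D (u v : C) : normc u - normc v <= normc (u - v).
  by rewrite lerBlDr -{1}(subrK v u); exact: le_normcD.
rewrite ler_norml D andbT lerNl opprB.
by rewrite (_ : normc (z - w) = normc (w - z)) // -[in RHS]opprB normcN.
Qed.

Lemma continuous_normc : continuous (@normc R : C -> R).
Proof.
move=> z; suff H e : 0 < e -> \forall w \near nbhs (z : C), `|normc z - normc w| <= e.
  by apply/(@cvgrPdist_le _ _ _ (nbhs (z : C))) => e e0; exact: H.
move=> e0; near=> w.
apply: (le_trans (normc_lerB _ _)); rewrite -lecR -complex_normE.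
near: w; have /cvgrPdist_le : (w : C) @[w --> nbhs (z : C)] --> z by exact: cvg_id.
by apply; rewrite ltcR.
Unshelve. all: by end_near. Qed.

Definition entire (f : C -> C) := forall z : C, derivable f z 1.

Lemma entire_continuous f : entire f -> continuous f.
Proof. by move=> ef z; apply/differentiable_continuous/derivable1_diffP. Qed.

Lemma entire0 : entire (fun=> 0).
Proof. by move=> z; exact: derivable_cst. Qed.

Lemma entireD f g : entire f -> entire g -> entire (fun z => f z + g z).
Proof. by move=> ef eg z; exact: derivableD. Qed.

Lemma entireZ c f : entire f -> entire (fun z => c * f z).
Proof. by move=> ef z; exact: derivableZ. Qed.

(* Integration over the plane, identified with [R * R] by [x +i* y]. *)
Definition int_dA (F : C -> \bar R) : \bar R :=
  \int[(lebesgue_measure \x lebesgue_measure)%E]_w F (w.1 +i* w.2).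

Definition fock_norm (p : R) (f : C -> C) : \bar R :=
  (((p / (2 * pi))%:E *
   int_dA (fun z => (normc (f z) `^ p * expR (- (p * normc z ^+ 2 / 2)))%:E)) `^ p^-1)%E.

Definition fock_set p : set (C -> C) :=
  [set f | entire f /\ (fock_norm p f < +oo)%E].

Local Notation mu := (@lebesgue_measure R \x @lebesgue_measure R)%E.

Definition fock_modulus (f : C -> C) (w : measurableTypeR R * measurableTypeR R) : R :=
  normc (f (w.1 +i* w.2)) * expR (- (normc (w.1 +i* w.2) ^+ 2 / 2)).

Lemma fock_modulus_continuous f :
  entire f -> continuous (fock_modulus f : R * R -> R).
Proof.
move=> ef w.
have c1 : {for w, continuous (fun w : R * R => normc (f (w.1 +i* w.2)) : R)}.
  apply: (@continuous_comp _ _ _ (fun w : R * R => (w.1 +i* w.2) : C)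
    (fun z : C => normc (f z) : R)); first exact: continuous_complex_of_pair.
  apply: (@continuous_comp _ _ _ f (@normc R : C -> R)).
    exact: entire_continuous.
  exact: continuous_normc.
have c2 : {for w, continuous
    (fun w : R * R => expR (- (normc (w.1 +i* w.2) ^+ 2 / 2)) : R)}.
  apply: (@continuous_comp _ _ _ (fun w : R * R => (w.1 +i* w.2) : C)
    (fun z : C => expR (- (normc z ^+ 2 / 2)) : R)).
    exact: continuous_complex_of_pair.
  apply: (@continuous_comp _ _ _ (@normc R : C -> R)
    (fun r : R => expR (- (r ^+ 2 / 2)) : R)); first exact: continuous_normc.
  apply: (@continuous_comp _ _ _ (fun r : R => - (r ^+ 2 / 2)) (@expR R)).
    by apply: cvgN; apply: cvgMr_tmp; exact: exprn_continuous.
  exact: continuous_expR.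
exact: (cvgM c1 c2).
Qed.

Lemma fock_modulus_measurable f : entire f -> measurable_fun setT (fock_modulus f).
Proof. by move=> /fock_modulus_continuous; exact: continuous_measurable_plane. Qed.

Lemma fock_modulus_ge0 f w : 0 <= fock_modulus f w.
Proof. by rewrite /fock_modulus mulr_ge0 ?normc_ge0 ?expR_ge0. Qed.

Lemma fock_normE (p : R) f : 0 < p ->
  fock_norm p f = (((p / (2 * pi)) `^ p^-1)%:E * Lnorm mu p%:E (EFin \o fock_modulus f))%E.
Proof.
move=> p0; have pp : 0 < p / (2 * pi) by rewrite divr_gt0 ?mulr_gt0 ?pi_gt0.
rewrite unlock /fock_norm poweRM ?lee_fin ?(ltW pp)//; last first.
  by apply: integral_ge0 => w _; rewrite lee_fin mulr_ge0 ?powR_ge0 ?expR_ge0.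
rewrite poweR_EFin; congr (_ * (_ `^ _))%E.
rewrite /int_dA; apply: eq_integral => w _ /=.
rewrite ger0_norm ?fock_modulus_ge0// /fock_modulus powRM ?normc_ge0 ?expR_ge0// -expRM; congr (_ * expR _)%:E.
by rewrite mulNr -[in LHS]mulrA [in LHS]mulrC.
Qed.

Lemma fock_norm_ge0 p f : (0 <= fock_norm p f)%E.
Proof. exact: poweR_ge0. Qed.

Let fock_cst_gt0 p : 0 < p -> 0 < (p / (2 * pi)) `^ p^-1 :> R.
Proof. by move=> p0; rewrite powR_gt0 ?divr_gt0 ?mulr_gt0 ?pi_gt0. Qed.

Let fock_modulus_powR_measurable p f : entire f ->
  measurable_fun setT (fun w => (`|(EFin \o fock_modulus f) w| `^ p)%E).
Proof.
move=> ef; apply: (@measurableT_comp _ _ _ _ _ _ (@poweR R ^~ p)).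
  exact: measurable_poweR.
by apply: measurableT_comp => //; apply/measurable_EFinP; exact: fock_modulus_measurable.
Qed.

Lemma fock_normD p f g : 1 <= p -> entire f -> entire g ->
  (fock_norm p (fun z => f z + g z)%R <= fock_norm p f + fock_norm p g)%E.
Proof.
move=> p1 ef eg; have p0 : 0 < p by rewrite (lt_le_trans _ p1).
have efg := entireD ef eg.
rewrite !fock_normE// -ge0_muleDr ?Lnorm_ge0//.
rewrite lee_pmul2l// ?lte_fin ?fock_cst_gt0//.
apply: (@le_trans _ _
    (Lnorm mu p%:E (EFin \o (fock_modulus f \+ fock_modulus g)%R))%E); last first.
  by apply: eminkowski; rewrite ?lee_fin//; exact: fock_modulus_measurable.
rewrite unlock; apply: gt0_ler_poweR; first by rewrite invr_ge0 ltW.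
- by rewrite in_itv/= leey integral_ge0// => ? _; exact: poweR_ge0.
- by rewrite in_itv/= leey integral_ge0// => ? _; exact: poweR_ge0.
apply: ge0_le_integral => //.
- by move=> ? _; exact: poweR_ge0.
- exact: fock_modulus_powR_measurable.
- apply: (@measurableT_comp _ _ _ _ _ _ (@poweR R ^~ p)).
    exact: measurable_poweR.
  apply: measurableT_comp => //; apply/measurable_EFinP.
  by apply: measurable_funD; exact: fock_modulus_measurable.
- move=> w _; apply: gt0_ler_poweR;
    rewrite ?(ltW p0) ?in_itv/= ?leey ?andbT ?lee_fin ?normr_ge0//.
  rewrite !ger0_norm ?addr_ge0 ?fock_modulus_ge0// /fock_modulus -mulrDl.
  by apply: ler_wpM2r; [exact: expR_ge0|exact: le_normcD].
Qed.

Lemma fock_normZ p (c : C) f : 0 < p -> entire f ->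
  (fock_norm p (fun z => c * f z)%R = (normc c)%:E * fock_norm p f)%E.
Proof.
move=> p0 ef; rewrite !fock_normE// muleCA; congr (_ * _)%E.
rewrite unlock.
rewrite (eq_integral (fun w => (normc c `^ p)%:E * `|(EFin \o fock_modulus f) w| `^ p))%E; last first.
  move=> w _; rewrite /= !ger0_norm ?fock_modulus_ge0// -EFinM -powRM ?normc_ge0 ?fock_modulus_ge0//.
  by rewrite /fock_modulus mulrA -normcM.
rewrite ge0_integralZl//; last 3 first.
- exact: fock_modulus_powR_measurable.
- by move=> ? _; exact: poweR_ge0.
- by rewrite lee_fin powR_ge0.
rewrite poweRM ?lee_fin ?powR_ge0//; last first.
  by apply: integral_ge0 => ? _; exact: poweR_ge0.
by rewrite poweR_EFin -powRrM mulfV ?gt_eqF// powRr1 ?normc_ge0.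
Qed.

Lemma fock_norm0 p : 0 < p -> fock_norm p (fun=> 0) = 0%E.
Proof.
move=> p0; have := fock_normZ 0 p0 entire0; rewrite normc0 mul0e => <-.
by congr fock_norm; apply/funext => z; rewrite mul0r.
Qed.

Lemma fock_norm_eq0 p f : 1 <= p -> entire f -> fock_norm p f = 0%E -> f = 0.
Proof.
move=> p1 ef; have p0 : 0 < p by rewrite (lt_le_trans _ p1).
rewrite fock_normE// => /eqP; rewrite mule_eq0 eqe gt_eqF ?fock_cst_gt0//=.
move=> /eqP/Lnorm_eq0_eq0; rewrite lte_fin => /(_ _ p0).
have mGf : measurable_fun setT (EFin \o fock_modulus f).
  by apply/measurable_EFinP; exact: fock_modulus_measurable.
move=> /(_ mGf) [N [mN N0 GN]].
apply/funext => -[x y]; apply: contrapT => fxy.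
have Gxy : 0 < fock_modulus f (x, y).
  rewrite /fock_modulus mulr_gt0 ?expR_gt0// lt_neqAle normc_ge0 andbT eq_sym.
  by apply/eqP => /eq0_normc.
have cxy : fock_modulus f w @[w --> ((x, y) : R * R)] --> fock_modulus f (x, y).
  exact: fock_modulus_continuous.
have := cvgr_gt _ cxy _ Gxy.
move=> [[A B] /= [/nbhs_ballP[a /= a0 aA] /nbhs_ballP[b /= b0 bB]] AB].
have : (mu (ball x a `*` ball y b) <= mu N)%E.
  apply: le_measure; rewrite ?inE//.
    by apply: measurableX; exact: measurable_ball.
  move=> [u v] /= [xu yv]; apply: GN => /= G0.
  have : fock_modulus f (u, v) > 0 by apply: AB; split => /=; [exact: aA|exact: bB].
  by case: (G0 I) => ->; rewrite ltxx.
rewrite N0 product_measure1E//; last 2 first.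
- exact: measurable_ball.
- exact: measurable_ball.
rewrite [X in (X <= _)%E -> _](_ : _ = (a *+ 2 * (b *+ 2))%:E); last first.
  by rewrite EFinM; congr (_ * _)%E; apply: lebesgue_measure_ball; exact: ltW.
by rewrite lee_fin leNgt mulr_gt0 ?pmulrn_lgt0.
Qed.

(* [1 <= p] is not used by the predicate: it indexes the space so that the
   vector-space and norm instances, which need it, can be inferred. *)
Definition fock_pred (p : R) (p1 : 1 <= p) : {pred C -> C} := mem (fock_set p).

Lemma fock_submod_closed (p : R) (p1 : 1 <= p) : submod_closed (fock_pred p1).
Proof.
have p0 : 0 < p by rewrite (lt_le_trans _ p1).
split.
  by apply: mem_set; split; [exact: entire0|rewrite fock_norm0// ltry].
move=> a f g /set_mem [ef nf] /set_mem [eg ng]; apply: mem_set.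
have nf' : (fock_norm p (fun z => a * f z)%R < +oo)%E.
  rewrite (fock_normZ a p0 ef); apply: lte_mul_pinfty nf.
  - by rewrite lee_fin normc_ge0.
  - exact: fin_numE.
have eaf : entire (fun z => a * f z) by exact: entireZ.
have -> : a *: f + g = (fun z => a * f z + g z) by exact/funext.
split; first exact: entireD.
apply: (le_lt_trans (fock_normD p1 eaf eg)); apply: lte_add_pinfty nf' ng.
Qed.

HB.instance Definition _ (p : R) (p1 : 1 <= p) :=
  GRing.isSubmodClosed.Build C (C -> C) (fock_pred p1) (fock_submod_closed p1).

Record fock (p : R) (p1 : 1 <= p) := Fock {
  fock_fun :> C -> C;
  fockP : fock_fun \in fock_pred p1
}.

Section fock_space.
Variables (p : R) (p1 : 1 <= p).

HB.instance Definition _ := [isSub for @fock_fun p p1].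
HB.instance Definition _ := [Choice of fock p1 by <:].
HB.instance Definition _ := [SubChoice_isSubLmodule of fock p1 by <:].

Let norm (f : fock p1) : C := (fine (fock_norm p f))%:C.

Let p0 : 0 < p. Proof. exact: lt_le_trans p1. Qed.

Lemma fock_entire (f : fock p1) : entire f.
Proof. by have := fockP f; rewrite inE => -[]. Qed.

Lemma fock_fin_num (f : fock p1) : fock_norm p f \is a fin_num.
Proof.
by have := fockP f; rewrite inE ge0_fin_numE ?fock_norm_ge0// => -[].
Qed.

Let normD (f g : fock p1) : norm (f + g) <= norm f + norm g.
Proof.
have D := fock_normD p1 (@fock_entire f) (@fock_entire g).
have fgE : (fun z => f z + g z) = (f + g : fock p1) :> (C -> C) by exact/funext.
rewrite fgE in D.
have S : (fock_norm p f + fock_norm p g)%E \is a fin_num.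
  by rewrite fin_numD; apply/andP; split; exact: fock_fin_num.
by have := fine_le (fock_fin_num (f + g)) S D;
  rewrite fineD ?fock_fin_num// /norm -rmorphD lecR.
Qed.

Let normZ (c : C) (f : fock p1) : norm (c *: f) = `|c| * norm f.
Proof.
have N := fock_normZ c p0 (@fock_entire f).
have cfE : (fun z => c * f z) = (c *: f : fock p1) :> (C -> C) by exact/funext.
rewrite cfE in N.
by rewrite /norm N fineM ?fock_fin_num// rmorphM.
Qed.

Let norm_eq0 (f : fock p1) : norm f = 0 -> f = 0.
Proof.
move=> /(congr1 (@complex.Re R)) /= nf; apply: val_inj.
apply: (fock_norm_eq0 p1 (@fock_entire f)).
by rewrite -(fineK (fock_fin_num f)) nf.
Qed.

HB.instance Definition _ :=
  Lmodule_isNormed.Build C (fock p1) normD normZ norm_eq0.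

Lemma fock_normrE (f : fock p1) : `|f| = (fine (fock_norm p f))%:C.
Proof. by []. Qed.

End fock_space.

Definition weighted_composition (psi phi f : C -> C) : C -> C :=
  fun z => psi z * f (phi z).

Definition mz (psi phi : C -> C) (z : C) : R :=
  normc (psi z) * expR ((normc (phi z) ^+ 2 - normc z ^+ 2) / 2).

(* The filter of [|z| -> +oo]. *)
Definition cinfty : set_system C :=
  filter_from setT (fun r : R => [set z : C | r < normc z]).

End fock.

Section operators.
Variables (R : realType) (X Y : normedModType R[i]).

(* Norms take values in [R[i]], hence the real part. *)
Definition opnorm (T : X -> Y) : \bar R :=
  ereal_sup [set (complex.Re `|T x|)%:E | x in [set x : X | `|x| <= 1]].

Definition bounded_operator (T : X -> Y) := (opnorm T < +oo)%E.

Definition compact_operator (K : X -> Y) :=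
  forall A : set X, bounded_set A -> precompact (K @` A).

Definition essential_norm (L : X -> Y) : \bar R :=
  ereal_inf [set opnorm (fun x => L x - K x) |
             K in [set K : {linear X -> Y} | compact_operator K]].

End operators.

(* Main.v *)
Require Import Defs.
From HB Require Import structures.
From mathcomp Require Import all_boot all_order all_algebra.
From mathcomp Require Import all_classical all_reals all_analysis.
From mathcomp Require Import measurable_realfun lebesgue_integral_fubini.
From mathcomp Require Import complex ring lra.

Set Implicit Arguments.
Unset Strict Implicit.
Unset Printing Implicit Defensive.

Import Order.TTheory GRing.Theory Num.Theory.
Import numFieldNormedType.Exports.
Import Normc.

Local Open Scope classical_set_scope.
Local Open Scope ring_scope.
Local Open Scope complex_scope.

(** With [fmod f z = |f z| e^(-|z|^2/2)], the integrand of the Fock norms is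
    [fmod f ^ p], and [fmod (W f) z = mz psi phi z * fmod f (phi z)]. Both bounds
    are read off from this identity.

    Lower bound ([limsup_mz_le_essential_norm]). The normalized reproducing kernel
    centred at [w], with [fmod] equal to [e^(-|z-w|^2/2)], has norm 1 in every Fock
    space. Evaluating the image under [W] of the kernel centred at [phi z] at the
    point [z] gives [mz psi phi z <= ||W k_(phi z)||]. A compact [K] sends kernels
    centred far away to small vectors, and [phi z] is far away when [z] is, so that
    [mz psi phi z <= ||W - K|| + o(1)]. The decay [||K k_w|| -> 0] is usually
    obtained from weak convergence; [compact_kernel_null] obtains it by summing
    separated kernels: if many of them had nearly the same nonzero image [g], the
    image of the sum of [n] of them would have norm of order [n], whereas the sum
    itself has norm [O(n^(1/p))], and [p > 1].

    Upper bound ([essential_norm_le_limsup_mz]). The Cesaro means [P_n] of the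
    Taylor series have finite rank, are contractions of [F^p], and [P_n f -> f]
    uniformly on compact sets and uniformly over the unit ball. Hence [W o P_n] is
    compact, and for [||f|| <= 1] the remainder [g = f - P_n f] has norm at most 2
    and is small on compact sets. Where [|z| <= r], [W g] is small because [g] is,
    and there only [||psi||_q < oo] matters. Where [|z| > r], [mz psi phi z <= L]
    for any [L] above the limsup, and this part contributes to [||W g||_q ^ q] at
    most [L^q] times the integral of [fmod g (phi z) ^ q], that is
    [L^q |a|^(-2) ||g||_q ^ q], by an affine change of variables. The embedding
    [F^p] in [F^q] has norm at most [(q/p)^(1/q)] ([fock_norm_embed]), and the
    product of these factors is the constant of the theorem.

    The function theory rests on Goursat's theorem for rectangles. Applied to
    [f (e^z) e^(-k z)] over a period rectangle, it shows that the Fourier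
    coefficients of [t |-> f (z e^(it))] are [c_k z^k] for [k >= 0] and vanish for
    [k < 0] ([tcoefP], [tcoefN]); therefore convolution with the Fejer kernel is
    the Cesaro mean ([fejer_meanP]). As an average of rotations it contracts the
    Fock norms, by Jensen's inequality ([fock_norm_fejer_mean]). The mean of
    order 0 is the value at the origin, whence the pointwise bound
    [fmod f z <= ||f||] at [z = 0], and everywhere by Weyl translations
    ([fmod_le_norm]). *)

(** * Complex differentiability and the exponential *)
Section differentiability.
Variable R : realType.
Local Notation C := (cplx R).
Implicit Types (z w : C) (x y t : R).

Lemma normc_Re z : `|complex.Re z| <= normc z.
Proof. by rewrite -lecR; exact: normc_ge_Re. Qed.

Lemma normc_Im z : `|complex.Im z| <= normc z.
Proof.
by case: z => x y /=; rewrite -[leLHS]sqrtr_sqr ler_wsqrtr// lerDr sqr_ge0.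
Qed.

Lemma normc_le_ReIm z : normc z <= `|complex.Re z| + `|complex.Im z|.
Proof.
case: z => x y /=; rewrite -[leRHS]ger0_norm ?addr_ge0// -sqrtr_sqr ler_wsqrtr//.
by rewrite [leRHS]sqrrD !real_normK ?num_real// addrAC lerDl mulrn_wge0 ?mulr_ge0.
Qed.

Lemma normc_sqr z : normc z ^+ 2 = complex.Re z ^+ 2 + complex.Im z ^+ 2.
Proof. by case: z => x y /=; rewrite sqr_sqrtr// addr_ge0// sqr_ge0. Qed.

Lemma normc_real x : normc (x%:C : C) = `|x|.
Proof. by rewrite /= expr0n addr0 sqrtr_sqr. Qed.

Lemma normcX z n : normc (z ^+ n) = normc z ^+ n.
Proof. by elim: n => [|n IH]; rewrite ?expr0 ?normc1// !exprS normcM IH. Qed.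

Lemma normc_sum (I : Type) (s : seq I) (P : pred I) (F : I -> C) :
  normc (\sum_(i <- s | P i) F i) <= \sum_(i <- s | P i) normc (F i).
Proof.
elim/big_ind2 : _ => [|x1 x2 y1 y2 h1 h2|//]; first by rewrite normc0.
by rewrite (le_trans (le_normcD _ _))// lerD.
Qed.

Lemma normc_eq0 z : (normc z == 0) = (z == 0).
Proof. by apply/eqP/eqP => [/eq0_normc//|->]; rewrite normc0. Qed.

Lemma normc_gt0 z : (0 < normc z) = (z != 0).
Proof. by rewrite lt_neqAle normc_ge0 andbT eq_sym normc_eq0. Qed.

Lemma normc_distC z w : normc (z - w) = normc (w - z).
Proof. by rewrite -[in LHS]opprB normcN. Qed.

Lemma nbhs_normc z (P : set C) :
  (\forall w \near nbhs z, P w) <->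
  exists2 d : R, 0 < d & forall w, normc (w - z) < d -> P w.
Proof.
split=> [/nbhs_ballP[/= [d d'] /=]|[d d0 dP]].
  rewrite ltcE /= => /andP[/eqP d'0 d0] dP; exists d => // w wz; apply: dP.
  rewrite -ball_normE /ball_ /= complex_normE normc_distC d'0 ltcR //.
apply/nbhs_ballP; exists (d%:C) => /=; first by rewrite ltcR.
by move=> w; rewrite -ball_normE /ball_ /= complex_normE ltcR normc_distC => /dP.
Qed.

(** Cauchy's increment form of complex differentiability, with the real-valued
    modulus: every estimate below starts from it. *)
Lemma derivable_incrP (f : C -> C) z : derivable f z 1 <->
  exists l : C, forall e : R, 0 < e -> exists2 d : R, 0 < d &
    forall w, normc (w - z) < d ->
      normc (f w - f z - l * (w - z)) <= e * normc (w - z).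
Proof.
split=> [df|[l fl]].
  exists ('D_1 f z) => e e0.
  have /cvgrPdist_le/(_ e%:C) := df.
  rewrite ltcR => /(_ e0)/=; rewrite near_withinE.
  move=> /(@nbhs_normc 0) [d d0 dP]; exists d => // w wz.
  have [->|wz0] := eqVneq w z.
    by rewrite !subrr mulr0 subr0 normc0 mulr0.
  have h0 : w - z != 0 by rewrite subr_eq0.
  have := dP (w - z); rewrite subr0 => /(_ wz h0).
  rewrite complex_normE lecR /GRing.scale /= mulr1 subrK -/(derive f z 1).
  set q := (X in _ - X) => le_q.
  have -> : f w - f z - 'D_1 f z * (w - z) = (q - 'D_1 f z) * (w - z).
    by rewrite mulrBl /q mulrAC mulVf// mul1r.
  by rewrite normcM ler_wpM2r ?normc_ge0// normc_distC.
apply: (cvgP l); apply/cvgrPdist_le => -[e e'].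
rewrite ltcE /= => /andP[/eqP -> e0].
have [d d0 dP] := fl _ e0.
rewrite near_withinE; apply/(@nbhs_normc 0); exists d => // h.
rewrite subr0 => hd h0; have := dP (h + z); rewrite addrK => /(_ hd).
rewrite complex_normE lecR /GRing.scale /= mulr1.
rewrite -ler_pdivrMr ?normc_gt0// -normcV -normcM.
by rewrite mulrBl mulfK// normc_distC mulrC.
Qed.

Lemma entire_comp (f g : C -> C) : entire f -> entire g -> entire (f \o g).
Proof.
move=> ef eg z; apply/derivable1_diffP; apply: differentiable_comp.
  exact/derivable1_diffP/eg.
exact/derivable1_diffP/ef.
Qed.

Lemma entireM (f g : C -> C) :
  entire f -> entire g -> entire (fun z => f z * g z).
Proof. by move=> ef eg z; exact: (@derivableM _ _ f g). Qed.

Lemma entire_id : entire (id : C -> C).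
Proof. by move=> z; exact: derivable_id. Qed.

Lemma entire_cst (c : C) : entire (fun=> c).
Proof. by move=> z; exact: derivable_cst. Qed.

Lemma entireX n : entire (fun z : C => z ^+ n).
Proof.
elim: n => [|n IH]; first exact: (@entire_cst 1).
have -> : (fun z : C => z ^+ n.+1) = (fun z => z * z ^+ n).
  by apply/funext => z; rewrite exprS.
exact: (@entireM id _ entire_id IH).
Qed.

Lemma entire_affine (a b : C) : entire (fun z => a * z + b).
Proof. exact: (@entireD _ _ _ (@entireZ _ a _ entire_id) (@entire_cst b)). Qed.

Lemma entire_sum (I : Type) (s : seq I) (P : pred I) (F : I -> C -> C) :
  (forall i, entire (F i)) -> entire (fun z => \sum_(i <- s | P i) F i z).
Proof.
move=> eF; elim: s => [|i s IH].
  by have := @entire0 R; congr entire; apply/funext => z; rewrite big_nil.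
have -> : (fun z => \sum_(j <- i :: s | P j) F j z) =
    (fun z => (if P i then F i z else 0) + \sum_(j <- s | P j) F j z).
  by apply/funext => z; rewrite big_cons; case: (P i) => //; rewrite add0r.
by apply: entireD IH; case: (P i) => //; exact: entire0.
Qed.

Definition eit t : C := cos t +i* sin t.

Lemma eitD t u : eit (t + u) = eit t * eit u.
Proof. by rewrite /eit cosD sinD; apply/eqP; rewrite eq_complex /= !(eqxx, mulrC, addrC). Qed.

Lemma eit0 : eit 0 = 1.
Proof. by rewrite /eit cos0 sin0. Qed.

Lemma normc_eit t : normc (eit t) = 1.
Proof. by rewrite /= cos2Dsin2 sqrtr1. Qed.

Lemma eit_neq0 t : eit t != 0.
Proof. by rewrite -normc_gt0 normc_eit. Qed.

Lemma eitN t : eit (- t) = (eit t)^-1.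
Proof.
by apply: (mulIf (eit_neq0 t)); rewrite -eitD addNr eit0 mulVf ?eit_neq0.
Qed.

Lemma eitD2pi t : eit (t + pi *+ 2) = eit t.
Proof. by rewrite /eit sinD2pi cosD2pi. Qed.

(** Logarithms of complex numbers come from this; the bound on [t] is what allows
    shifting the circle mean of a periodic function by [t] ([avg_shift]). *)
Lemma eit_surj (u : C) : normc u = 1 -> exists2 t, 0 <= t <= pi *+ 2 & u = eit t.
Proof.
case: u => x y u1; have := normc_sqr (x +i* y); rewrite u1 /= expr1n => /esym xy.
have x1 : -1 <= x <= 1.
  by rewrite -ler_norml -(ler_pXn2r (n := 2)) ?nnegrE// real_normK ?num_real// expr1n -xy lerDl sqr_ge0.
have y2 : 1 - x ^+ 2 = y ^+ 2 by rewrite -xy addrAC subrr add0r.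
have a0 := acos_ge0 x1; have a1 := acos_lepi x1; have p0 := pi_ge0 R.
have [y0|y0] := leP 0 y.
  exists (acos x); first by rewrite a0/= (le_trans a1)// mulr2n lerDl.
  by rewrite /eit acosK ?in_itv// sin_acos// y2 sqrtr_sqr ger0_norm.
exists (- acos x + pi *+ 2).
  by rewrite mulr2n; move: a0 a1 p0; lra.
rewrite eitD2pi /eit cosN sinN acosK ?in_itv// sin_acos// y2.
by rewrite sqrtr_sqr ltr0_norm ?opprK.
Qed.

Definition cexp z : C := (expR (complex.Re z))%:C * eit (complex.Im z).

Lemma cexpD z w : cexp (z + w) = cexp z * cexp w.
Proof.
rewrite /cexp !raddfD /= expRD rmorphM eitD.
by rewrite mulrACA.
Qed.

Lemma cexp0 : cexp 0 = 1.
Proof. by rewrite /cexp /= expR0 eit0 mulr1. Qed.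

Lemma normc_cexp z : normc (cexp z) = expR (complex.Re z).
Proof. by rewrite normcM normc_eit mulr1 normc_real ger0_norm ?expR_ge0. Qed.

Lemma cexp_neq0 z : cexp z != 0.
Proof. by rewrite -normc_gt0 normc_cexp expR_gt0. Qed.

Lemma cexpN z : cexp (- z) = (cexp z)^-1.
Proof.
by apply: (mulIf (cexp_neq0 z)); rewrite -cexpD addNr cexp0 mulVf ?cexp_neq0.
Qed.

Lemma cexp_surj z : z != 0 -> exists2 w, 0 <= complex.Im w <= pi *+ 2 & z = cexp w.
Proof.
rewrite -normc_gt0 => z0; have [|t t0 zt] := @eit_surj ((normc z)^-1%:C * z).
  by rewrite normcM normc_real ger0_norm ?invr_ge0 ?ltW// mulVf ?gt_eqF.
exists (ln (normc z) +i* t) => //; rewrite /cexp /= lnK ?posrE// -zt mulrA -rmorphM.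
by rewrite divff ?gt_eqF// mul1r.
Qed.

Lemma real_incr (g : R -> R) x l : is_derive x 1 g l ->
  forall e : R, 0 < e -> exists2 d : R, 0 < d &
    forall h : R, `|h| < d -> `|g (h + x) - g x - l * h| <= e * `|h|.
Proof.
move=> [dg dl] e e0.
have /cvgrPdist_le/(_ e e0) := dg; rewrite near_withinE.
move=> /nbhs_ballP[d /= d0 dP]; exists d => // h hd.
have [->|h0] := eqVneq h 0; first by rewrite add0r subrr mulr0 subr0 normr0 mulr0.
have := dP h; rewrite /ball /= sub0r normrN => /(_ hd h0).
rewrite /GRing.scale /= mulr1 -[X in X - _]/(derive g x 1) dl => le_q.
have -> : g (h + x) - g x - l * h = (h^-1 * (g (h + x) - g x) - l) * h.
  by rewrite mulrBl mulrAC mulVf// mul1r.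
by rewrite normrM ler_wpM2r// distrC.
Qed.

(** Since [cexp (z + h) = cexp z * cexp h], only the increment at 0 matters, and
    there it splits into the increments of [expR], [cos] and [sin] at 0 and
    products of these, which are of second order. The factor 9 counts the error
    terms. *)
Lemma cexp_entire : entire cexp.
Proof.
move=> z; apply/derivable_incrP; exists (cexp z) => e e0.
pose n : R := normc (cexp z).
have n0 : 0 < n by rewrite normc_gt0 cexp_neq0.
pose e1 : R := Num.min 1 (e / n / 9).
have e10 : 0 < e1 by rewrite lt_min ltr01 !divr_gt0.
have e11 : e1 <= 1 by rewrite ge_min lexx.
have e1e : e1 * 9 <= e / n by rewrite -ler_pdivlMr// ge_min lexx orbT.
clearbody e1.
have [d1 d10 Hexp] := real_incr (is_derive_expR 0) e10.
have [d2 d20 Hcos] := real_incr (is_derive_cos 0) e10.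
have [d3 d30 Hsin] := real_incr (is_derive_sin 0) e10.
exists (Num.min e1 (Num.min d1 (Num.min d2 d3))); first by rewrite !lt_min e10 d10 d20 d30.
move=> w; rewrite !lt_min => /and4P[we w1 w2 w3].
set h := w - z in we w1 w2 w3 *.
have -> : w = z + h by rewrite /h addrC subrK.
rewrite cexpD -[X in _ - X - _]mulr1 -!mulrBr normcM.
have := normc_Re h; have := normc_Im h; have := normc_ge0 h.
rewrite -/n; move: we w1 w2 w3; set N : R := normc h.
rewrite /cexp; clearbody N h.
case: h => x y we w1 w2 w3 N0 yN xN.
rewrite /= in yN xN.
have := Hexp x (le_lt_trans xN w1).
have := Hcos y (le_lt_trans yN w2).
have := Hsin y (le_lt_trans yN w3).
rewrite expR0 cos0 sin0 !(oppr0, mul0r, addr0, subr0, mul1r).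
move=> Hs Hc He.
rewrite -ler_pdivlMl// mulrA [n^-1 * e]mulrC.
apply: le_trans (_ : e1 * 9 * N <= _); last by rewrite ler_wpM2r.
apply: le_trans (normc_le_ReIm _) _.
rewrite /= !(mul0r, subr0, addr0, oppr0).
have Hs' : `|sin y| <= 2 * N.
  have -> : sin y = (sin y - y) + y by rewrite subrK.
  apply: le_trans (ler_normD _ _) _; have := ler_pM (ltW e10) (normr_ge0 y) e11 yN.
  by move: Hs yN; rewrite mul1r; lra.
have Hx : `|expR x - 1| <= 2 * N.
  have -> : expR x - 1 = (expR x - 1 - x) + x by rewrite subrK.
  apply: le_trans (ler_normD _ _) _; have := ler_pM (ltW e10) (normr_ge0 x) e11 xN.
  by move: He xN; rewrite mul1r; lra.
have -> : expR x * cos y - 1 - x =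
   (expR x - 1 - x) + (cos y - 1) + (expR x - 1) * (cos y - 1) by ring.
have -> : expR x * sin y - y = (sin y - y) + (expR x - 1) * sin y by ring.
have P1 : `|(expR x - 1) * (cos y - 1)| <= (2 * N) * (e1 * N).
  by rewrite normrM ler_pM// (le_trans Hc)// ler_wpM2l// ltW.
have P2 : `|(expR x - 1) * sin y| <= (2 * N) * (2 * N).
  by rewrite normrM ler_pM.
have T1 := ler_normD (expR x - 1 - x + (cos y - 1)) ((expR x - 1) * (cos y - 1)).
have T2 := ler_normD (expR x - 1 - x) (cos y - 1).
have T3 := ler_normD (sin y - y) ((expR x - 1) * sin y).
have eN : e1 * N <= N by rewrite ler_piMl.
have xe : e1 * `|x| <= e1 * N by rewrite ler_wpM2l// ltW.
have ye : e1 * `|y| <= e1 * N by rewrite ler_wpM2l// ltW.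
have NN : N * N <= e1 * N by rewrite ler_wpM2r// ltW.
have eNN : N * (e1 * N) <= e1 * N.
  rewrite mulrC -mulrA ler_wpM2l ?(ltW e10)//; rewrite -[leRHS]mul1r ler_wpM2r//.
  by rewrite (le_trans (ltW we)).
move: T1 T2 T3 P1 P2 Hs Hc He xe ye NN eNN; lra.
Qed.

Lemma continuous_Re : continuous (@complex.Re R : C -> R).
Proof.
move=> z; apply/(@cvgrPdist_le _ _ _ (nbhs z)) => e e0; apply/nbhs_normc; exists e => // w wz.
by rewrite -raddfB (le_trans (normc_Re (z - w)))// normc_distC ltW.
Qed.

Lemma continuous_Im : continuous (@complex.Im R : C -> R).
Proof.
move=> z; apply/(@cvgrPdist_le _ _ _ (nbhs z)) => e e0; apply/nbhs_normc; exists e => // w wz.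
by rewrite -raddfB (le_trans (normc_Im (z - w)))// normc_distC ltW.
Qed.

Lemma continuous_mkC (T : topologicalType) (u v : T -> R) :
  continuous u -> continuous v -> continuous (fun a : T => (u a +i* v a) : C).
Proof.
move=> cu cv t.
apply: (@continuous_comp _ _ _ (fun a : T => (u a, v a)) (fun w : R * R => (w.1 +i* w.2) : C)).
  by apply: (@cvg_pair _ _ _ _ (nbhs (u t)) (nbhs (v t))); [exact: cu|exact: cv].
exact: continuous_complex_of_pair.
Qed.

Lemma continuous_eit : continuous eit.
Proof. by apply: continuous_mkC; [exact: continuous_cos|exact: continuous_sin]. Qed.

Lemma continuousMC (T : topologicalType) (f g : T -> C) :
  continuous f -> continuous g -> continuous (fun a : T => f a * g a).
Proof. by move=> cf cg t; apply: (@cvgM _ _ (nbhs t) _ f g); [exact: cf|exact: cg]. Qed.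

Lemma continuous_cstC (T : topologicalType) (c : C) : continuous (fun _ : T => c).
Proof. by move=> t; exact: cvg_cst. Qed.

Lemma continuous_compC (T : topologicalType) (V : topologicalType) (f : C -> V) (g : T -> C) :
  continuous f -> continuous g -> continuous (fun a : T => f (g a)).
Proof. by move=> cf cg t; apply: (@continuous_comp _ _ _ g f); [exact: cg|exact: cf]. Qed.

End differentiability.

(** * Goursat's theorem on rectangles *)
Section bisection.
Variable R : realType.
Implicit Types (s t r : R).

(** Goursat's bisection argument for an additive function [I] of rectangles: if
    [I] did not vanish on the initial rectangle, then some quarter would carry at
    least a quarter of its absolute value, and the nested rectangles obtained in
    this way would contradict [|I| = o(area)] at their common point. Additivity is
    all that is needed, so that no integral enters here. *)
Lemma bisection_eq0 (I : R -> R -> R -> R -> R) (l1 l2 s0 t0 : R) :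
  0 < l1 -> 0 < l2 ->
  (forall a b c x y : R, a <= b -> b <= c -> x <= y ->
    I a c x y = I a b x y + I b c x y) ->
  (forall a b c x y : R, a <= b -> b <= c -> x <= y ->
    I x y a c = I x y a b + I x y b c) ->
  (forall s t (k : R), 0 < k -> exists2 d : R, 0 < d &
    forall s1 t1 r, 0 < r -> r < d ->
      s1 <= s <= s1 + r * l1 -> t1 <= t <= t1 + r * l2 ->
      `|I s1 (s1 + r * l1) t1 (t1 + r * l2)| <= k * r ^+ 2) ->
  I s0 (s0 + l1) t0 (t0 + l2) = 0.
Proof.
move=> l10 l20 addh addv loc; apply/eqP/contraT => I0.
(* half of the value, so that the first rectangle is bad with a strict inequality *)
pose k : R := `|I s0 (s0 + l1) t0 (t0 + l2)| / 2.
have k0 : 0 < k by rewrite divr_gt0 ?normr_gt0.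
pose r n : R := 2^-1 ^+ n.
have r0 n : 0 < r n by rewrite exprn_gt0.
have rS n : r n = r n.+1 + r n.+1 by rewrite /r exprS; lra.
pose J r (x : R * R) := I x.1 (x.1 + r * l1) x.2 (x.2 + r * l2).
pose bad n (x : R * R) := k * r n ^+ 2 < `|J (r n) x|.
have step n x : bad n x -> exists y, [/\ bad n.+1 y,
    x.1 <= y.1 <= x.1 + r n.+1 * l1 & x.2 <= y.2 <= x.2 + r n.+1 * l2].
  case: x => s t; rewrite /bad => bx; set p := r n.+1.
  have p0 : 0 < p := r0 _.
  have pl1 : 0 < p * l1 by rewrite mulr_gt0.
  have pl2 : 0 < p * l2 by rewrite mulr_gt0.
  have JE : J (r n) (s, t) = J p (s, t) + J p (s + p * l1, t)
      + (J p (s, t + p * l2) + J p (s + p * l1, t + p * l2)).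
    rewrite /J /= rS -/p !mulrDl !addrA.
    have le1 x (q : R) : 0 < q -> x <= x + q by move=> /ltW; rewrite lerDl.
    have s2 : s <= s + p * l1 + p * l1 by rewrite (le_trans (le1 _ _ pl1)) ?le1.
    rewrite (addv t (t + p * l2)) ?le1//.
    rewrite (addh s (s + p * l1) _ t) ?le1//.
    by rewrite (addh s (s + p * l1) _ (t + p * l2)) ?le1// !addrA.
  apply: contrapT => nex.
  have small y : s <= y.1 <= s + p * l1 -> t <= y.2 <= t + p * l2 ->
      `|J p y| <= k * p ^+ 2.
    by move=> y1 y2; rewrite leNgt; apply/negP => by_; apply: nex; exists y.
  move: bx; rewrite ltNge => /negP; apply; rewrite JE rS -/p.
  have H1 := small (s, t); have H2 := small (s + p * l1, t).
  have H3 := small (s, t + p * l2); have H4 := small (s + p * l1, t + p * l2).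
  move: H1 H2 H3 H4; rewrite /= !lexx !lerDl (ltW pl1) (ltW pl2).
  move=> /(_ isT isT) H1 /(_ isT isT) H2 /(_ isT isT) H3 /(_ isT isT) H4.
  have -> : k * (p + p) ^+ 2 =
    k * p ^+ 2 + k * p ^+ 2 + (k * p ^+ 2 + k * p ^+ 2) by ring.
  by do ![rewrite (le_trans (ler_normD _ _))// lerD//].
pose next n x := if pselect (bad n x) is left h then sval (cid (step n x h)) else x.
pose u := fix u n := if n is m.+1 then next m (u m) else (s0, t0).
have bu n : bad n (u n).
  elim: n => [|n IH] /=.
    rewrite /bad /J /r expr0 !mul1r /= expr1n mulr1 /k.
    by rewrite ltr_pdivrMr// ltr_pMr ?normr_gt0// ltr1n.
  rewrite /next; case: pselect => // b; by case: cid => y /= [].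
have su n : (u n).1 <= (u n.+1).1 <= (u n).1 + r n.+1 * l1 /\
            (u n).2 <= (u n.+1).2 <= (u n).2 + r n.+1 * l2.
  rewrite /= /next; case: pselect => [b|/(_ (bu n))//]; by case: cid => y /= [].
(* the common point is the supremum of the left ends *)
have nest (v : nat -> R) l : 0 < l ->
    (forall n, v n <= v n.+1 <= v n + r n.+1 * l) ->
    exists x, forall n, v n <= x <= v n + r n * l.
  move=> l0 hv.
  have up : {homo v : m n / (m <= n)%N >-> m <= n}.
    by apply: homo_leq => [x|y x z|n]; [exact: lexx|exact: le_trans|case/andP: (hv n)].
  have down : {homo (fun n => v n + r n * l) : m n / (m <= n)%N >-> n <= m}.
    apply: homo_leq => [x|y x z|n]; [exact: lexx|by move=> /[swap]; exact: le_trans|].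
    by rewrite [in leRHS]rS mulrDl addrA lerD2r; case/andP: (hv n).
  have ub m n : v n <= v m + r m * l.
    have rl j : v j <= v j + r j * l by rewrite lerDl mulr_ge0 ?ltW.
    case: (leqP m n) => mn; first exact: le_trans (rl n) (down _ _ mn).
    exact: le_trans (up _ _ (ltnW mn)) (rl m).
  exists (sup (range v)) => n; apply/andP; split.
    by apply: ub_le_sup; [exists (v 0 + r 0 * l) => _ [j _ <-]|exists n].
  by apply: ge_sup; [exists (v 0), 0%N|move=> _ [j _ <-]].
have [s hs] := nest (fun n => (u n).1) _ l10 (fun n => (su n).1).
have [t ht] := nest (fun n => (u n).2) _ l20 (fun n => (su n).2).
have [d d0 hd] := loc s t k k0.
have [n rn] : exists n, r n < d.
  have : r n @[n --> \oo] --> 0.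
    by apply: cvg_expr; rewrite ger0_norm ?invr_ge0// invf_lt1// ltr1n.
  by move=> /cvgr_lt/(_ d d0) [n _ nd]; exists n; exact: (nd n (leqnn n)).
have := hd _ _ _ (r0 n) rn (hs n) (ht n).
by move=> /le_lt_trans/(_ (bu n)); rewrite ltxx.
Qed.

End bisection.

Section interval_integral.
Variable R : realType.
Implicit Types (a b c x y k M : R) (f g : R -> R).

Definition ri f a b : R := \int[lebesgue_measure]_(x in `[a, b]) f x.

Lemma ri_integrable f a b : continuous f ->
  (@lebesgue_measure R).-integrable `[a, b] (EFin \o f).
Proof.
move=> cf; apply: continuous_compact_integrable; first exact: segment_compact.
exact: continuous_subspaceT.
Qed.

Lemma ri_cat f a b c : continuous f -> a <= b -> b <= c ->
  ri f a c = ri f a b + ri f b c.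
Proof.
move=> cf ab bc; have := @Rintegral_itvB _ f (BLeft a) (BRight c) b.
move=> /(_ (ri_integrable _ _ cf)); rewrite !bnd_simp => /(_ ab bc).
rewrite Rintegral_itv_obnd_cbnd; last first.
  apply: (integrableS _ _ _ (ri_integrable b c cf)) => //.
  by apply: subset_itvr; rewrite bnd_simp.
by move=> /eqP; rewrite subr_eq addrC => /eqP.
Qed.

Lemma riD f g a b : continuous f -> continuous g ->
  ri (fun x => f x + g x) a b = ri f a b + ri g a b.
Proof. by move=> cf cg; apply: RintegralD => //; exact: ri_integrable. Qed.

Lemma riB f g a b : continuous f -> continuous g ->
  ri (fun x => f x - g x) a b = ri f a b - ri g a b.
Proof. by move=> cf cg; apply: RintegralB => //; exact: ri_integrable. Qed.

Lemma riZ k f a b : continuous f -> ri (fun x => k * f x) a b = k * ri f a b.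
Proof. by move=> cf; apply: RintegralZl => //; exact: ri_integrable. Qed.

Lemma ri_cst k a b : a <= b -> ri (fun=> k) a b = k * (b - a).
Proof.
move=> ab; rewrite /ri Rintegral_cst//; congr (_ * _).
by rewrite [X in fine X]lebesgue_measure_itv /= lte_fin; case: ltgtP ab => //= -> _; rewrite subrr.
Qed.

Lemma ler_ri f g a b : continuous f -> continuous g ->
  (forall x, a <= x <= b -> f x <= g x) -> ri f a b <= ri g a b.
Proof.
move=> cf cg fg; apply: le_Rintegral => //; do ?exact: ri_integrable.
Qed.

(** The integral of a function close to a constant; the circulation of a form
    around a small rectangle is estimated with it. *)
Lemma ri_dist f k M a b : continuous f -> a <= b ->
  (forall x, a <= x <= b -> `|f x - k| <= M) ->
  `|ri f a b - k * (b - a)| <= M * (b - a).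
Proof.
move=> cf ab fM; have cc c : continuous (fun _ : R => c) by move=> ?; exact: cvg_cst.
rewrite ler_norml lerBrDr lerBlDr -mulNr -!mulrDl -!ri_cst//; apply/andP; split.
  apply: ler_ri => // x /fM; rewrite ler_norml => /andP[+ _].
  by rewrite lerBrDr.
apply: ler_ri => // x /fM; rewrite ler_norml => /andP[_].
by rewrite lerBlDr.
Qed.

End interval_integral.

Section goursat.
Variable R : realType.
Local Notation C := (cplx R).
Implicit Types (s t : R).

(** Green's formula for a closed form with merely differentiable
    coefficients: [P ds + Q dt] with [P_t = Q_s] has no circulation. The first
    order part of the form is exact and drops out of the circulation around a
    rectangle, which leaves [o(area)]; bisection then applies. The number [c] is
    the common value of [P_t] and [Q_s] at the point. *)
Lemma circulation_eq0 (P Q : R -> R -> R) s0 t0 l1 l2 :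
  0 < l1 -> 0 < l2 ->
  (forall t, continuous (P ^~ t)) -> (forall s, continuous (Q s)) ->
  (forall s t : R, exists a b c : R, forall e : R, 0 < e ->
     exists2 d : R, 0 < d & forall x y : R, `|x - s| < d -> `|y - t| < d ->
      `|P x y - P s t - a * (x - s) - c * (y - t)| <= e * (`|x - s| + `|y - t|) /\
      `|Q x y - Q s t - c * (x - s) - b * (y - t)| <= e * (`|x - s| + `|y - t|)) ->
  ri (fun s => P s t0 - P s (t0 + l2)) s0 (s0 + l1) +
  ri (fun t => Q (s0 + l1) t - Q s0 t) t0 (t0 + l2) = 0.
Proof.
move=> l10 l20 cP cQ dPQ.
have cP2 t t' : continuous (fun s => P s t - P s t').
  by move=> x; apply: cvgB; exact: cP.
have cQ2 s s' : continuous (fun t => Q s t - Q s' t).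
  by move=> x; apply: cvgB; exact: cQ.
apply: (@bisection_eq0 _ (fun a b x y => ri (fun s => P s x - P s y) a b +
    ri (fun t => Q b t - Q a t) x y)) => //.
- move=> a b c x y ab bc xy.
  rewrite (ri_cat _ ab bc)//.
  have -> : (fun t => Q c t - Q a t) = (fun t => (Q b t - Q a t) + (Q c t - Q b t)).
    by apply/funext => t; ring.
  by rewrite (riD _ _ (cQ2 b a) (cQ2 c b)); ring.
- move=> a b c x y ab bc xy.
  rewrite (ri_cat _ ab bc)//.
  have -> : (fun s => P s a - P s c) = (fun t => (P t a - P t b) + (P t b - P t c)).
    by apply/funext => t; ring.
  by rewrite (riD _ _ (cP2 a b) (cP2 b c)); ring.
move=> s t k k0; have [a [b [c H]]] := dPQ s t.
pose L := l1 + l2; have L0 : 0 < L by rewrite addr_gt0.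
(* the two pairs of sides contribute [2 e r L * r l1] and [2 e r L * r l2], in all
   [2 e (r L) ^ 2 = k r ^ 2] *)
pose e := k / (2 * L ^+ 2).
have e0 : 0 < e by rewrite divr_gt0// mulr_gt0// exprn_gt0.
have [d d0 {}H] := H e e0.
exists (d / L); first by rewrite divr_gt0.
move=> s1 t1 r r0; rewrite ltr_pdivlMr// => rd sr tr.
set s2 := s1 + r * l1; set t2 := t1 + r * l2.
have rl1 : 0 < r * l1 by rewrite mulr_gt0.
have rl2 : 0 < r * l2 by rewrite mulr_gt0.
have near x y : s1 <= x <= s2 -> t1 <= y <= t2 ->
    `|P x y - P s t - a * (x - s) - c * (y - t)| <= e * (r * L) /\
    `|Q x y - Q s t - c * (x - s) - b * (y - t)| <= e * (r * L).
  move=> xs yt.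
  have dx : `|x - s| <= r * l1.
    by rewrite ler_norml; move: xs sr; rewrite /s2; lra.
  have dy : `|y - t| <= r * l2.
    by rewrite ler_norml; move: yt tr; rewrite /t2; lra.
  have [||h1 h2] := H x y.
  - by apply: le_lt_trans rd; rewrite (le_trans dx)// ler_pM2l// /L lerDl ltW.
  - by apply: le_lt_trans rd; rewrite (le_trans dy)// ler_pM2l// /L lerDr ltW.
  have eL : e * (`|x - s| + `|y - t|) <= e * (r * L).
    by rewrite ler_pM2l// /L mulrDr lerD.
  by split; [exact: le_trans h1 eL|exact: le_trans h2 eL].
have s12 : s1 <= s2 by rewrite lerDl ltW.
have t12 : t1 <= t2 by rewrite lerDl ltW.
have B1 := @ri_dist _ _ (c * (t1 - t2)) (e * (r * L) + e * (r * L)) _ _ (cP2 t1 t2) s12.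
have B2 := @ri_dist _ _ (c * (s2 - s1)) (e * (r * L) + e * (r * L)) _ _ (cQ2 s2 s1) t12.
have {}B1 := B1 _; have {}B2 := B2 _.
have {}B1 : `|ri (fun x => P x t1 - P x t2) s1 s2 - c * (t1 - t2) * (s2 - s1)| <=
    (e * (r * L) + e * (r * L)) * (s2 - s1).
  apply: B1 => x xs.
  have [h1 _] := near x t1 xs ltac:(by rewrite lexx).
  have [h2 _] := near x t2 xs ltac:(by rewrite lexx t12).
  have -> : P x t1 - P x t2 - c * (t1 - t2) =
    (P x t1 - P s t - a * (x - s) - c * (t1 - t)) - (P x t2 - P s t - a * (x - s) - c * (t2 - t)).
    by ring.
  by rewrite (le_trans (ler_normB _ _))// lerD.
have {}B2 : `|ri (fun y => Q s2 y - Q s1 y) t1 t2 - c * (s2 - s1) * (t2 - t1)| <=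
    (e * (r * L) + e * (r * L)) * (t2 - t1).
  apply: B2 => y yt.
  have [_ h1] := near s2 y ltac:(by rewrite lexx s12) yt.
  have [_ h2] := near s1 y ltac:(by rewrite lexx) yt.
  have -> : Q s2 y - Q s1 y - c * (s2 - s1) =
    (Q s2 y - Q s t - c * (s2 - s) - b * (y - t)) - (Q s1 y - Q s t - c * (s1 - s) - b * (y - t)).
    by ring.
  by rewrite (le_trans (ler_normB _ _))// lerD.
have -> : ri (fun x => P x t1 - P x t2) s1 s2 + ri (fun y => Q s2 y - Q s1 y) t1 t2 =
  (ri (fun x => P x t1 - P x t2) s1 s2 - c * (t1 - t2) * (s2 - s1)) +
  (ri (fun y => Q s2 y - Q s1 y) t1 t2 - c * (s2 - s1) * (t2 - t1)) by ring.
apply: le_trans (ler_normD _ _) _; apply: le_trans (lerD B1 B2) _.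
rewrite -mulrDr /s2 /t2 !(addrC _ (r * _)) !addrK -mulrDr -/L.
rewrite le_eqVlt; apply/orP; left; apply/eqP.
have L1 : L != 0 by rewrite gt_eqF.
have -> : (r * l1 + r * l2) = r * L by rewrite -mulrDr.
by rewrite /e; clearbody L; field.
Qed.

Lemma entire_cont_ReIm (f : C -> C) : entire f -> forall s t,
  [/\ continuous (fun s => complex.Re (f (s +i* t))),
      continuous (fun t => complex.Re (f (s +i* t))),
      continuous (fun s => complex.Im (f (s +i* t))) &
      continuous (fun t => complex.Im (f (s +i* t)))].
Proof.
move=> ef s t; have cf := entire_continuous ef.
have c1 : continuous (fun s : R => (s +i* t) : C).
  by apply: continuous_mkC => x; [exact: cvg_id|exact: cvg_cst].
have c2 : continuous (fun t : R => (s +i* t) : C).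
  by apply: continuous_mkC => x; [exact: cvg_cst|exact: cvg_id].
have cr := continuous_compC (@continuous_Re R) cf.
have ci := continuous_compC (@continuous_Im R) cf.
split; [exact: (continuous_compC cr c1) | exact: (continuous_compC cr c2) |
        exact: (continuous_compC ci c1) | exact: (continuous_compC ci c2)].
Qed.

(** Goursat's theorem, real part: for [f = u + iv] the form [u ds - v dt] is
    closed by the Cauchy-Riemann equations. *)
Lemma goursat_Re (f : C -> C) s0 t0 l1 l2 : entire f -> 0 < l1 -> 0 < l2 ->
  ri (fun s => complex.Re (f (s +i* t0)) - complex.Re (f (s +i* (t0 + l2)))) s0 (s0 + l1) =
  ri (fun t => complex.Im (f ((s0 + l1) +i* t)) - complex.Im (f (s0 +i* t))) t0 (t0 + l2).
Proof.
move=> ef l10 l20; apply/eqP; rewrite -subr_eq0; apply/eqP.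
pose P s t := complex.Re (f (s +i* t)).
pose Q s t := - complex.Im (f (s +i* t)).
have cQ s : continuous (Q s).
  by case: (entire_cont_ReIm ef s 0) => _ _ _ c t; apply: cvgN; exact: c.
rewrite -[RHS](@circulation_eq0 P Q s0 t0 l1 l2 l10 l20) //; first last.
- move=> s t; have [l fl] := (derivable_incrP f (s +i* t)).1 (ef _).
  exists (complex.Re l), (- complex.Re l), (- complex.Im l) => e e0.
  have [d d0 {}fl] := fl e e0; exists (d / 2); first by rewrite divr_gt0.
  move=> x y xd yd; set w : C := (x +i* y) - (s +i* t).
  have wxy : normc w <= `|x - s| + `|y - t| by exact: normc_le_ReIm.
  have wd : normc w < d.
    by apply: le_lt_trans wxy _; rewrite (splitr d) ltrD.
  have := fl (x +i* y) wd; set r := (X in normc X) => rw.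
  have {}rw : normc r <= e * (`|x - s| + `|y - t|).
    by apply: le_trans rw _; rewrite ler_pM2l.
  split.
    apply: le_trans rw; apply: le_trans (normc_Re r); rewrite /r /P.
    by case: (f _) => ? ?; case: (f _) => ? ?; case: l {fl r} => ? ? /=; rewrite le_eqVlt; apply/orP; left; apply/eqP; congr (`|_|); ring.
  apply: le_trans rw; apply: le_trans (normc_Im r); rewrite /r /Q -normrN.
  by case: (f _) => ? ?; case: (f _) => ? ?; case: l {fl r} => ? ? /=; rewrite le_eqVlt; apply/orP; left; apply/eqP; congr (`|_|); ring.
- by move=> t; case: (entire_cont_ReIm ef 0 t).
congr (_ + _); rewrite -mulN1r -riZ; last first.
  have [_ _ _ c1] := entire_cont_ReIm ef (s0 + l1) 0.
  have [_ _ _ c2] := entire_cont_ReIm ef s0 0.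
  by move=> t; apply: cvgB; [exact: c1|exact: c2].
by congr ri; apply/funext => t; rewrite /Q mulN1r opprB opprK addrC.
Qed.

End goursat.

(** * Circle means of entire functions *)
Section circle_mean.
Variable R : realType.
Local Notation C := (cplx R).
Local Notation tau := (pi *+ 2 : R).
Implicit Types (f g : R -> R) (u v : R -> C) (a k M s t : R) (z : C).

Lemma tau_gt0 : 0 < tau.
Proof. by rewrite pmulrn_lgt0// pi_gt0. Qed.

Definition avg f : R := tau^-1 * ri f 0 tau.

Lemma avgD f g : continuous f -> continuous g ->
  avg (fun t => f t + g t) = avg f + avg g.
Proof. by move=> cf cg; rewrite /avg riD// mulrDr. Qed.

Lemma avgZ k f : continuous f -> avg (fun t => k * f t) = k * avg f.
Proof. by move=> cf; rewrite /avg riZ// mulrCA. Qed.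

Lemma avg_cst k : avg (fun=> k) = k.
Proof.
by rewrite /avg ri_cst ?(ltW tau_gt0)// subr0 mulrCA mulVf ?mulr1// gt_eqF ?tau_gt0.
Qed.

Lemma ler_avg f g : continuous f -> continuous g ->
  (forall t, f t <= g t) -> avg f <= avg g.
Proof.
move=> cf cg fg; rewrite /avg ler_wpM2l ?invr_ge0 ?(ltW tau_gt0)//.
exact: ler_ri.
Qed.

Lemma continuous_cstR (T V : topologicalType) (k : V) : continuous (fun _ : T => k).
Proof. by move=> ?; exact: cvg_cst. Qed.

Lemma avg_ge0 f : continuous f -> (forall t, 0 <= f t) -> 0 <= avg f.
Proof. by move=> cf f0; rewrite -[leLHS]avg_cst; apply: ler_avg => //; exact: continuous_cstR. Qed.

(** Circle means have to be shifted because a point [z <> 0] enters as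
    [exp w], where the imaginary part of [w] translates the angle. *)
Lemma ri_shift f a b c : a <= b -> continuous f ->
  ri f (a + c) (b + c) = ri (fun t => f (t + c)) a b.
Proof.
move=> ab cf; rewrite /ri /Rintegral.
have dF (x : R) : is_derive x 1 (fun t => t + c) 1.
  by have := is_deriveD (is_derive_id x (1 : R)) (is_derive_cst c x 1); rewrite addr0.
have dE : derive1 (fun t : R => t + c) = (fun=> 1).
  by apply/funext => x; rewrite derive1E derive_val.
have cF : continuous (fun t : R => t + c).
  by move=> x; apply: cvgD; [exact: cvg_id|exact: cvg_cst].
rewrite (@integration_by_substitution_increasing _ (fun t => t + c) f a b ab).
- congr fine; apply: eq_integral => x _; congr EFin.
  by rewrite /= dE /GRing.mul /= mulr1.
- by move=> x y _ _ xy; rewrite ltrD2r.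
- by move=> x _; rewrite dE; exact: continuous_cstR.
- by rewrite dE; exact: is_cvg_cst.
- by rewrite dE; exact: is_cvg_cst.
- split=> [x _| |]; first exact: ex_derive.
  + exact: cvg_at_right_filter (cF a).
  + exact: cvg_at_left_filter (cF b).
- exact: continuous_subspaceT.
Qed.

Lemma avg_shift f a : continuous f -> (forall t, f (t + tau) = f t) ->
  0 <= a <= tau -> avg (fun t => f (t + a)) = avg f.
Proof.
move=> cf pf /andP[a0 a1]; rewrite /avg -ri_shift// ?(ltW tau_gt0)// add0r; congr (_ * _).
have E : ri f tau (tau + a) = ri f 0 a.
  rewrite -[X in ri f X _]add0r [in X in ri f _ X]addrC ri_shift//.
  by congr ri; apply/funext => t.
by rewrite (ri_cat (b := tau) cf) ?lerDl// E (ri_cat cf a0 a1) addrC.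
Qed.

Definition avgC u : C := avg (fun t => complex.Re (u t)) +i* avg (fun t => complex.Im (u t)).

Let cRe u : continuous u -> continuous (fun t => complex.Re (u t)).
Proof. exact: continuous_compC (@continuous_Re R). Qed.

Let cIm u : continuous u -> continuous (fun t => complex.Im (u t)).
Proof. exact: continuous_compC (@continuous_Im R). Qed.

Lemma eq_avgC u v : u =1 v -> avgC u = avgC v.
Proof. by move=> /funext ->. Qed.

Lemma avgCD u v : continuous u -> continuous v ->
  avgC (fun t => u t + v t) = avgC u + avgC v.
Proof.
move=> cu cv; rewrite /avgC.
under [X in avg X +i* _]eq_fun do rewrite raddfD.
under [X in _ +i* avg X]eq_fun do rewrite raddfD.
by rewrite !avgD//; do ?[exact: cRe|exact: cIm].
Qed.

Lemma avgCZ z u : continuous u -> avgC (fun t => z * u t) = z * avgC u.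
Proof.
move=> cu; have cr := cRe cu; have ci := cIm cu; rewrite /avgC; case: z => x y.
have cZ k f : continuous f -> continuous (fun t => k * f t).
  by move=> cf t; apply: cvgM; [exact: cvg_cst|exact: cf].
have -> : (fun t => complex.Re ((x +i* y) * u t)) =
  (fun t => x * complex.Re (u t) + (- y) * complex.Im (u t)).
  by apply/funext => t; case: (u t) => ? ? /=; rewrite mulNr.
have -> : (fun t => complex.Im ((x +i* y) * u t)) =
  (fun t => x * complex.Im (u t) + y * complex.Re (u t)).
  by apply/funext => t; case: (u t) => ? ? /=.
by rewrite !avgD ?avgZ//; do ?exact: cZ; rewrite mulNr.
Qed.

Lemma avgC_cst z : avgC (fun=> z) = z.
Proof. by rewrite /avgC !avg_cst; case: z. Qed.

Lemma continuous_normcC u : continuous u -> continuous (fun t => normc (u t)).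
Proof. exact: continuous_compC (@continuous_normc R). Qed.

(** Multiplying by a unimodular constant makes the mean real, and then only real
    parts have to be compared. *)
Lemma normc_avgC u : continuous u -> normc (avgC u) <= avg (fun t => normc (u t)).
Proof.
move=> cu; have [->|w0] := eqVneq (avgC u) 0.
  by rewrite normc0; apply: avg_ge0 => [|t]; [exact: continuous_normcC|exact: normc_ge0].
pose w : C := (normc (avgC u))%:C / avgC u.
have nw : normc w = 1.
  by rewrite normcM normcV normc_real ger0_norm ?normc_ge0// divff// normc_eq0.
have cwu : continuous (fun t => w * u t : C).
  exact: (continuousMC (@continuous_cstC _ _ w) cu).
have := avgCZ w cu; rewrite /w mulfVK// => /(congr1 (@complex.Re R)) /= <-.
apply: ler_avg => [||t]; [exact: (cRe cwu)|exact: continuous_normcC|].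
by rewrite -/w (le_trans (ler_norm _))// (le_trans (normc_Re _))// normcM nw mul1r.
Qed.

Lemma continuous_sumC (I : Type) (r : seq I) (P : pred I) (F : I -> R -> C) :
  (forall i, continuous (F i)) -> continuous (fun t => \sum_(i <- r | P i) F i t).
Proof.
move=> cF; elim: r => [|i r IH].
  have -> : (fun t => \sum_(i <- [::] | P i) F i t) = (fun=> 0).
    by apply/funext => t; rewrite big_nil.
  exact: continuous_cstC.
have -> : (fun t => \sum_(j <- i :: r | P j) F j t) =
    (fun t => (if P i then F i t else 0) + \sum_(j <- r | P j) F j t).
  by apply/funext => z; rewrite big_cons; case: (P i) => //; rewrite add0r.
have ci : continuous (fun t => if P i then F i t else 0).
  by case: (P i); [exact: cF|exact: continuous_cstC].
by move=> t; apply: cvgD; [exact: ci|exact: IH].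
Qed.

Lemma avgC_sum (I : Type) (r : seq I) (P : pred I) (F : I -> R -> C) :
  (forall i, continuous (F i)) ->
  avgC (fun t => \sum_(i <- r | P i) F i t) = \sum_(i <- r | P i) avgC (F i).
Proof.
move=> cF; elim: r => [|i r IH].
  rewrite big_nil -[RHS]avgC_cst; apply: eq_avgC => t; exact: big_nil.
rewrite big_cons -IH; case: ifP => Pi; last first.
  by apply: eq_avgC => t; rewrite big_cons Pi.
rewrite -(avgCD (cF i) (@continuous_sumC _ r P _ cF)).
by apply: eq_avgC => t; rewrite big_cons Pi.
Qed.

Lemma avgC_shift u a : continuous u -> (forall t, u (t + tau) = u t) ->
  0 <= a <= tau -> avgC (fun t => u (t + a)) = avgC u.
Proof.
move=> cu pu a01; rewrite /avgC.
rewrite (@avg_shift (fun t => complex.Re (u t)))//; first last.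
- by move=> t; rewrite pu.
- exact: cRe.
rewrite (@avg_shift (fun t => complex.Im (u t)))//; first exact: cIm.
by move=> t; rewrite pu.
Qed.

(** The integrals of a [2 pi i]-periodic entire function over the horizontal
    sides of a period rectangle cancel, so that the vertical ones agree. *)
Lemma avgC_strip (h : C -> C) : entire h -> (forall s t, h (s +i* (t + tau)) = h (s +i* t)) ->
  forall s s', avgC (fun t => h (s +i* t)) = avgC (fun t => h (s' +i* t)).
Proof.
suff Imh (g : C -> C) : entire g -> (forall s t, g (s +i* (t + tau)) = g (s +i* t)) ->
    forall s s', s < s' ->
    avg (fun t => complex.Im (g (s +i* t))) = avg (fun t => complex.Im (g (s' +i* t))).
  move=> eh ph; have Ih := Imh _ eh ph.
  have Rh := Imh _ (@entireZ _ 'i _ eh) (fun s t => congr1 _ (ph s t)).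
  have {}Rh s s' : s < s' ->
    avg (fun t => complex.Re (h (s +i* t))) = avg (fun t => complex.Re (h (s' +i* t))).
    move=> ss'; have := Rh _ _ ss'.
    have E x : (fun t => complex.Im ('i * h (x +i* t))) = (fun t => complex.Re (h (x +i* t))).
      by apply/funext => t; case: (h _) => ? ? /=; rewrite mul0r add0r mul1r.
    by rewrite !E.
  move=> s s'; rewrite /avgC; have [ss'|ss'|->//] := ltgtP s s'.
    by rewrite (Rh _ _ ss') (Ih _ _ ss').
  by rewrite (Rh _ _ ss') (Ih _ _ ss').
move=> eg pg s s' ss'; have l0 : 0 < s' - s by rewrite subr_gt0.
have := goursat_Re s 0 eg l0 tau_gt0; rewrite add0r.
under [X in ri X _ _ = _ -> _]eq_fun do rewrite -[pi *+ 2]add0r pg subrr.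
rewrite ri_cst ?lerDl ?(ltW l0)// mul0r addrC subrK.
have [_ _ _ c1] := entire_cont_ReIm eg s 0.
have [_ _ _ c2] := entire_cont_ReIm eg s' 0.
by rewrite riB// => /esym/eqP; rewrite subr_eq0 => /eqP E; rewrite /avg E.
Qed.

(** The [k]-th Taylor coefficient of [f] at 0, taken from the unit circle. *)
Definition tcoef (f : C -> C) (k : nat) : C := avgC (fun t => f (eit t) * eit (- t) ^+ k).

Lemma continuous_circle (f : C -> C) z : entire f -> continuous (fun t => f (z * eit t)).
Proof.
move=> ef; apply: continuous_compC; first exact: entire_continuous.
exact: (continuousMC (@continuous_cstC _ _ z) (@continuous_eit R)).
Qed.

Lemma continuous_eitX (k : nat) : continuous (fun t => eit t ^+ k : C).
Proof.
have -> : (fun t => eit t ^+ k : C) = (fun t => (1 * eit t) ^+ k).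
  by apply/funext => t; rewrite mul1r.
exact: (@continuous_circle (fun w => w ^+ k) 1 (@entireX R k)).
Qed.

Lemma continuous_eitNX (k : nat) : continuous (fun t => eit (- t) ^+ k : C).
Proof.
move=> t; apply: (@continuous_comp _ _ _ (fun t : R => - t) (fun t => eit t ^+ k : C)).
  exact: opp_continuous.
exact: continuous_eitX.
Qed.

(** The function [h x = f (exp x) exp (- k x)] is entire and [2 pi i]-periodic; its
   mean over a vertical line does not depend on the line. The line through [w],
   with [exp w = z], carries the circle of radius [|z|], the imaginary axis the
   unit circle. *)
Let tcoefP_neq0 (f : C -> C) (k : nat) z : entire f -> z != 0 ->
  avgC (fun t => f (z * eit t) * eit (- t) ^+ k) = tcoef f k * z ^+ k.
Proof.
move=> ef z0; have [w w0 zw] := cexp_surj z0.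
pose h (x : C) : C := f (cexp x) * cexp (- x) ^+ k.
have eh : entire h.
  apply: entireM; first exact: (entire_comp ef (@cexp_entire R)).
  apply: (@entire_comp _ (fun x => x ^+ k)); first exact: (@entireX R k).
  apply: (@entire_comp _ (@cexp R)); first exact: cexp_entire.
  have := @entire_affine R (-1) 0; congr entire.
  by apply/funext => x; rewrite mulN1r addr0.
have ph s t : h (s +i* (t + tau)) = h (s +i* t).
  have E : cexp (s +i* (t + tau)) = cexp (s +i* t) by rewrite /cexp /= eitD2pi.
  by rewrite /h !cexpN E.
have hE t : h (complex.Re w +i* (t + complex.Im w)) =
    (z ^+ k)^-1 * (f (z * eit t) * eit (- t) ^+ k).
  have -> : complex.Re w +i* (t + complex.Im w) = w + (0 +i* t) :> C.
    by case: w {w0 zw} => x y; apply/eqP; rewrite eq_complex /= addr0 addrC !eqxx.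
  have E : cexp (0 +i* t) = eit t by rewrite /cexp /= expR0 mul1r.
  rewrite /h cexpN cexpD -zw E invfM -eitN exprMn exprVn mulrCA.
  by [].
have h0E t : h (0 +i* t) = f (eit t) * eit (- t) ^+ k.
  have E : cexp (0 +i* t) = eit t by rewrite /cexp /= expR0 mul1r.
  by rewrite /h cexpN E eitN.
have ch s : continuous (fun t => h (s +i* t)).
  apply: (continuous_compC (entire_continuous eh)).
  by apply: continuous_mkC => x; [exact: cvg_cst|exact: cvg_id].
have := avgC_strip eh ph (complex.Re w) 0.
have E1 := avgC_shift (ch (complex.Re w)) (ph (complex.Re w)) w0.
have E2 := avgC_strip eh ph (complex.Re w) 0.
clearbody h.
have E3 := etrans (etrans (esym (eq_avgC hE)) (etrans E1 E2)) (eq_avgC h0E).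
have cfz := continuousMC (@continuous_circle _ z ef) (@continuous_eitNX k).
have {}E3 := etrans (esym (avgCZ ((z ^+ k)^-1) cfz)) E3.
rewrite /tcoef -E3 mulrAC mulVf ?mul1r//.
by rewrite expf_neq0.
Qed.

(** The mean does not depend on the radius of the circle; let it tend to 0. *)
Lemma tcoef0 (f : C -> C) : entire f -> tcoef f 0 = f 0.
Proof.
move=> ef; apply/eqP; rewrite -subr_eq0 -normc_eq0 eq_le normc_ge0 andbT.
apply/ler_addgt0Pr => e e0; rewrite add0r.
have cf := @entire_continuous _ _ ef (0 : C).
have : \forall w \near nbhs (0 : C), `|f 0 - f w| <= e%:C.
  by move/cvgrPdist_le : cf; apply; rewrite ltcR.
move=> /nbhs_normc[d d0 dP]; pose z : C := (d / 2)%:C.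
have z0 : z != 0 by rewrite -normc_gt0 normc_real normr_gt0 mulf_neq0// gt_eqF.
have := tcoefP_neq0 0 ef z0; rewrite expr0 mulr1 => <-.
have -> : (fun t => f (z * eit t) * eit (- t) ^+ 0) = (fun t => f (z * eit t)).
  by apply/funext => t; rewrite expr0 mulr1.
have c1 := @continuous_circle _ z ef.
have c2 := @continuous_cstC R R (- f 0).
have c3 : continuous (fun t => f (z * eit t) + - f 0).
  by move=> t; apply: cvgD; [exact: c1|exact: c2].
rewrite -[X in _ + X](avgC_cst (- f 0)) -(avgCD c1 c2).
apply: le_trans (normc_avgC c3) _; rewrite -[leRHS]avg_cst; apply: ler_avg.
- exact: continuous_normcC.
- exact: continuous_cstR.
move=> t; have := dP (z * eit t); rewrite subr0 complex_normE lecR normc_distC; apply.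
rewrite normcM normc_eit mulr1 normc_real ger0_norm ?divr_ge0 ?ltW//.
by rewrite ltr_pdivrMr// ltr_pMr// ltr1n.
Qed.

(** Compare the circles of radius 1 and 2: the coefficient equals [2^k] times
    itself. This avoids integrating [e^(ikt)]. *)
Lemma tcoef_cst (k : nat) (c : C) : (0 < k)%N -> tcoef (fun=> c) k = 0.
Proof.
move=> k0; have z0 : 2 != 0 :> C by rewrite pnatr_eq0.
have := tcoefP_neq0 k (@entire_cst R c) z0.
rewrite -/(tcoef (fun=> c) k) -[X in X = _ -> _]mulr1 => /eqP.
rewrite -subr_eq0 -mulrBr mulf_eq0 => /orP[/eqP//|].
rewrite subr_eq0 eq_sym -natrX pnatr_eq1; case: k k0 => // k _.
by rewrite expnS muln_eq1.
Qed.

(** The Fourier coefficients of [t |-> f (z e^it)] are those of a power series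
    in [z]; this is what makes the Cesaro means of [f] polynomials. *)
Lemma tcoefP (f : C -> C) (k : nat) z : entire f ->
  avgC (fun t => f (z * eit t) * eit (- t) ^+ k) = tcoef f k * z ^+ k.
Proof.
move=> ef; have [->|] := eqVneq z 0; last exact: tcoefP_neq0.
have -> : (fun t => f (0 * eit t) * eit (- t) ^+ k) = (fun t => f 0 * eit (- t) ^+ k).
  by apply/funext => t; rewrite mul0r.
case: k => [|k].
  rewrite expr0 mulr1 tcoef0// -[RHS]avgC_cst; apply: eq_avgC => t.
  by rewrite expr0 mulr1.
by rewrite exprS mul0r mulr0 -/(tcoef (fun=> f 0) k.+1) tcoef_cst.
Qed.

(** The negative Fourier coefficients are, up to the factor [z^k], the values
    at 0 of the entire function [f w * w ^ k], whose mean is its value at 0. *)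
Lemma tcoefN (f : C -> C) (k : nat) z : entire f -> (0 < k)%N ->
  avgC (fun t => f (z * eit t) * eit t ^+ k) = 0.
Proof.
move=> ef k0; have eF : entire (fun w => f w * w ^+ k) by exact: (entireM ef (@entireX R k)).
have mv z' : avgC (fun t => f (z' * eit t) * (z' * eit t) ^+ k) = 0.
  have := tcoefP 0 z' eF; rewrite tcoef0// expr0n -[k == 0%N]negbK -lt0n k0 mulr0 mul0r => <-.
  by congr avgC; apply/funext => t; rewrite expr0 mulr1.
have [->|z0] := eqVneq z 0; last first.
  have zk : z ^+ k != 0 by rewrite expf_neq0.
  apply: (mulfI zk); rewrite mulr0 -avgCZ; last first.
    exact: (continuousMC (@continuous_circle _ z ef) (@continuous_eitX k)).
  rewrite -[RHS](mv z); congr avgC; apply/funext => t.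
  by rewrite exprMn mulrCA.
have -> : (fun t => f (0 * eit t) * eit t ^+ k) = (fun t => f 0 * eit t ^+ k).
  by apply/funext => t; rewrite mul0r.
rewrite avgCZ; last exact: continuous_eitX.
have eX : entire (fun w : C => w ^+ k) by exact: entireX.
have := tcoefP 0 1 eX; rewrite tcoef0// expr0n -[k == 0%N]negbK -lt0n k0 mul0r => E.
rewrite [X in _ * X](_ : _ = 0) ?mulr0// -[RHS]E.
by congr avgC; apply/funext => t; rewrite expr0 mulr1 mul1r.
Qed.

Lemma tcoefD (f g : C -> C) (k : nat) : entire f -> entire g ->
  tcoef (fun z => f z + g z) k = tcoef f k + tcoef g k.
Proof.
move=> ef eg; rewrite /tcoef.
have cf := continuousMC (@continuous_circle _ 1 ef) (@continuous_eitNX k).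
have cg := continuousMC (@continuous_circle _ 1 eg) (@continuous_eitNX k).
have E (h : C -> C) : (fun t => h (eit t) * eit (- t) ^+ k) =
  (fun t => h (1 * eit t) * eit (- t) ^+ k) by apply/funext => t; rewrite mul1r.
rewrite (E f) (E g) -(avgCD cf cg); congr avgC; apply/funext => t.
by rewrite !mul1r mulrDl.
Qed.

Lemma tcoefZ (f : C -> C) (k : nat) (c : C) : entire f ->
  tcoef (fun z => c * f z) k = c * tcoef f k.
Proof.
move=> ef; rewrite /tcoef.
have cf := continuousMC (@continuous_circle _ 1 ef) (@continuous_eitNX k).
have E (h : C -> C) : (fun t => h (eit t) * eit (- t) ^+ k) =
  (fun t => h (1 * eit t) * eit (- t) ^+ k) by apply/funext => t; rewrite mul1r.
rewrite (E f) -(avgCZ c cf); congr avgC; apply/funext => t.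
by rewrite !mul1r mulrA.
Qed.

(** Cauchy's estimate: by [tcoefP], [c_k r^k] is the mean of a function of modulus
    at most [M]. *)
Lemma normc_tcoef (f : C -> C) (k : nat) (r M : R) : entire f -> 0 < r ->
  (forall w, normc w <= r -> normc (f w) <= M) -> normc (tcoef f k) * r ^+ k <= M.
Proof.
move=> ef r0 fM; have := congr1 (@normc R) (tcoefP k (r%:C : C) ef).
rewrite normcM normcX normc_real (ger0_norm (ltW r0)) => <-.
have cf := continuousMC (@continuous_circle _ (r%:C : C) ef) (@continuous_eitNX k).
apply: le_trans (normc_avgC cf) _; rewrite -[leRHS]avg_cst; apply: ler_avg.
- exact: continuous_normcC cf.
- exact: continuous_cstR.
move=> t; rewrite normcM normcX normc_eit expr1n mulr1; apply: fM.
by rewrite normcM normc_eit mulr1 normc_real ger0_norm// ltW.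
Qed.

End circle_mean.

(** * Cesaro means *)
Section fejer_mean.
Variable R : realType.
Local Notation C := (cplx R).
Local Notation tau := (pi *+ 2 : R).
Implicit Types (f : C -> C) (z w : C) (t : R) (n l m : nat).

Definition psum f l z : C := \sum_(m < l.+1) tcoef f m * z ^+ m.

Definition fejer_mean n f z : C := n.+1%:R^-1 * \sum_(l < n.+1) psum f l z.

(** The Fejer kernel, written as a square so that its positivity is evident. *)
Definition fejer n t : R := normc (\sum_(j < n.+1) eit t ^+ j) ^+ 2 / n.+1%:R.

Lemma fejer_ge0 n t : 0 <= fejer n t.
Proof. by rewrite /fejer divr_ge0// sqr_ge0. Qed.

Lemma continuous_fejer n : continuous (fejer n).
Proof.
have cs : continuous (fun t => \sum_(j < n.+1) eit t ^+ j : C).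
  by apply: continuous_sumC => j; exact: continuous_eitX.
move=> t; apply: cvgM; last exact: cvg_cst.
apply: (@continuous_comp _ _ _ (fun t => normc (\sum_(j < n.+1) eit t ^+ j)) (fun x : R => x ^+ 2)).
  exact: (continuous_normcC cs).
exact: exprn_continuous.
Qed.

Lemma fejerE n t :
  (fejer n t)%:C = n.+1%:R^-1 * \sum_(l < n.+1) \sum_(j < n.+1) (eit t ^+ j * eit (- t) ^+ l) :> C.
Proof.
have conj_eit l : conjc (eit t ^+ l) = eit (- t) ^+ l :> R[i].
  by rewrite rmorphXn /= /eit cosN sinN.
have sq (w : C) : (normc w ^+ 2)%:C = w * (w^*)%C.
  case: w => x y; apply/eqP; rewrite eq_complex normc_sqr /=.
  by rewrite mulrN opprK -!expr2 eqxx /= mulrN mulrC addrC subrr.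
rewrite /fejer (rmorphM (real_complex R)) (fmorphV (real_complex R)) (rmorph_nat (real_complex R)).
rewrite [in RHS]mulrC; congr (_ / _).
apply: (etrans (sq _)); rewrite rmorph_sum big_distrlr /= exchange_big /=.
by apply: eq_bigr => l _; apply: eq_bigr => j _; rewrite -conj_eit.
Qed.

(** Convolution with the Fejer kernel: a positive average of rotations of [f]
    that depends on finitely many coefficients. *)
Lemma fejer_meanP n f z : entire f ->
  avgC (fun t => (fejer n t)%:C * f (z * eit t)) = fejer_mean n f z.
Proof.
move=> ef.
pose A l j t : C := (f (z * eit t) * eit t ^+ j) * eit (- t) ^+ l.
have cA l j : continuous (A l j).
  apply: continuousMC (@continuous_eitNX R l).
  exact: (continuousMC (@continuous_circle R _ z ef) (@continuous_eitX R j)).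
have eitK t m : eit t ^+ m * eit (- t) ^+ m = 1.
  by rewrite -exprMn -eitD subrr eit0 expr1n.
have AE l j : avgC (A l j) = if (j < l.+1)%N then tcoef f (l - j) * z ^+ (l - j) else 0.
  rewrite ltnS; case: leqP => jl.
    rewrite -tcoefP//; apply: eq_avgC => t; rewrite /A.
    by rewrite -{1}(subnKC jl) exprD -mulrA (mulrA (eit t ^+ j)) eitK mul1r.
  rewrite -(@tcoefN R f (j - l) z ef) ?subn_gt0//; apply: eq_avgC => t; rewrite /A.
  by rewrite -{1}(subnK (ltnW jl)) exprD -!mulrA eitK mulr1.
have E t : (fejer n t)%:C * f (z * eit t) =
    n.+1%:R^-1 * \sum_(l < n.+1) \sum_(j < n.+1) A l j t.
  rewrite fejerE mulrAC -mulrA; congr (_ * _).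
  rewrite mulr_sumr; apply: eq_bigr => l _; rewrite mulr_sumr.
  by apply: eq_bigr => j _; rewrite /A mulrA.
have cs1 l : continuous (fun t => \sum_(j < n.+1) A l j t).
  by apply: continuous_sumC => j; exact: cA.
have cs2 : continuous (fun t => \sum_(l < n.+1) \sum_(j < n.+1) A l j t).
  by apply: continuous_sumC => l; exact: cs1.
rewrite (eq_avgC E) (avgCZ _ cs2) /fejer_mean; congr (_ * _).
rewrite (@avgC_sum R _ _ _ (fun (l : 'I_n.+1) t => \sum_(j < n.+1) A l j t)); last first.
  by move=> l; exact: cs1.
apply: eq_bigr => -[l ln] _ /=.
rewrite (@avgC_sum R _ _ _ (fun (j : 'I_n.+1) t => A l j t)); last by move=> j; exact: cA.
rewrite (eq_bigr (fun j : 'I_n.+1 =>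
    if (j < l.+1)%N then tcoef f (l - j) * z ^+ (l - j) else 0)); last first.
  by move=> j _; exact: AE.
rewrite -big_mkcond /=.
rewrite -(big_ord_widen _ (fun j => tcoef f (l - j) * z ^+ (l - j)))//.
rewrite (reindex_inj rev_ord_inj) /=.
by apply: eq_bigr => m _; rewrite subSS subKn// -ltnS.
Qed.

Lemma fejer_mean_cst0 n c : fejer_mean n (fun=> c) 0 = c.
Proof.
rewrite /fejer_mean (eq_bigr (fun=> c)) ?sumr_const ?card_ord.
  by rewrite -[X in _ * X]mulr_natl mulrA mulVf ?mul1r// pnatr_eq0.
move=> l _; rewrite /psum big_ord_recl expr0 mulr1 tcoef0; last exact: entire_cst.
by rewrite big1 ?addr0// => m _; rewrite exprS mul0r mulr0.
Qed.

(** The Cesaro mean of the constant 1 is 1. *)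
Lemma avg_fejer n : avg (fejer n) = 1.
Proof.
have := fejer_meanP n 0 (@entire_cst R 1).
rewrite fejer_mean_cst0.
have -> : (fun t => (fejer n t)%:C * 1) = (fun t => (fejer n t)%:C : C).
  by apply/funext => t; rewrite mulr1.
by move=> /(congr1 (@complex.Re R)).
Qed.

(** The geometric sum has modulus at most [2 / |1 - e^it|]. This replaces the
    usual estimate of the kernel away from 0, and needs no choice of an arc. *)
Lemma fejer_concentration n t : fejer n t * normc (1 - eit t) ^+ 2 <= 4 / n.+1%:R.
Proof.
rewrite /fejer mulrAC -exprMn -normcM ler_pM2r ?invr_gt0//.
have -> : (\sum_(j < n.+1) eit t ^+ j) * (1 - eit t) = 1 - eit t ^+ n.+1.
  rewrite -[X in _ = X - _](expr1n _ n.+1) subrXX mulrC; congr (_ * _).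
  by apply: eq_bigr => j _; rewrite expr1n mul1r.
have -> : 4 = 2 ^+ 2 :> R by rewrite -natrX.
rewrite ler_pXn2r ?nnegrE ?normc_ge0// (le_trans (le_normcD _ _))//.
by rewrite normcN normcX normc_eit expr1n normc1.
Qed.

(** Continuity of [f] at [z] handles small angles; elsewhere [|f| <= M] and the
    kernel is small by [fejer_concentration]. Both cases are covered by the one
    inequality [fK], in which [K] is chosen so that [K |1 - e^it|^2 >= 2 M] as soon
    as [z e^it] is at distance at least [d] from [z]. *)
Lemma fejer_mean_cvg f z (M e : R) : entire f ->
  (forall w, normc w <= normc z -> normc (f w) <= M) -> 0 < e ->
  exists n0, forall n, (n0 <= n)%N -> normc (fejer_mean n f z - f z) <= e.
Proof.
move=> ef fM e0.
have cf := @entire_continuous _ _ ef z.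
have : \forall w \near nbhs z, `|f z - f w| <= (e / 2)%:C.
  by move/cvgrPdist_le : cf; apply; rewrite ltcR divr_gt0.
move=> /nbhs_normc[d d0 dP].
have M0 : 0 <= M by apply: le_trans (fM 0 _); rewrite ?normc0 ?normc_ge0.
pose K := 2 * M * normc z ^+ 2 / d ^+ 2.
have K0 : 0 <= K by rewrite divr_ge0 ?sqr_ge0// mulr_ge0 ?sqr_ge0// mulr_ge0.
have fK t : normc (f (z * eit t) - f z) <= e / 2 + K * normc (1 - eit t) ^+ 2.
  have [near|far] := ltP (normc (z * eit t - z)) d.
    have := dP _ near; rewrite complex_normE lecR normc_distC => /le_trans; apply.
    by rewrite lerDl mulr_ge0// sqr_ge0.
  apply: (@le_trans _ _ (2 * M)).
    rewrite (le_trans (le_normcD _ _))// normcN mulr2n mulrDl mul1r lerD//; apply: fM => //.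
    by rewrite normcM normc_eit mulr1.
  apply: ler_wpDl; first by rewrite divr_ge0// ltW.
  have -> : K * normc (1 - eit t) ^+ 2 = 2 * M * ((normc z * normc (1 - eit t)) ^+ 2 / d ^+ 2).
    by rewrite /K exprMn; ring.
  rewrite ler_peMr ?mulr_ge0// ler_pdivlMr ?exprn_gt0// mul1r.
  have -> : normc z * normc (1 - eit t) = normc (z * eit t - z).
    by rewrite -normcM mulrBr mulr1 normc_distC.
  by rewrite ler_pXn2r ?nnegrE ?normc_ge0// ltW.
exists (Num.truncn (8 * K / e)) => n nn0.
have c1 : continuous (fun t => (fejer n t)%:C * (f (z * eit t) - f z) : C).
  apply: continuousMC.
    by apply: continuous_mkC; [exact: continuous_fejer|exact: continuous_cstR].
  have c1 := @continuous_circle R _ z ef.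
  by move=> t; apply: cvgB; [exact: c1|exact: cvg_cst].
have c2 : continuous (fun t => (fejer n t)%:C * f (z * eit t) : C).
  apply: continuousMC; last exact: (@continuous_circle R _ z ef).
  by apply: continuous_mkC; [exact: continuous_fejer|exact: continuous_cstR].
have cF : continuous (fun t => (fejer n t)%:C * - f z : C).
  apply: continuousMC; last exact: continuous_cstC.
  by apply: continuous_mkC; [exact: continuous_fejer|exact: continuous_cstR].
have -> : fejer_mean n f z - f z = avgC (fun t => (fejer n t)%:C * (f (z * eit t) - f z)).
  have -> : avgC (fun t => (fejer n t)%:C * (f (z * eit t) - f z)) =
     avgC (fun t => (fejer n t)%:C * f (z * eit t) + (fejer n t)%:C * - f z).
    by apply: eq_avgC => t; rewrite -mulrDr.
  rewrite (avgCD c2 cF) fejer_meanP//; congr (_ + _).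
  by rewrite -[LHS](fejer_mean_cst0 n); have E := fejer_meanP n 0 (@entire_cst R (- f z)); rewrite -E.
apply: le_trans (normc_avgC c1) _.
apply: (@le_trans _ _ (avg (fun t => (e / 2) * fejer n t + K * (4 / n.+1%:R)))).
  apply: ler_avg => [||t].
  - exact: continuous_normcC c1.
  - move=> t; apply: cvgD; last exact: cvg_cst.
    by apply: cvgM; [exact: cvg_cst|exact: continuous_fejer].
  rewrite normcM normc_real ger0_norm ?fejer_ge0//.
  apply: (le_trans (ler_wpM2l (fejer_ge0 _ _) (fK t))).
  rewrite mulrDr mulrC lerD2l mulrCA ler_wpM2l// fejer_concentration//.
rewrite avgD; first last.
- exact: continuous_cstR.
- by move=> t; apply: cvgM; [exact: cvg_cst|exact: continuous_fejer].
rewrite avg_cst avgZ ?avg_fejer ?mulr1; last exact: continuous_fejer.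
rewrite [leRHS](splitr e) lerD2l mulrA ler_pdivrMr//.
have : 8 * K / e <= n.+1%:R.
  apply: (le_trans (ltW (truncnS_gt _))).
  by rewrite ler_nat ltnS.
by rewrite ler_pdivrMr//; lra.
Qed.

(** By Cauchy's estimate on the circle of radius [2 r], the terms of the Taylor
    series are at most [M 2^(-m)] on the disc of radius [r]. *)
Lemma normc_psumB f (r M : R) z l l' : entire f -> 0 < r ->
  (forall w, normc w <= 2 * r -> normc (f w) <= M) -> normc z <= r ->
  normc (psum f l z - psum f l' z) <= M * (2^-1 ^+ l + 2^-1 ^+ l').
Proof.
move=> ef r0 fM zr.
wlog ll : l l' / (l <= l')%N => [H|].
  case: (leqP l l') => [/H //|/ltnW ll].
  by rewrite normc_distC [in leRHS]addrC; exact: H.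
have M0 : 0 <= M by apply: le_trans (fM 0 _); rewrite ?normc0 ?normc_ge0// mulr_ge0// ltW.
have term m : normc (tcoef f m * z ^+ m) <= M * 2^-1 ^+ m.
  have r20 : 0 < 2 * r by rewrite mulr_gt0.
  have := normc_tcoef m ef r20 fM; rewrite exprMn normcM normcX => h.
  rewrite exprVn -ler_pdivrMr ?invr_gt0 ?exprn_gt0// invrK; apply: le_trans h.
  rewrite -mulrA ler_wpM2l ?normc_ge0// mulrC ler_wpM2l ?exprn_ge0//.
  by rewrite lerXn2r ?nnegrE ?normc_ge0// ltW.
rewrite -(subnKC ll); set d := (l' - l)%N; rewrite normc_distC.
suff : normc (psum f (l + d) z - psum f l z) <= M * (2^-1 ^+ l - 2^-1 ^+ (l + d)).
  move=> /le_trans; apply; rewrite ler_wpM2l// lerD2l.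
  by rewrite (@le_trans _ _ 0)// ?oppr_le0 exprn_ge0// invr_ge0.
elim: d {ll} => [|d IH]; first by rewrite addn0 !subrr normc0 mulr0.
rewrite addnS {1}/psum big_ord_recr /= -/(psum f (l + d) z) addrAC.
apply: le_trans (le_normcD _ _) _; apply: le_trans (lerD IH (term _)) _.
by rewrite -mulrDr ler_wpM2l// exprS; lra.
Qed.

(** Averaging [normc_psumB] over both indices compares two Cesaro means; letting
    the second index tend to infinity replaces that mean by [f]. The bound depends
    on [f] through [M] only, which gives uniformity over the unit ball of a Fock
    space. *)
Lemma normc_fejer_meanB f (r M : R) z n : entire f -> 0 < r ->
  (forall w, normc w <= 2 * r -> normc (f w) <= M) -> normc z <= r ->
  normc (fejer_mean n f z - f z) <= 2 * M / n.+1%:R.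
Proof.
move=> ef r0 fM zr.
have M0 : 0 <= M by apply: le_trans (fM 0 _); rewrite ?normc0 ?normc_ge0// mulr_ge0// ltW.
have geo k : \sum_(l < k.+1) 2^-1 ^+ l <= 2 :> R.
  have -> : \sum_(l < k.+1) 2^-1 ^+ l = 2 - 2^-1 ^+ k :> R.
    elim: k => [|k IH]; first by rewrite big_ord1 !expr0; lra.
    by rewrite big_ord_recr /= IH exprS; lra.
  by rewrite gerBl exprn_ge0// invr_ge0.
have cc k : normc (fejer_mean n f z - fejer_mean k f z) <= 2 * M / n.+1%:R + 2 * M / k.+1%:R.
  have -> : fejer_mean n f z - fejer_mean k f z = (n.+1%:R * k.+1%:R)^-1 *
      \sum_(l < n.+1) \sum_(j < k.+1) (psum f l z - psum f j z).
    under eq_bigr do rewrite sumrB.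
    rewrite sumrB (eq_bigr (fun l : 'I_n.+1 => k.+1%:R * psum f l z)); last first.
      by move=> l _; rewrite sumr_const card_ord mulr_natl.
    rewrite -mulr_sumr sumr_const card_ord -[X in _ * (_ - X)]mulr_natl /fejer_mean mulrBr.
    congr (_ - _); first by rewrite invfM mulrA mulfVK// pnatr_eq0.
    by rewrite invfM mulrA [_^-1 * k.+1%:R^-1]mulrC mulfVK// pnatr_eq0.
  rewrite normcM normcV normcM.
  have nN i : normc (i.+1%:R : C) = i.+1%:R.
    by rewrite -(rmorph_nat (real_complex R)) normc_real ger0_norm.
  rewrite !nN mulrC ler_pdivrMr ?mulr_gt0//.
  apply: le_trans (normc_sum _ _ _) _.
  apply: (@le_trans _ _ (\sum_(l < n.+1) \sum_(j < k.+1) M * (2^-1 ^+ l + 2^-1 ^+ j))).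
    apply: ler_sum => l _; apply: le_trans (normc_sum _ _ _) _.
    by apply: ler_sum => j _; exact: (normc_psumB _ _ ef r0 fM zr).
  under eq_bigr do rewrite -mulr_sumr big_split /= sumr_const card_ord.
  rewrite -mulr_sumr big_split /= sumr_const card_ord sumrMnl.
  have -> : (2 * M / n.+1%:R + 2 * M / k.+1%:R) * (n.+1%:R * k.+1%:R) =
    M * (2 *+ k.+1 + 2 *+ n.+1) :> R.
    by rewrite -!(mulr_natr 2); field; rewrite !nat1r !pnatr_eq0.
  by rewrite ler_wpM2l// lerD// lerMn2r geo.
apply/ler_addgt0Pr => e e0.
have e20 : 0 < e / 2 by rewrite divr_gt0.
have [|k0 hk] := @fejer_mean_cvg f z M (e / 2) ef _ e20.
  by move=> w wz; apply: fM; rewrite (le_trans wz)// (le_trans zr)// ler_peMl ?ltW// ltr1n.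
pose k := maxn k0 (Num.truncn (4 * M / e)).
have h1 := hk k (leq_maxl _ _).
have h2 : 2 * M / k.+1%:R <= e / 2.
  have : 4 * M / e <= k.+1%:R.
    apply: (le_trans (ltW (truncnS_gt _))).
    by rewrite ler_nat ltnS leq_maxr.
  by rewrite ler_pdivrMr// => h; rewrite ler_pdivrMr//; lra.
have -> : fejer_mean n f z - f z = (fejer_mean n f z - fejer_mean k f z) + (fejer_mean k f z - f z).
  by rewrite addrA subrK.
apply: le_trans (le_normcD _ _) _; apply: le_trans (lerD (cc k) h1) _.
by rewrite -addrA lerD2l [leRHS](splitr e) lerD2r.
Qed.

End fejer_mean.

(** * Integration over the plane *)
Section plane.
Variable R : realType.
Local Notation C := (cplx R).
Local Notation leb := (@lebesgue_measure R).
Local Notation mu := (leb \x leb)%E.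
Local Notation RR := (measurableTypeR R).

(** A Caratheodory function is the limit of the functions obtained by rounding its
    continuous argument down to multiples of [n.+1 ^-1]. *)
Lemma measurable_fun_separately d (T : measurableType d) (h : R -> T -> R) :
  (forall w, continuous (h ^~ w)) -> (forall t, measurable_fun setT (h t)) ->
  measurable_fun [set: RR * T] (fun x : RR * T => h x.1 x.2).
Proof.
move=> ch mh; pose s (n : nat) (x : R) : R := (Num.floor (x * n.+1%:R))%:~R / n.+1%:R.
apply: (@measurable_fun_cvg _ _ _ _ (fun n (w : RR * T) => h (s n w.1) w.2)); last first.
  move=> [x y] _ /=.
  suff c : s n x @[n --> \oo] --> x.
    by apply: (cvg_comp (fun n => s n x) (h ^~ y) c); exact: ch.
  apply/cvgrPdist_le => e e0; near=> n.
  have n0 : 0 < n.+1%:R :> R by [].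
  rewrite /s -[X in X - _](mulfK (lt0r_neq0 n0)) /=.
  rewrite -mulrBl normrM normfV (ger0_norm (ltW n0)) ler_pdivrMr//.
  have /andP[f1 f2] := floor_itv (x * n.+1%:R).
  rewrite ger0_norm ?subr_ge0// (@le_trans _ _ 1)//.
    by move: f2; rewrite intrD lerBlDl => /ltW.
  rewrite -ler_pdivrMl// mulr1.
  near: n; exists (Num.truncn e^-1) => // n /= en.
  by apply: (le_trans (ltW (truncnS_gt _))); rewrite ler_nat ltnS.
move=> n _ A mA; rewrite setTI.
rewrite [X in measurable X](_ : _ = \bigcup_(k : int)
   ([set x : R | Num.floor (x * n.+1%:R) = k] `*`
    [set y | A (h (k%:~R / n.+1%:R) y)])).
  apply: countable_bigcupT_measurable => // k; apply: measurableX.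
    rewrite [X in measurable X](_ : _ = `[k%:~R / n.+1%:R, (k + 1)%:~R / n.+1%:R[%classic).
      exact: measurable_itv.
    apply/seteqP; split => x /=; rewrite in_itv /= ler_pdivrMr// ltr_pdivlMr//.
      by move=> <-; exact: floor_itv.
    exact: floor_def.
  by have := mh (k%:~R / n.+1%:R) measurableT A mA; rewrite setTI.
apply/seteqP; split => [[x y] /= Ah|[x y] [k _ [/= xk]]].
  by exists (Num.floor (x * n.+1%:R)).
by rewrite /s xk.
Unshelve. all: by end_near.
Qed.

(** Positive slopes are enough: the reflection will appear inside a rotation. *)
Lemma integral_affine (G : R -> R) (c e : R) : 0 < c -> continuous G -> (forall x, 0 <= G x) ->
  (\int[leb]_x (G (c * x + e))%:E = c^-1%:E * \int[leb]_x (G x)%:E)%E.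
Proof.
move=> c0 cG G0.
have dF (x : R) : is_derive x 1 (fun x => c * x + e) c.
  have := is_deriveD (is_deriveZ c (is_derive_id x (1 : R))) (is_derive_cst e x 1).
  by rewrite addr0 /GRing.scale /= mulr1.
have dE : derive1 (fun x => c * x + e) = (fun=> c).
  by apply/funext => x; rewrite derive1E derive_val.
rewrite (@increasing_ge0_integration_by_substitutionT _ (fun x => c * x + e) G) //.
- apply: esym; apply: (@etrans _ _ (c^-1%:E * \int[leb]_x (c%:E * (G (c * x + e)%R)%:E))%E).
    congr (_ * _)%E; apply: eq_integral => x _; rewrite -EFinM; congr EFin.
    by rewrite dE mulrC.
  rewrite ge0_integralZl//.
  + by rewrite muleA -EFinM mulVf ?mul1e// gt_eqF.
  + apply/measurable_EFinP; apply: continuous_measurable_fun => x.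
    apply: (@continuous_comp _ _ _ (fun x => c * x + e) G); last exact: cG.
    by apply/differentiable_continuous/derivable1_diffP; exact: ex_derive.
  + by move=> x _; rewrite lee_fin.
  + by rewrite lee_fin ltW.
- by move=> x y xy; rewrite ltrD2r ltr_pM2l.
- by rewrite dE; exact: cst_continuous.
- by rewrite dE; exact: is_cvg_cst.
- by rewrite dE; exact: is_cvg_cst.
- apply/cvgrNyPle => A; exists ((A - e) / c); split; first exact: num_real.
  by move=> x xA; rewrite -lerBrDr -ler_pdivlMl// mulrC ltW.
- apply/cvgryPge => A; exists ((A - e) / c); split; first exact: num_real.
  by move=> x xA; rewrite -lerBlDr -ler_pdivrMl// mulrC ltW.
Qed.

Let EFin_meas (F : R * R -> R) : continuous F -> measurable_fun setT (fun w : RR * RR => (F w)%:E).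
Proof. by move=> cF; apply/measurable_EFinP; exact: continuous_measurable_plane. Qed.

Let pairc (T : topologicalType) (u v : T -> R) : continuous u -> continuous v ->
  continuous (fun t => (u t, v t)).
Proof.
by move=> cu cv t; apply: (@cvg_pair _ _ _ _ (nbhs (u t)) (nbhs (v t))); [exact: cu|exact: cv].
Qed.

Let slice1 (F : R * R -> R) (u v : R -> R) : continuous F -> continuous u -> continuous v ->
  continuous (fun t => F (u t, v t)).
Proof.
move=> cF cu cv t; apply: (@continuous_comp _ _ _ (fun t => (u t, v t)) F); last exact: cF.
exact: pairc.
Qed.

Let comp2 (F : R * R -> R) (u v : R * R -> R) : continuous F -> continuous u -> continuous v ->
  continuous (fun t : R * R => F (u t, v t)).
Proof.
move=> cF cu cv t; apply: (@continuous_comp _ _ _ (fun t => (u t, v t)) F); last exact: cF.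
exact: pairc.
Qed.

Let cfst : continuous (fun w : R * R => w.1).
Proof. by move=> w; exact: cvg_fst. Qed.
Let csnd : continuous (fun w : R * R => w.2).
Proof. by move=> w; exact: cvg_snd. Qed.
Let cidR : continuous (fun x : R => x).
Proof. by move=> w; exact: cvg_id. Qed.
Let ccst (T : topologicalType) (k : R) : continuous (fun _ : T => k).
Proof. by move=> w; exact: cvg_cst. Qed.
Let clin (T : topologicalType) (u v : T -> R) (j k : R) : continuous u -> continuous v ->
  continuous (fun w => j * u w + k * v w).
Proof.
by move=> cu cv w; apply: cvgD; apply: cvgM; do ?exact: cvg_cst; [exact: cu|exact: cv].
Qed.

Let tonelli1 (F : R * R -> R) : continuous F -> (forall w, 0 <= F w) ->
  (\int[mu]_w (F w)%:E = \int[leb]_x \int[leb]_y (F (x, y))%:E)%E.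
Proof.
move=> cF F0; rewrite fubini_tonelli1 //; exact: EFin_meas.
Qed.

Let tonelli2 (F : R * R -> R) : continuous F -> (forall w, 0 <= F w) ->
  (\int[mu]_w (F w)%:E = \int[leb]_y \int[leb]_x (F (x, y))%:E)%E.
Proof.
move=> cF F0; rewrite fubini_tonelli2 //; exact: EFin_meas.
Qed.

Let measurable_fst (F : R * R -> R) : continuous F -> (forall w, 0 <= F w) ->
  measurable_fun setT (fun x : RR => \int[leb]_y (F (x, y))%:E)%E.
Proof.
move=> cF F0; have F0' w : (0%:E <= (F w)%:E)%E by rewrite lee_fin.
by have := @measurable_fun_fubini_tonelli_F _ _ RR RR R leb (fun w : RR * RR => (F w)%:E) (EFin_meas cF) F0'.
Qed.

Let measurable_snd (F : R * R -> R) : continuous F -> (forall w, 0 <= F w) ->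
  measurable_fun setT (fun y : RR => \int[leb]_x (F (x, y))%:E)%E.
Proof.
move=> cF F0; have F0' w : (0%:E <= (F w)%:E)%E by rewrite lee_fin.
by have := @measurable_fun_fubini_tonelli_G _ _ RR RR R leb (fun w : RR * RR => (F w)%:E) (EFin_meas cF) F0'.
Qed.

Lemma shear1 (F : R * R -> R) (k : R) : continuous F -> (forall w, 0 <= F w) ->
  (\int[mu]_w (F (1 * w.1 + k * w.2, w.2)%R)%:E = \int[mu]_w (F w)%:E)%E.
Proof.
move=> cF F0; have cs : continuous (fun w : R * R => F (1 * w.1 + k * w.2, w.2)).
  by apply: comp2 => //; exact: clin.
rewrite (tonelli2 cs (fun w => F0 _)) (tonelli2 cF F0); apply: eq_integral => y _ /=.
have := @integral_affine (fun x => F (x, y)) 1 (k * y) ltr01 _ (fun x => F0 _).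
rewrite invr1 mul1e; apply.
exact: (slice1 cF cidR (@ccst _ y)).
Qed.

Lemma shear2 (F : R * R -> R) (k : R) : continuous F -> (forall w, 0 <= F w) ->
  (\int[mu]_w (F (w.1, 1 * w.2 + k * w.1)%R)%:E = \int[mu]_w (F w)%:E)%E.
Proof.
move=> cF F0; have cs : continuous (fun w : R * R => F (w.1, 1 * w.2 + k * w.1)).
  by apply: comp2 => //; exact: clin.
rewrite (tonelli1 cs (fun w => F0 _)) (tonelli1 cF F0); apply: eq_integral => x _ /=.
have := @integral_affine (fun y => F (x, y)) 1 (k * x) ltr01 _ (fun x => F0 _).
rewrite invr1 mul1e; apply.
exact: (slice1 cF (@ccst _ x) cidR).
Qed.

Lemma dilation (F : R * R -> R) (k x0 y0 : R) : 0 < k -> continuous F -> (forall w, 0 <= F w) ->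
  (\int[mu]_w (F (k * w.1 + x0, k * w.2 + y0)%R)%:E = (k ^- 2)%:E * \int[mu]_w (F w)%:E)%E.
Proof.
move=> k0 cF F0.
have caff (T : topologicalType) (u : T -> R) x : continuous u -> continuous (fun w => k * u w + x).
  by move=> cu w; apply: cvgD; [apply: cvgM; [exact: cvg_cst|exact: cu]|exact: cvg_cst].
have cs : continuous (fun w : R * R => F (k * w.1 + x0, k * w.2 + y0)).
  by apply: comp2 => //; exact: caff.
have c2 : continuous (fun w : R * R => F (w.1, k * w.2 + y0)).
  by apply: comp2 => //; exact: caff.
have k1 : (0 <= (k^-1)%:E)%E by rewrite lee_fin invr_ge0 ltW.
rewrite (tonelli2 cs)//.
rewrite (eq_integral (fun y : RR => (k^-1)%:E * \int[leb]_x (F (x, k * y + y0)%R)%:E)%E); last first.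
  move=> y _ /=.
  apply: (@integral_affine (fun x => F (x, k * y + y0)) k x0 k0 _ (fun x => F0 _)).
  exact: (slice1 cF cidR (@ccst _ (k * y + y0))).
rewrite (ge0_integralZl _ _ (measurable_snd c2 (fun w => F0 _)))//; last first.
  by move=> y _; apply: integral_ge0 => x _; rewrite lee_fin.
have := tonelli2 c2 (fun w => F0 _); rewrite (tonelli1 c2 (fun w => F0 _)) /= => <-.
rewrite (eq_integral (fun x : RR => (k^-1)%:E * \int[leb]_y (F (x, y)%R)%:E)%E); last first.
  move=> x _ /=.
  apply: (@integral_affine (fun y => F (x, y)) k y0 k0 _ (fun x => F0 _)).
  exact: (slice1 cF (@ccst _ x) cidR).
rewrite (ge0_integralZl _ _ (measurable_fst cF F0))//; last first.
  by move=> y _; apply: integral_ge0 => x _; rewrite lee_fin.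
by rewrite muleA -EFinM -expr2 exprVn -(tonelli1 cF F0).
Qed.

(** A rotation is a product of three shears, except for the half turn, which
    is the square of a quarter turn. *)
Lemma rotation (F : R * R -> R) (c s : R) : c ^+ 2 + s ^+ 2 = 1 ->
  continuous F -> (forall w, 0 <= F w) ->
  (\int[mu]_w (F (c * w.1 - s * w.2, s * w.1 + c * w.2)%R)%:E = \int[mu]_w (F w)%:E)%E.
Proof.
have rot (c' s' : R) : c' != - 1 -> c' ^+ 2 + s' ^+ 2 = 1 -> forall F : R * R -> R,
    continuous F -> (forall w, 0 <= F w) ->
    (\int[mu]_w (F (c' * w.1 - s' * w.2, s' * w.1 + c' * w.2)%R)%:E = \int[mu]_w (F w)%:E)%E.
  move=> c1 cs1 {}F cF F0.
  have c10 : 1 + c' != 0 by rewrite addrC addr_eq0.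
  pose t := s' / (1 + c').
  have ts : 1 - t * s' = c'.
    rewrite /t; have : s' ^+ 2 = (1 - c') * (1 + c') by rewrite -[s' ^+ 2](addKr (c' ^+ 2)) cs1; ring.
    by rewrite mulrAC -expr2 => ->; rewrite mulfK//; ring.
  have tc : t * (1 + c') = s' by rewrite mulfVK.
  have e1 (x y : R) : c' * x - s' * y = 1 * (1 * x + - t * y) + - t * (1 * y + s' * (1 * x + - t * y)).
    have -> : 1 * (1 * x + - t * y) + - t * (1 * y + s' * (1 * x + - t * y)) =
      (1 - t * s') * x - t * (1 + (1 - t * s')) * y by ring.
    by rewrite ts tc.
  have e2 (x y : R) : s' * x + c' * y = 1 * y + s' * (1 * x + - t * y).
    by rewrite -[in LHS]ts; ring.
  pose F1 w := F (1 * w.1 + - t * w.2, w.2).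
  have cF1 : continuous F1 by apply: comp2 => //; exact: clin.
  pose F2 w := F1 (w.1, 1 * w.2 + s' * w.1).
  have cF2 : continuous F2 by apply: comp2 => //; exact: clin.
  rewrite -(shear1 (- t) cF F0) -(shear2 s' cF1 (fun w => F0 _)) -(shear1 (- t) cF2 (fun w => F0 _)).
  apply: eq_integral => -[x y] _; rewrite /F2 /F1 /=; congr (F (_, _))%:E.
    exact: e1.
  exact: e2.
move=> cs cF F0; have [c1|c1] := eqVneq c (- 1); last exact: rot.
have s0 : s = 0.
  by apply/eqP; rewrite -sqrf_eq0; move: cs; rewrite c1 sqrrN expr1n => /(congr1 (fun x => x - 1)); rewrite addrAC subrr add0r => ->.
have z1 : 0 != - 1 :> R by rewrite eq_sym oppr_eq0 oner_eq0.
have o1 : 0 ^+ 2 + 1 ^+ 2 = 1 :> R by rewrite expr0n expr1n add0r.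
rewrite -(rot 0 1 z1 o1 F cF F0).
pose F1 w := F (0 * w.1 - 1 * w.2, 1 * w.1 + 0 * w.2).
have cF1 : continuous F1.
  apply: comp2 => //; last exact: clin.
  have -> : (fun t : R * R => 0 * t.1 - 1 * t.2) = (fun t => 0 * t.1 + -1 * t.2).
    by apply/funext => w; rewrite mulNr.
  exact: clin.
rewrite -(rot 0 1 z1 o1 F1 cF1 (fun w => F0 _)).
apply: eq_integral => -[x y] _; rewrite /F1 c1 s0 /=; congr (F (_, _))%:E; ring.
Qed.

(** The map is a rotation followed by the dilation by [|a|] and a translation. *)
Lemma int_dA_affine (G : C -> R) (a b : C) : a != 0 -> continuous G -> (forall z, 0 <= G z) ->
  int_dA (fun z => (G (a * z + b))%:E) = ((normc a ^- 2)%:E * int_dA (fun z => (G z)%:E))%E.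
Proof.
move=> a0 cG G0; rewrite /int_dA.
pose F (w : R * R) := G (w.1 +i* w.2).
have cF : continuous F by exact: (continuous_compC cG (@continuous_complex_of_pair R)).
have k0 : 0 < normc a by rewrite normc_gt0.
have F0 w : 0 <= F w by exact: G0.
rewrite -(dilation (complex.Re b) (complex.Im b) k0 cF F0).
pose F1 w := F (normc a * w.1 + complex.Re b, normc a * w.2 + complex.Im b).
have cF1 : continuous F1.
  by apply: comp2 => // w; (apply: cvgD; [apply: cvgM; [exact: cvg_cst|exact: cfst || exact: csnd]|exact: cvg_cst]).
pose c := complex.Re a / normc a; pose s := complex.Im a / normc a.
have cs1 : c ^+ 2 + s ^+ 2 = 1.
  by rewrite /c /s !expr_div_n -mulrDl -normc_sqr mulfV// sqrf_eq0 gt_eqF.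
rewrite -(rotation cs1 cF1 (fun w => F0 _)).
apply: eq_integral => -[x y] _; rewrite /F1 /F /=; congr (G _)%:E.
apply/eqP; rewrite /c /s; case: (a) k0 => a1 a2; case: (b) => b1 b2 k0.
have kn : normc (a1 +i* a2) != 0 by rewrite gt_eqF.
rewrite eq_complex [complex.Re (a1 +i* a2)]/= [complex.Im (a1 +i* a2)]/=.
move: (normc (a1 +i* a2)) kn => k kn /=.
by apply/andP; split; apply/eqP; field.
Qed.

Lemma int_dA_gauss (c : R) : 0 < c ->
  int_dA (fun z : C => (expR (- (c * normc z ^+ 2)))%:E) = (pi / c)%:E.
Proof.
have cg (k : R) : continuous (fun z : C => expR (- (k * normc z ^+ 2))).
  move=> z; apply: (@continuous_comp _ _ _ (@normc R : C -> R) (fun r : R => expR (- (k * r ^+ 2)))).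
    exact: continuous_normc.
  apply: (@continuous_comp _ _ _ (fun r : R => - (k * r ^+ 2)) (@expR R)); last exact: continuous_expR.
  by apply: cvgN; apply: cvgM; [exact: cvg_cst|exact: exprn_continuous].
have g1 : int_dA (fun z : C => (expR (- (1 * normc z ^+ 2)))%:E) = pi%:E.
  rewrite /int_dA (tonelli1 (F := fun w => expR (- (1 * normc (w.1 +i* w.2) ^+ 2)))); first last.
  - by move=> w; exact: expR_ge0.
  - exact: (continuous_compC (cg 1) (@continuous_complex_of_pair R)).
  rewrite (eq_integral (fun x : RR => (Num.sqrt pi)%:E * (gauss_fun x)%:E)%E); last first.
    move=> x _; rewrite -integralT_gauss muleC -ge0_integralZl//.
    - apply: eq_integral => y _; rewrite -EFinM /gauss_fun -expRD; congr (expR _)%:E.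
      by rewrite mul1r normc_sqr /=; ring.
    - by apply/measurable_EFinP; exact: measurable_gauss_fun.
    - by move=> y _; rewrite lee_fin gauss_fun_ge0.
    - by rewrite lee_fin gauss_fun_ge0.
  rewrite ge0_integralZl//.
  - by rewrite integralT_gauss -EFinM -expr2 sqr_sqrtr// pi_ge0.
  - by apply/measurable_EFinP; exact: measurable_gauss_fun.
  - by move=> y _; rewrite lee_fin gauss_fun_ge0.
move=> c0; pose a : C := (Num.sqrt c)%:C.
have na : normc a ^+ 2 = c by rewrite normc_real ger0_norm ?sqrtr_ge0// sqr_sqrtr// ltW.
have a0 : a != 0.
  by apply: contraTneq c0 => a0; rewrite -na a0 normc0 expr0n ltxx.
have := int_dA_affine 0 a0 (cg 1) (fun z => expR_ge0 _).
rewrite g1 na -EFinM mulrC => <-; congr int_dA; apply/funext => z; congr (expR _)%:E.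
by rewrite addr0 normcM exprMn na mul1r.
Qed.

End plane.

(** * Norm inequalities in Fock spaces *)
Section fock_norms.
Variable R : realType.
Local Notation C := (cplx R).
Local Notation leb := (@lebesgue_measure R).
Local Notation mu := (leb \x leb)%E.
Local Notation RR := (measurableTypeR R).
Local Notation tau := (pi *+ 2 : R).
Implicit Types (f g : C -> C) (p q N : R) (n : nat).

Lemma continuousMR (T : topologicalType) (u v : T -> R) :
  continuous u -> continuous v -> continuous (fun a : T => u a * v a).
Proof. by move=> cu cv a; apply: (@cvgM _ _ (nbhs a) _ u v); [exact: cu|exact: cv]. Qed.

Lemma continuous_powR (T : topologicalType) (h : T -> R) p : 0 < p ->
  (forall x, 0 <= h x) -> continuous h -> continuous (fun x => h x `^ p).
Proof.
move=> p0 h0 ch x.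
have -> : (fun x => h x `^ p) = (fun y => `|y| `^ p) \o h.
  by apply/funext => y /=; rewrite ger0_norm.
apply: (@continuous_comp _ _ _ h (fun y : R => `|y| `^ p)); first exact: ch.
have [->|y0] := eqVneq (h x) 0.
  apply/(@cvgrPdist_lt _ _ _ (nbhs (0 : R))) => e e0; rewrite normr0 powR0 ?gt_eqF//.
  apply/nbhs_ballP; exists (e `^ p^-1) => /=; first exact: powR_gt0.
  move=> y; rewrite /ball /= sub0r normrN => ye.
  rewrite sub0r normrN ger0_norm ?powR_ge0//.
  have -> : e = (e `^ p^-1) `^ p by rewrite -powRrM mulVf ?gt_eqF// powRr1// ltW.
  by apply: gt0_ltr_powR; rewrite ?nnegrE ?powR_ge0.
apply: (@continuous_comp _ _ _ (fun y : R => `|y|) (fun y : R => y `^ p)).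
  exact: norm_continuous.
apply/differentiable_continuous/derivable1_diffP; apply: derivable_powR.
by rewrite in_itv /= andbT normr_gt0.
Qed.

(** Jensen's inequality for [x ^ p] and the probability [K]. Young's inequality
    [T^(p-1) h <= h^p / p + T^p (p-1)/p], with [T] the mean itself, is the tangent
    line of the power at [T]; averaging it against [K] gives the claim. *)
Lemma avg_jensen (K h : R -> R) p : 1 <= p -> continuous K -> continuous h ->
  (forall t, 0 <= K t) -> (forall t, 0 <= h t) -> avg K = 1 ->
  avg (fun t => K t * h t) `^ p <= avg (fun t => K t * h t `^ p).
Proof.
move=> p1 cK ch K0 h0 K1; have p0 : 0 < p by rewrite (lt_le_trans _ p1).
have cKh : continuous (fun t => K t * h t).
  by move=> t; apply: cvgM; [exact: cK|exact: ch].
have chp := continuous_powR p0 h0 ch.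
have cKp : continuous (fun t => K t * h t `^ p).
  by move=> t; apply: cvgM; [exact: cK|exact: chp].
have T0 : 0 <= avg (fun t => K t * h t) by apply: avg_ge0 => // t; exact: mulr_ge0.
move: p1; rewrite le_eqVlt => /predU1P[<-|p1].
  rewrite powRr1//; apply: ler_avg => //.
    by under eq_fun do rewrite powRr1//.
  by move=> t; rewrite powRr1.
set T := avg (fun t => K t * h t) in T0 *.
have q0 : 0 < p / (p - 1) by rewrite divr_gt0// subr_gt0.
have pq : p^-1 + (p / (p - 1))^-1 = 1.
  by rewrite invf_div; field; rewrite gt_eqF.
have Tp : T `^ p = avg (fun t => T `^ (p - 1) * (K t * h t)).
  by rewrite avgZ// -/T mulrC mulr_powRB1.
have : T `^ p <= avg (fun t => p^-1 * (K t * h t `^ p) + (T `^ p * (p / (p - 1))^-1) * K t).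
  rewrite {1}Tp; apply: ler_avg.
  - by move=> t; apply: cvgM; [exact: cvg_cst|exact: cKh].
  - by move=> t; apply: cvgD; (apply: cvgM; first exact: cvg_cst); [exact: cKp|exact: cK].
  move=> t; have := conjugate_powR (h0 t) (powR_ge0 T (p - 1)) p0 q0 pq.
  rewrite -powRrM mulrCA divff ?mulr1; last by rewrite subr_eq0 gt_eqF.
  by move=> /(ler_wpM2l (K0 t)) => H; apply: le_trans (le_trans _ H) _; rewrite le_eqVlt; apply/orP; left; apply/eqP; ring.
rewrite avgD; last 2 first.
- by move=> t; apply: cvgM; [exact: cvg_cst|exact: cKp].
- by move=> t; apply: cvgM; [exact: cvg_cst|exact: cK].
rewrite !avgZ// K1 mulr1.
have -> : (p / (p - 1))^-1 = 1 - p^-1 by apply/eqP; rewrite eq_sym subr_eq [X in _ == X]addrC pq.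
rewrite mulrBr mulr1 => H; rewrite -(ler_pM2l (x := p^-1)) ?invr_gt0//.
by move: H; rewrite (mulrC (T `^ p)); lra.
Qed.

Lemma EFin_avg (h : R -> R) : continuous h ->
  ((avg h)%:E = (tau^-1)%:E * \int[leb]_(t in `[0%R, tau]) (h t)%:E)%E.
Proof.
move=> ch; rewrite /avg /ri /Rintegral EFinM fineK//.
by apply: integrable_fin_num => //; exact: ri_integrable.
Qed.

(** The product measure under a name of its own, on which the sigma-finite
    structure that Tonelli's theorem asks for can be declared. *)
Definition plane_measure : set (RR * RR) -> \bar R := (leb \x leb)%E.

HB.instance Definition _ := Measure.copy plane_measure (leb \x leb)%E.

Let plane_measure_sigma_finite : sigma_finite setT plane_measure.
Proof.
have /sigma_finiteP[F [TF ndF Foo]] := sigma_finiteT leb.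
exists (fun n => F n `*` F n).
  rewrite -setXTT TF predeqE => -[x y]; split.
    move=> [/= [n _ Fnx] [k _ Fky]]; exists (maxn n k) => //; split.
    - by move: x Fnx; exact/subsetPset/ndF/leq_maxl.
    - by move: y Fky; exact/subsetPset/ndF/leq_maxr.
  by move=> [n _ []/= ? ?]; split; exists n.
move=> k; have [? ?] := Foo k; split; first exact: measurableX.
by rewrite /plane_measure product_measure1E// lte_mul_pinfty// ge0_fin_numE.
Qed.

HB.instance Definition _ :=
  Measure_isSigmaFinite.Build _ _ _ plane_measure plane_measure_sigma_finite.

(** Tonelli's theorem for circle means, with the indicator of the period interval
    moved into the integrand so that both integrals are over full spaces. *)
Section circle_tonelli.
Variables (d : measure_display) (T : measurableType d) (h : R -> T -> R).
Hypothesis ch : forall w, continuous (h ^~ w).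
Hypothesis mh : forall t, measurable_fun setT (h t).
Hypothesis h0 : forall t w, 0 <= h t w.

Let D := `[0%R, tau]%classic : set RR.
Let Phi (x : RR * T) := (h x.1 x.2 * \1_D x.1)%:E.

Let Phi0 x : (0 <= Phi x)%E.
Proof. by rewrite lee_fin mulr_ge0. Qed.

Let mPhi : measurable_fun setT Phi.
Proof.
have mI : measurable_fun [set: RR] (\1_D : RR -> R).
  by apply: measurable_indic; exact: measurable_itv.
apply/measurable_EFinP; apply: measurable_funM; last first.
  exact: (measurableT_comp mI (@measurable_fst _ _ _ _)).
exact: (@measurable_fun_separately R _ _ h).
Qed.

Let tau0 : (0 <= (tau^-1)%:E)%E.
Proof. by rewrite lee_fin invr_ge0 ltW ?tau_gt0. Qed.

Let avgE w : (avg (h ^~ w))%:E = ((tau^-1)%:E * \int[leb]_t Phi (t, w))%E.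
Proof.
rewrite (EFin_avg (@ch w)); congr (_ * _)%E.
rewrite integral_mkcond epatch_indic; apply: eq_integral => t _.
by rewrite /Phi /= EFinM.
Qed.

Let mG : measurable_fun setT (fun w => \int[leb]_t Phi (t, w))%E.
Proof. by have := @measurable_fun_fubini_tonelli_G _ _ RR T R leb Phi mPhi Phi0. Qed.

Lemma measurable_avg : measurable_fun setT (fun w => (avg (h ^~ w))%:E).
Proof.
have -> : (fun w => (avg (h ^~ w))%:E) =
    (fun w => (tau^-1)%:E * \int[leb]_t Phi (t, w))%E by exact/funext.
exact: measurable_funeM.
Qed.

Lemma integral_avg (m : {sigma_finite_measure set T -> \bar R}) :
  (\int[m]_w (avg (h ^~ w))%:E =
   (tau^-1)%:E * \int[leb]_(t in `[0%R, tau]) \int[m]_w (h t w)%:E)%E.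
Proof.
rewrite (eq_integral (fun w => (tau^-1)%:E * \int[leb]_t Phi (t, w))%E); last first.
  by move=> w _; exact: avgE.
rewrite ge0_integralZl//; last first.
  by move=> w _; apply: integral_ge0 => t _; exact: Phi0.
congr (_ * _)%E; apply: (etrans (esym (@fubini_tonelli _ _ RR T R leb m Phi mPhi Phi0))).
rewrite [in RHS]integral_mkcond epatch_indic; apply: eq_integral => t _ /=.
rewrite muleC -ge0_integralZl//.
- by apply: eq_integral => w _; rewrite /Phi /= EFinM muleC.
- by apply/measurable_EFinP.
- by move=> w _; rewrite lee_fin.
Qed.

End circle_tonelli.

(** For each [t], [w |-> w e^it] preserves the area; integrate this in [t]. *)
Lemma int_dA_avg (K : R -> R) (H : C -> R) : continuous K -> continuous H ->
  (forall t, 0 <= K t) -> (forall z, 0 <= H z) ->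
  int_dA (fun w => (avg (fun t => K t * H (w * eit t)))%:E) =
  ((avg K)%:E * int_dA (fun w => (H w)%:E))%E.
Proof.
move=> cK cH K0 H0.
have crot (w : C) : continuous (fun t : R => H (w * eit t)).
  apply: (continuous_compC cH).
  exact: (continuousMC (@continuous_cstC R R w) (@continuous_eit R)).
have crot2 (t : R) : continuous (fun w : C => H (w * eit t)).
  apply: (continuous_compC cH).
  exact: (entire_continuous (@entireM R _ _ (@entire_id R) (@entire_cst R (eit t)))).
have mrot t : measurable_fun setT (fun w : RR * RR => H ((w.1 +i* w.2) * eit t)).
  apply: continuous_measurable_plane.
  exact: (continuous_compC (crot2 t) (@continuous_complex_of_pair R)).
have mH : measurable_fun setT (fun w : RR * RR => H (w.1 +i* w.2)).
  apply: continuous_measurable_plane.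
  exact: (continuous_compC cH (@continuous_complex_of_pair R)).
pose m := plane_measure.
pose h t (w : RR * RR) := K t * H ((w.1 +i* w.2) * eit t).
have IA : (\int[m]_w (avg (h ^~ w))%:E =
    (tau^-1)%:E * \int[leb]_(t in `[0%R, tau]) \int[m]_w (h t w)%:E)%E.
  apply: integral_avg.
  - by move=> w t; apply: cvgM; [exact: cK|exact: crot].
  - by move=> t; apply: measurable_funM; [exact: measurable_cst|exact: mrot].
  - by move=> t w; exact: mulr_ge0.
apply: (etrans IA); rewrite (EFin_avg cK) -muleA; congr (_ * _)%E.
  rewrite (eq_integral (fun t : RR => (K t)%:E * int_dA (fun w => (H w)%:E))%E); last first.
    move=> t _; have := int_dA_affine 0 (eit_neq0 t) cH H0.
    rewrite normc_eit expr1n invr1 mul1e => <-.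
    rewrite /int_dA -ge0_integralZl//.
    + apply: eq_integral => w _; rewrite -EFinM; congr (_ * H _)%:E.
      by rewrite addr0 mulrC.
    + apply/measurable_EFinP.
      have -> : (fun w : RR * RR => H (eit t * (w.1 +i* w.2) + 0)) =
                (fun w => H ((w.1 +i* w.2) * eit t)) by apply/funext => w; rewrite addr0 mulrC.
      exact: mrot.
    + by move=> w _; rewrite lee_fin.
    + by rewrite lee_fin.
  rewrite ge0_integralZr//.
  + by apply/measurable_EFinP; apply: measurable_funTS; exact: continuous_measurable_fun.
  + by move=> t _; rewrite lee_fin.
  + by apply: integral_ge0 => w _; rewrite lee_fin.
Qed.

End fock_norms.

Section fock_estimates.
Variable R : realType.
Local Notation C := (cplx R).
Implicit Types (f g : C -> C) (p q N S : R) (n : nat) (z : C).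

(** The function [fock_modulus f] with a complex argument. Its powers are the
    integrands of all Fock norms, and translations act on it through [weyl]. *)
Definition fmod f z : R := normc (f z) * expR (- (normc z ^+ 2 / 2)).

Definition fock_int p f : \bar R := int_dA (fun z => (fmod f z `^ p)%:E).

Lemma fmod_ge0 f z : 0 <= fmod f z.
Proof. by rewrite mulr_ge0 ?normc_ge0 ?expR_ge0. Qed.

Lemma continuous_gauss_weight : continuous (fun z : C => expR (- (normc z ^+ 2 / 2))).
Proof.
move=> z; apply: (@continuous_comp _ _ _ (@normc R : C -> R) (fun r : R => expR (- (r ^+ 2 / 2)))).
  exact: continuous_normc.
apply: (@continuous_comp _ _ _ (fun r : R => - (r ^+ 2 / 2)) (@expR R)); last exact: continuous_expR.
by apply: cvgN; apply: cvgM; [exact: exprn_continuous|exact: cvg_cst].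
Qed.

Lemma continuous_fmod f : entire f -> continuous (fmod f).
Proof.
move=> ef; have c := continuous_compC (@continuous_normc R) (entire_continuous ef).
exact: (continuousMR c continuous_gauss_weight).
Qed.

Lemma continuous_fmodp f p : 0 < p -> entire f -> continuous (fun z => fmod f z `^ p).
Proof. by move=> p0 ef; apply: continuous_powR => //; [exact: fmod_ge0|exact: continuous_fmod]. Qed.

Lemma fock_int_ge0 p f : (0 <= fock_int p f)%E.
Proof. by apply: integral_ge0 => w _; rewrite lee_fin powR_ge0. Qed.

Lemma fock_norm_int p f : 0 < p ->
  fock_norm p f = (((p / (2 * pi))%:E * fock_int p f) `^ p^-1)%E.
Proof.
move=> p0; rewrite /fock_norm; congr ((_ * _) `^ _)%E.
congr int_dA; apply/funext => z; congr EFin.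
rewrite /fmod powRM ?normc_ge0 ?expR_ge0// -expRM; congr (_ * expR _).
by ring.
Qed.

Let cst_gt0 p : 0 < p -> 0 < p / (2 * pi) :> R.
Proof. by move=> p0; rewrite divr_gt0// mulr_gt0// pi_gt0. Qed.

Lemma ler_poweR (r : R) (x y : \bar R) : 0 <= r -> (0 <= x)%E -> (x <= y)%E -> (x `^ r <= y `^ r)%E.
Proof.
move=> r0 x0 xy; apply: gt0_ler_poweR => //; rewrite in_itv /= leey andbT//.
exact: le_trans xy.
Qed.

(** Turns a norm bound into an integral bound and back, so that estimates need no
    root of an extended real. *)
Lemma fock_norm_le p f N : 0 < p -> 0 <= N ->
  (fock_norm p f <= N%:E)%E <-> ((p / (2 * pi))%:E * fock_int p f <= (N `^ p)%:E)%E.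
Proof.
move=> p0 N0; have c0 := cst_gt0 p0.
have I0 : (0 <= (p / (2 * pi))%:E * fock_int p f)%E.
  by rewrite mule_ge0 ?fock_int_ge0// lee_fin ltW.
rewrite fock_norm_int//.
have NK : (N%:E = (N `^ p)%:E `^ p^-1)%E.
  by rewrite poweR_EFin -powRrM mulfV ?powRr1// gt_eqF.
have XK : ((p / (2 * pi))%:E * fock_int p f =
           (((p / (2 * pi))%:E * fock_int p f) `^ p^-1) `^ p)%E.
  by rewrite -poweRrM mulVf ?poweRe1// gt_eqF.
split=> [le|le].
  by rewrite XK -poweR_EFin; apply: ler_poweR le; [exact: ltW|exact: poweR_ge0].
by rewrite NK; apply: ler_poweR le; [rewrite invr_ge0 ltW|exact: I0].
Qed.

Lemma entire_psum f n : entire (psum f n).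
Proof.
have := @entire_sum R _ (index_enum 'I_n.+1) xpredT (fun (m : 'I_n.+1) z => tcoef f m * z ^+ m).
by apply => m; exact: (@entireZ _ _ _ (@entireX R m)).
Qed.

Lemma entire_fejer_mean n f : entire (fejer_mean n f).
Proof.
apply: entireZ; have := @entire_sum R _ (index_enum 'I_n.+1) xpredT (fun (l : 'I_n.+1) z => psum f l z).
by apply => m; exact: entire_psum.
Qed.

(** Cesaro means are averages of rotations, and for [1 <= p] the power is convex. *)
Lemma fock_int_fejer_mean p n f : 1 <= p -> entire f ->
  (fock_int p (fejer_mean n f) <= fock_int p f)%E.
Proof.
move=> p1 ef; have p0 : 0 < p by rewrite (lt_le_trans _ p1).
have cF := @continuous_fejer R n.
have chp := continuous_fmodp p0 ef.
have cfm (w : C) : continuous (fun t : R => fmod f (w * eit t)).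
  apply: (continuous_compC (continuous_fmod ef)).
  exact: (continuousMC (@continuous_cstC R R w) (@continuous_eit R)).
have cfmp (w : C) : continuous (fun t : R => fmod f (w * eit t) `^ p).
  apply: (continuous_compC chp).
  exact: (continuousMC (@continuous_cstC R R w) (@continuous_eit R)).
have cKh (w : C) : continuous (fun t => fejer n t * fmod f (w * eit t) `^ p).
  by move=> t; apply: cvgM; [exact: cF|exact: cfmp].
have cKh1 (w : C) : continuous (fun t => fejer n t * fmod f (w * eit t)).
  by move=> t; apply: cvgM; [exact: cF|exact: cfm].
have pw z : fmod (fejer_mean n f) z `^ p <= avg (fun t => fejer n t * fmod f (z * eit t) `^ p).
  apply: le_trans (avg_jensen p1 cF (cfm z) (@fejer_ge0 R n) (fun t => fmod_ge0 _ _) (avg_fejer R n)).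
  apply: ge0_ler_powR; rewrite ?nnegrE ?fmod_ge0 ?(ltW p0)//.
    by apply: avg_ge0 => [|t]; [exact: cKh1|rewrite mulr_ge0 ?fejer_ge0 ?fmod_ge0].
  have c2 : continuous (fun t => (fejer n t)%:C * f (z * eit t) : C).
    apply: continuousMC; last exact: (@continuous_circle R _ z ef).
    by apply: continuous_mkC; [exact: continuous_fejer|exact: continuous_cstR].
  rewrite /fmod -fejer_meanP// mulrC.
  apply: le_trans (ler_wpM2l (expR_ge0 _) (normc_avgC c2)) _.
  rewrite -avgZ; last exact: (continuous_normcC c2).
  rewrite le_eqVlt; apply/orP; left; apply/eqP; congr avg; apply/funext => t.
  by rewrite !normcM normc_eit mulr1 normc_real ger0_norm ?fejer_ge0// mulrC mulrA.
have -> : fock_int p f = int_dA (fun w => (avg (fun t => fejer n t * fmod f (w * eit t) `^ p))%:E).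
  have := int_dA_avg cF chp (@fejer_ge0 R n) (fun z => powR_ge0 _ _).
  by rewrite avg_fejer mul1e.
apply: ge0_le_integral => //.
- by move=> w _; rewrite lee_fin powR_ge0.
- apply/measurable_EFinP; apply: continuous_measurable_plane.
  exact: (continuous_compC (continuous_fmodp p0 (@entire_fejer_mean n f)) (@continuous_complex_of_pair R)).
- pose h t (w : measurableTypeR R * measurableTypeR R) :=
    fejer n t * fmod f ((w.1 +i* w.2) * eit t) `^ p.
  have c1 w : continuous (h ^~ w) by exact: cKh.
  have c2 t : measurable_fun setT (h t).
    apply: measurable_funM; first exact: measurable_cst.
    apply: continuous_measurable_plane.
    have c := continuous_compC chp (entire_continuous (@entireM R _ _ (@entire_id R) (@entire_cst R (eit t)))).
    exact: (continuous_compC c (@continuous_complex_of_pair R)).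
  have c3 t w : 0 <= h t w by rewrite mulr_ge0 ?fejer_ge0 ?powR_ge0.
  by have := measurable_avg c1 c2 c3.
- by move=> w _; rewrite lee_fin.
Qed.

Lemma fock_norm_fejer_mean p n f : 1 <= p -> entire f ->
  (fock_norm p (fejer_mean n f) <= fock_norm p f)%E.
Proof.
move=> p1 ef; have p0 : 0 < p by rewrite (lt_le_trans _ p1).
have c0 := cst_gt0 p0; rewrite (fock_norm_int _ p0) (fock_norm_int f p0).
apply: ler_poweR; first by rewrite invr_ge0 ltW.
  by apply: mule_ge0; [rewrite lee_fin ltW|exact: fock_int_ge0].
by apply: lee_wpmul2l; [rewrite lee_fin ltW|exact: fock_int_fejer_mean].
Qed.

(** The factor [p / (2 pi)] in the norm is there to make this true. *)
Lemma fock_norm_cst p (c : C) : 0 < p -> fock_norm p (fun=> c) = (normc c)%:E.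
Proof.
move=> p0; rewrite (fock_norm_int _ p0).
have cg : continuous (fun z : C => expR (- (p / 2 * normc z ^+ 2))).
  have -> : (fun z : C => expR (- (p / 2 * normc z ^+ 2))) =
      (fun z => expR (- (normc z ^+ 2 / 2)) `^ p).
    by apply/funext => z; rewrite -expRM; congr expR; ring.
  exact: (continuous_powR p0 (fun z : C => expR_ge0 _) continuous_gauss_weight).
have -> : fock_int p (fun=> c) = (normc c `^ p * (pi / (p / 2)))%:E.
  rewrite EFinM -(int_dA_gauss (c := p / 2)) ?divr_gt0// /int_dA -ge0_integralZl//.
  - apply: eq_integral => w _; rewrite -EFinM /fmod powRM ?normc_ge0 ?expR_ge0// -expRM.
    by congr (_ * expR _)%:E; ring.
  - apply/measurable_EFinP; apply: continuous_measurable_plane.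
    exact: (continuous_compC cg (@continuous_complex_of_pair R)).
  - by rewrite lee_fin powR_ge0.
rewrite -EFinM poweR_EFin; congr EFin.
have -> : p / (2 * pi) * (normc c `^ p * (pi / (p / 2))) = normc c `^ p.
  have pi0 : pi != 0 :> R by rewrite gt_eqF// pi_gt0.
  have pn0 : p != 0 by rewrite gt_eqF.
  by move: (@pi R) pi0 => y y0; field; rewrite y0 pn0.
by rewrite -powRrM mulfV ?powRr1 ?normc_ge0// gt_eqF.
Qed.

(** Weyl translations: isometries of every Fock space, transitive on points. The
    arguments are written [1 * z + a] and [_ * z + 0] to be instances of the affine
    functions of [entire_affine] and [int_dA_affine]. *)
Definition weyl (a : C) f z : C :=
  f (1 * z + a) * (cexp (- (a^*)%C * z + 0) * (expR (- (normc a ^+ 2 / 2)))%:C).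

Lemma entire_weyl a f : entire f -> entire (weyl a f).
Proof.
move=> ef; apply: (@entireM R (fun z => f (1 * z + a))).
  exact: (entire_comp ef (@entire_affine R 1 a)).
apply: (@entireM R (fun z => cexp (- (a^*)%C * z + 0)) (fun=> _)); last exact: entire_cst.
exact: (entire_comp (@cexp_entire R) (@entire_affine R (- (a^*)%C) 0)).
Qed.

Lemma fmod_weyl a f z : fmod (weyl a f) z = fmod f (1 * z + a).
Proof.
rewrite /fmod /weyl normcM [normc (cexp _ * _)]normcM normc_cexp normc_real ger0_norm ?expR_ge0//.
rewrite -mulrA; congr (_ * _); rewrite -!expRD; congr expR.
by rewrite !normc_sqr mul1r addr0; case: z => x y; case: a => a b /=; field.
Qed.

Lemma fock_norm_weyl p a f : 0 < p -> entire f -> fock_norm p (weyl a f) = fock_norm p f.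
Proof.
move=> p0 ef; rewrite (fock_norm_int _ p0) (fock_norm_int f p0).
have -> // : fock_int p (weyl a f) = fock_int p f.
have E : (fun z => (fmod (weyl a f) z `^ p)%:E) = (fun z => (fmod f (1 * z + a) `^ p)%:E).
  by apply/funext => z; rewrite fmod_weyl.
have := int_dA_affine a (oner_neq0 C) (continuous_fmodp p0 ef) (fun z => powR_ge0 _ _).
by rewrite normc1 expr1n invr1 mul1e -E.
Qed.

(** The sharp pointwise bound; at the origin it is the contraction property of
    the Cesaro mean of order 0, which is the constant [f 0]. *)
Lemma fmod_le_norm p f z : 1 <= p -> entire f -> ((fmod f z)%:E <= fock_norm p f)%E.
Proof.
move=> p1 ef; have p0 : 0 < p by rewrite (lt_le_trans _ p1).
rewrite -(fock_norm_weyl z p0 ef); have ew := @entire_weyl z f ef.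
have -> : fmod f z = normc (weyl z f 0).
  by have := fmod_weyl z f 0; rewrite mulr0 add0r => <-; rewrite /fmod normc0 expr0n mul0r oppr0 expR0 mulr1.
rewrite -(fock_norm_cst _ p0).
have E : fejer_mean 0 (weyl z f) = (fun=> weyl z f 0).
  apply/funext => w.
  by rewrite /fejer_mean big_ord1 /psum big_ord1 expr0 mulr1 invr1 mul1r tcoef0.
by have := fock_norm_fejer_mean 0 p1 ew; rewrite E.
Qed.

(** [x^q = x^(q-p) x^p] pointwise. It serves twice: with [S] the norm of [f], for
    the embedding of Fock spaces; with exponents 1 and [p], for sums of kernels. *)
Lemma fock_int_interpolation p q f S : 0 < p -> p <= q -> entire f ->
  (forall z, fmod f z <= S) ->
  (fock_int q f <= (S `^ (q - p))%:E * fock_int p f)%E.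
Proof.
move=> p0 pq ef fS; have q0 := lt_le_trans p0 pq.
have mp : measurable_fun setT (fun w : measurableTypeR R * measurableTypeR R => fmod f (w.1 +i* w.2) `^ p).
  apply: continuous_measurable_plane.
  exact: (continuous_compC (continuous_fmodp p0 ef) (@continuous_complex_of_pair R)).
rewrite /fock_int /int_dA -ge0_integralZl//; last 3 first.
- exact/measurable_EFinP.
- by move=> w _; rewrite lee_fin powR_ge0.
- by rewrite lee_fin powR_ge0.
apply: ge0_le_integral => //.
- by move=> w _; rewrite lee_fin powR_ge0.
- apply/measurable_EFinP; apply: continuous_measurable_plane.
  exact: (continuous_compC (continuous_fmodp q0 ef) (@continuous_complex_of_pair R)).
- by apply: measurable_funeM; exact/measurable_EFinP.
move=> w _; rewrite -EFinM lee_fin; set x := fmod f _.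
have x0 : 0 <= x by exact: fmod_ge0.
have [->|xn0] := eqVneq x 0; first by rewrite !powR0 ?gt_eqF// mulr0.
have xS : x <= S by exact: fS.
have -> : x `^ q = x `^ (q - p) * x `^ p by rewrite -powRD ?subrK// xn0 implybT.
by rewrite ler_wpM2r ?powR_ge0// ge0_ler_powR ?nnegrE ?subr_ge0// (le_trans x0).
Qed.

(** Interpolate with [S = N], which is admissible by [fmod_le_norm]; the constant
    [q / p] is the quotient of the normalizing factors of the two norms. *)
Lemma fock_norm_embed p q f N : 1 <= p -> p <= q -> entire f -> 0 <= N ->
  (fock_norm p f <= N%:E)%E -> (fock_norm q f <= ((q / p) `^ q^-1 * N)%:E)%E.
Proof.
move=> p1 pq ef N0 fN; have p0 : 0 < p by rewrite (lt_le_trans _ p1).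
have q0 := lt_le_trans p0 pq.
have qp : 0 < q / p by rewrite divr_gt0.
have fS z : fmod f z <= N by rewrite -lee_fin (le_trans (fmod_le_norm z p1 ef)).
have I := fock_int_interpolation p0 pq ef fS.
apply/fock_norm_le => //; first by rewrite mulr_ge0// powR_ge0.
rewrite powRM ?powR_ge0// -powRrM mulVf ?gt_eqF// powRr1 ?(ltW qp)//.
have /fock_norm_le := fN; move=> /(_ p0 N0) {}fN.
apply: (@le_trans _ _ ((q / p * N `^ (q - p))%:E * ((p / (2 * pi))%:E * fock_int p f))%E).
  rewrite muleA -EFinM.
  have -> : q / p * N `^ (q - p) * (p / (2 * pi)) = q / (2 * pi) * N `^ (q - p).
    have pi0 : pi != 0 :> R by rewrite gt_eqF// pi_gt0.
    have pn0 : p != 0 by rewrite gt_eqF.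
    by move: (@pi R) pi0 => y y0; field; rewrite y0 pn0.
  rewrite (EFinM (q / (2 * pi)) (N `^ (q - p))) -muleA; apply: lee_wpmul2l I.
  by rewrite lee_fin ltW// cst_gt0.
apply: (@le_trans _ _ ((q / p * N `^ (q - p))%:E * (N `^ p)%:E)%E).
  by apply: lee_wpmul2l => //; rewrite lee_fin mulr_ge0 ?powR_ge0// ltW.
rewrite -EFinM lee_fin -(mulrA (q / p)) (ler_pM2l qp).
have [->|n0] := eqVneq N 0; first by rewrite (powR0 (x := p)) ?gt_eqF// mulr0 powR_ge0.
by rewrite -powRD ?subrK// n0 implybT.
Qed.

End fock_estimates.

(** * Compact operators *)
Section real_norm.
Variables (R : realType) (V : normedModType R[i]).
Implicit Types (x y : V).

(** The norm with values in [R], in which all estimates are done. *)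
Definition nrm x : R := complex.Re `|x|.

Lemma nrmE x : `|x| = (nrm x)%:C.
Proof. by rewrite /nrm RRe_real// ger0_real. Qed.

Lemma nrm_ge0 x : 0 <= nrm x.
Proof. by rewrite -ler0c -nrmE. Qed.

Lemma nrmD x y : nrm (x + y) <= nrm x + nrm y.
Proof. by rewrite -lecR rmorphD /= -!nrmE ler_normD. Qed.

Lemma nrmN x : nrm (- x) = nrm x.
Proof. by rewrite /nrm normrN. Qed.

Lemma nrmB x y : nrm (x - y) = nrm (y - x).
Proof. by rewrite -nrmN opprB. Qed.

Lemma nrmZ (c : R[i]) x : nrm (c *: x) = normc c * nrm x.
Proof.
apply: (@complexI R); rewrite rmorphM /= -!nrmE normrZ; congr (_ * _).
Qed.

Lemma nrm0 : nrm (0 : V) = 0.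
Proof. by rewrite /nrm normr0. Qed.

Lemma nrm_sum (I : Type) (s : seq I) (P : pred I) (F : I -> V) :
  nrm (\sum_(i <- s | P i) F i) <= \sum_(i <- s | P i) nrm (F i).
Proof.
elim/big_ind2 : _ => [|x1 x2 y1 y2 h1 h2|//]; first by rewrite nrm0.
by rewrite (le_trans (nrmD _ _))// lerD.
Qed.

Lemma nbhs_nrm x (P : set V) :
  (exists2 d : R, 0 < d & forall y, nrm (y - x) < d -> P y) -> nbhs x P.
Proof.
move=> [d d0 dP]; apply/nbhs_ballP; exists (d%:C) => /=; first by rewrite ltcR.
by move=> y; rewrite -ball_normE /ball_ /= nrmE ltcR nrmB => /dP.
Qed.

Lemma nrm_bounded (A : set V) (B : R) : (forall x, A x -> nrm x <= B) -> bounded_set A.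
Proof.
move=> AB; exists B%:C; split; first by apply/complex_realP; exists B.
by move=> M BM x /AB; rewrite -lecR -nrmE => /le_trans; apply; exact: ltW.
Qed.

Lemma bounded_nrm (A : set V) : bounded_set A -> exists B : R, forall x, A x -> nrm x <= B.
Proof.
move=> [M [/complex_realP[m ->] mP]]; exists (m + 1) => x Ax.
by rewrite -lecR -nrmE; apply: (mP (m + 1)%:C) => //; rewrite ltcR ltrDl.
Qed.

End real_norm.

Section compact_operators.
Variables (R : realType) (X Y : normedModType R[i]).

(** Clustering along the nested sets [P r], [r -> oo]: the images of [A `&` P r]
    generate a proper filter that contains a compact set. *)
Lemma compact_operator_cluster (K : X -> Y) (A : set X) (P : R -> set X) :
  compact_operator K -> bounded_set A ->
  (forall r s, r <= s -> P s `<=` P r) -> (forall r, A `&` P r !=set0) ->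
  exists g : Y, forall (d r : R), 0 < d -> exists x, [/\ A x, P r x & nrm (K x - g) < d].
Proof.
move=> cK bA dP AP; have := cK A bA; rewrite precompactE => cptK.
pose F := filter_from setT (fun r : R => K @` (A `&` P r)).
have FF : ProperFilter F.
  apply: filter_from_proper.
    apply: filter_from_filter; first by exists 0.
    move=> r s _ _; exists (Num.max r s) => // y [x [Ax Px] <-].
    by split; exists x => //; split=> //; apply: dP Px; rewrite le_max lexx ?orbT.
  by move=> r _; case: (AP r) => x ARx; exists (K x), x.
have FcK : F (closure (K @` A)).
  exists 0 => // y [x [Ax _] <-]; apply: subset_closure; exists x => //.
have [g [_ Fg]] := cptK F FF FcK; exists g => d r d0.
have Fr : F (K @` (A `&` P r)) by exists r.
have ng : nbhs g [set y | nrm (y - g) < d] by apply: nbhs_nrm; exists d.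
by have [y [[x [Ax Px] <-] /= yd]] := Fg _ _ Fr ng; exists x.
Qed.

(** Otherwise the images of points [x] of the ball with [r < nrm (K x)] would
    cluster at some [g] as [r] grows, although their norms exceed [nrm g + 1]. *)
Lemma compact_operator_bounded (K : X -> Y) : compact_operator K ->
  exists2 M : R, 0 < M & forall x, nrm x <= 1 -> nrm (K x) <= M.
Proof.
move=> cK; apply: contrapT => nM.
have AP r : [set x : X | nrm x <= 1] `&` [set x | r < nrm (K x)] !=set0.
  apply: contrapT => nx; apply: nM; exists (Num.max 1 r); first by rewrite lt_max ltr01.
  move=> x x1; rewrite leNgt; apply/negP => Kx; apply: nx; exists x; split => //=.
  by apply: le_lt_trans Kx; rewrite le_max lexx orbT.
have bA : bounded_set [set x : X | nrm x <= 1] by apply: (@nrm_bounded _ _ _ 1).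
have dP (r s : R) : r <= s -> [set x | s < nrm (K x)] `<=` [set x | r < nrm (K x)].
  by move=> rs x /=; exact: le_lt_trans.
have [g hg] := compact_operator_cluster cK bA dP AP.
have [x [_ /= gx xg]] := hg 1 (nrm g + 1) ltr01.
have := le_lt_trans (nrmD (K x - g) g) (ltr_leD xg (lexx (nrm g))).
by rewrite subrK addrC => /(lt_trans gx); rewrite ltxx.
Qed.

(** The image of a bounded set lies in the set of combinations of the [v i] with
    coefficients in a fixed compact square, a continuous image of a product of
    compact sets. *)
Lemma finite_rank_compact n (T : X -> Y) (l : 'I_n -> X -> R[i]) (v : 'I_n -> Y) (M : R) :
  (forall x, T x = \sum_(i < n) l i x *: v i) ->
  (forall i x, normc (l i x) <= M * nrm x) -> compact_operator T.
Proof.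
move=> TE lM A bA; have [B AB] := bounded_nrm bA.
pose D := `|M| * `|B|.
pose Sq : set R[i]^o := [set c | exists2 w : R * R, (`[- D, D] `*` `[- D, D])%classic w &
   (w.1 +i* w.2) = c].
have cSq : compact Sq.
  have -> : Sq = (fun w : R * R => (w.1 +i* w.2) : R[i]^o) @` (`[- D, D] `*` `[- D, D])%classic.
    by apply/seteqP; split.
  apply: continuous_compact.
    by apply: continuous_subspaceT; exact: continuous_complex_of_pair.
  by apply: compact_setX; exact: segment_compact.
have lSq i x : A x -> Sq (l i x).
  move=> Ax; have lD : normc (l i x) <= D.
    apply: le_trans (lM i x) _; rewrite /D.
    apply: (@le_trans _ _ (`|M| * nrm x)).
      by rewrite ler_wpM2r ?nrm_ge0// ler_norm.
    by rewrite ler_wpM2l// (le_trans (AB _ Ax))// ler_norm.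
  exists (complex.Re (l i x), complex.Im (l i x)); last by case: (l i x).
  split=> /=; rewrite in_itv /= -ler_norml.
    by rewrite (le_trans (normc_Re (l i x))).
  by rewrite (le_trans (normc_Im (l i x))).
(* the compact set of combinations, defined for all [m] for the induction on [m] *)
pose E m (u : 'I_m -> Y) : set Y := [set y | exists2 c : 'I_m -> R[i], (forall i, Sq (c i)) &
   y = \sum_(i < m) c i *: u i].
have cE m (u : 'I_m -> Y) : compact (E m u).
  elim: m u => [|m IH] u.
    have -> : E 0 u = [set 0].
      apply/seteqP; split => [y [c _ ->]|y ->]; first by rewrite big_ord0.
      by exists (fun=> 0); [case|rewrite big_ord0].
    exact: compact_set1.
  pose u' (i : 'I_m) := u (lift ord0 i).
  have -> : E m.+1 u = (fun w : Y * R[i]^o => (w.2 : R[i]) *: u ord0 + w.1) @` (E m u' `*` Sq).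
    apply/seteqP; split => [y [c cS ->]|_ [[y c] [/= [c' cS' ->] cS] <-]].
      exists (\sum_(i < m) c (lift ord0 i) *: u' i, c ord0).
        by split => /=; [exists (fun i => c (lift ord0 i))|exact: cS].
      by rewrite /= big_ord_recl.
    exists (fun i => if unlift ord0 i is Some j then c' j else c).
      by move=> i; case: unliftP => [j _|_]; [exact: cS'|exact: cS].
    rewrite big_ord_recl unlift_none; congr (_ + _); apply: eq_bigr => i _.
    by rewrite liftK.
  apply: continuous_compact; last exact: compact_setX (IH u') cSq.
  apply: continuous_subspaceT => -[y c].
  apply: cvgD; last exact: cvg_fst.
  apply: (@cvgZr_tmp _ _ _ _ _ (fun w : Y * R[i]^o => w.2)).
  exact: cvg_snd.
apply: (@precompact_subset _ _ (E n v)).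
  by move=> _ [x Ax <-]; exists (fun i => l i x) => [i|]; [exact: lSq|exact: TE].
apply: compact_precompact (cE n v).
exact: norm_hausdorff.
Qed.

End compact_operators.

(** * Reproducing kernels *)
Section kernels.
Variable R : realType.
Local Notation C := (cplx R).
Implicit Types (p q : R).

(** [e^(-x^2/2) <= e^(1/2) e^(-|x|)] reduces to exponentials, for which the sum over
    the centres up to [r] is at most twice its last term, as [e^(-1) <= 1/2]. Beyond
    [r] the terms decrease by the factor 1/2 at least, and the growth of the bound
    [5 - 2 e (r - rho n)] along the induction pays for each new term. *)
Lemma separated_gauss_sum (rho : nat -> R) (r : R) n :
  (forall j, rho j + 1 <= rho j.+1) ->
  \sum_(j < n) expR (- ((r - rho j) ^+ 2 / 2)) <= 5 * expR 2^-1.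
Proof.
move=> sep.
have e2 : 2 <= expR 1 :> R by apply: le_trans (expR_ge1Dx 1); rewrite -natr1.
have eN1 : expR (- 1) <= 2^-1 :> R by rewrite expRN lef_pV2 ?posrE ?expR_gt0.
pose e (x : R) : R := expR (- `|x|).
have ge x : expR (- (x ^+ 2 / 2)) <= expR 2^-1 * e x.
  rewrite -expRD ler_expR.
  have := sqr_ge0 (`|x| - 1); rewrite sqrrB1 real_normK ?num_real//; lra.
suff H : \sum_(j < n) e (r - rho j) <= 5.
  apply: (@le_trans _ _ (\sum_(j < n) expR 2^-1 * e (r - rho j))).
    by apply: ler_sum => j _.
  by rewrite -mulr_sumr mulrC ler_wpM2r ?expR_ge0.
case: n => [|n]; first by rewrite big_ord0.
have e0 x : 0 <= e x by exact: expR_ge0.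
suff [H1 H2] : (rho n <= r -> \sum_(j < n.+1) e (r - rho j) <= 2 * e (r - rho n)) /\
    (r <= rho n -> \sum_(j < n.+1) e (r - rho j) <= 5 - 2 * e (r - rho n)).
  have eb : e (r - rho n) <= 1 by rewrite -expR0 ler_expR oppr_le0.
  have [/H1|/ltW/H2] := leP (rho n) r; first by move: eb; lra.
  by move: (e0 (r - rho n)); lra.
elim: n => [|n [IH1 IH2]].
  have eb : e (r - rho 0%N) <= 1 by rewrite -expR0 ler_expR oppr_le0.
  by rewrite big_ord1; move: (e0 (r - rho 0%N)) eb; split; lra.
set x := rho n in IH1 IH2; set y := rho n.+1; have xy : x + 1 <= y := sep n.
rewrite big_ord_recr /= -/y.
have eL u v : u + 1 <= v -> expR u <= 2^-1 * expR v :> R.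
  move=> uv; apply: (@le_trans _ _ (expR (- 1) * expR v)); last by rewrite ler_wpM2r ?expR_ge0.
  by rewrite -expRD ler_expR; lra.
split=> ry.
  have xr : x <= r by lra.
  have := IH1 xr; have : e (r - x) <= 2^-1 * e (r - y).
    by apply: eL; rewrite !ger0_norm ?subr_ge0//; lra.
  lra.
have [xr|rx] := leP x r.
  have eb u : e u <= 1 by rewrite -expR0 ler_expR oppr_le0.
  by have := IH1 xr; move: (eb (r - x)) (eb (r - y)); lra.
have := IH2 (ltW rx); have : e (r - y) <= 2^-1 * e (r - x).
  by apply: eL; rewrite !ler0_norm ?subr_le0 ?(ltW rx)//; lra.
by move: (e0 (r - x)); lra.
Qed.

(** The normalized reproducing kernel [e^(conj w z - |w|^2/2)], as a translate of
    the constant 1. *)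
Definition kern (w : C) : C -> C := weyl (- w) (fun=> 1).

Lemma entire_kern w : entire (kern w).
Proof. by apply: entire_weyl; exact: entire_cst. Qed.

Lemma fmod_kern w z : fmod (kern w) z = expR (- (normc (z - w) ^+ 2 / 2)).
Proof. by rewrite /kern fmod_weyl /fmod normc1 !mul1r. Qed.

Lemma fock_norm_kern p w : 0 < p -> fock_norm p (kern w) = 1%E.
Proof.
move=> p0; rewrite /kern (fock_norm_weyl _ p0 (@entire_cst R 1)).
by rewrite fock_norm_cst// normc1.
Qed.

Section unit_ball_bound.
Variables (X Y : normedModType R[i]) (K : {linear X -> Y}) (M : R).

Lemma linear_nrm_le : 0 <= M -> (forall x, nrm x <= 1 -> nrm (K x) <= M) ->
  forall x, nrm (K x) <= M * nrm x.
Proof.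
move=> M0 KM x; have [x0|xn0] := eqVneq (nrm x) 0.
  have -> : x = 0 by apply/normr0_eq0; rewrite nrmE x0.
  by rewrite linear0 !nrm0 mulr0.
have xp : 0 < nrm x by rewrite lt0r xn0 nrm_ge0.
have := KM (((nrm x)^-1)%:C *: x).
rewrite linearZ /= !nrmZ normc_real ger0_norm ?invr_ge0 ?nrm_ge0// mulVf// => /(_ (lexx _)).
by rewrite ler_pdivrMl// mulrC.
Qed.

End unit_ball_bound.

Section fock_elements.
Variables (p : R) (p1 : 1 <= p).

Let p0 : 0 < p. Proof. exact: lt_le_trans p1. Qed.

Lemma fock_nrm (f : fock p1) : (nrm f)%:E = fock_norm p f.
Proof. by rewrite /nrm fock_normrE /= fineK// fock_fin_num. Qed.

Definition mkfock (f : C -> C) (ef : entire f) (nf : (fock_norm p f < +oo)%E) : fock p1 :=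
  @Fock R p p1 f (mem_set (conj ef nf)).

Lemma fock_kern_lty w : (fock_norm p (kern w) < +oo)%E.
Proof. by rewrite fock_norm_kern// ltry. Qed.

Definition fkern w : fock p1 := mkfock (@entire_kern w) (fock_kern_lty w).

Lemma nrm_fkern w : nrm (fkern w) = 1.
Proof. by apply: EFin_inj; rewrite fock_nrm /= fock_norm_kern. Qed.

Lemma fock_fmod_le (f : fock p1) z : fmod f z <= nrm f.
Proof. by rewrite -lee_fin fock_nrm; apply: fmod_le_norm => //; exact: fock_entire. Qed.

Lemma fock_sumE (I : Type) (s : seq I) (F : I -> fock p1) z :
  (\sum_(i <- s) F i : fock p1) z = \sum_(i <- s) F i z.
Proof.
elim: s => [|i s IH]; first by rewrite !big_nil.
by rewrite !big_cons -IH.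
Qed.

Lemma fock_norm_sum (I : Type) (s : seq I) (q : R) (F : I -> C -> C) (c : R) : 1 <= q -> 0 <= c ->
  (forall i, entire (F i)) -> (forall i, (fock_norm q (F i) <= c%:E)%E) ->
  (fock_norm q (fun z => (\sum_(i <- s) F i z)%R) <= ((size s)%:R * c)%:E)%E.
Proof.
move=> q1 c0 eF Fc; have q0 : 0 < q by rewrite (lt_le_trans _ q1).
elim: s => [|i s IH].
  have -> : (fun z => \sum_(i <- [::]) F i z) = (fun=> 0).
    by apply/funext => z; rewrite big_nil.
  by rewrite fock_norm0// mul0r.
have -> : (fun z => \sum_(j <- i :: s) F j z) = (fun z => F i z + \sum_(j <- s) F j z).
  by apply/funext => z; rewrite big_cons.
have es : entire (fun z => \sum_(j <- s) F j z) by exact: entire_sum.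
apply: le_trans (fock_normD q1 (eF i) es) _.
by rewrite /= -natr1 mulrDl mul1r addrC EFinD; apply: leeD.
Qed.

End fock_elements.

(** Kernels centred at infinity are eventually small under a compact operator:
    otherwise infinitely many separated kernels have images within [e / 4] of one
    [g] with [nrm g >= 3 e / 4], and the image of the sum of [n] of them has norm at
    least [n e / 2]. But the sum has bounded [fmod], by [separated_gauss_sum], and
    norm at most [n] in [F^1], hence norm [O(n ^ p^-1)] in [F^p] by interpolation. *)
Lemma compact_kernel_null p (p1 : 1 < p) (Y : normedModType R[i])
    (K : {linear fock (ltW p1) -> Y}) (e : R) :
  compact_operator K -> 0 < e ->
  exists r : R, forall w, r < normc w -> nrm (K (fkern (ltW p1) w)) <= e.
Proof.
move=> cK e0; apply: contrapT => nr; have p0 : 0 < p by rewrite (lt_trans _ p1).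
pose A : set (fock (ltW p1)) := [set x | exists2 w, e < nrm (K (fkern (ltW p1) w)) & x = fkern (ltW p1) w].
pose P r : set (fock (ltW p1)) := [set x | exists2 w, r < normc w & e < nrm (K (fkern (ltW p1) w)) /\ x = fkern (ltW p1) w].
have bA : bounded_set A by apply: (@nrm_bounded _ _ _ 1) => _ [w _ ->]; rewrite nrm_fkern.
have dP r s : r <= s -> P s `<=` P r.
  by move=> rs x [w sw wx]; exists w => //; exact: le_lt_trans sw.
have AP r : A `&` P r !=set0.
  apply: contrapT => nx; apply: nr; exists r => w rw; rewrite leNgt; apply/negP => Kw.
  by apply: nx; exists (fkern (ltW p1) w); split; exists w.
have [g hg] := compact_operator_cluster cK bA dP AP.
have e4 : 0 < e / 4 by rewrite divr_gt0.
have step r : exists w : C, r < normc w /\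
    (e < nrm (K (fkern (ltW p1) w)) /\ nrm (K (fkern (ltW p1) w) - g) < e / 4).
  have [x [_ [w rw [ew ->]] xg]] := hg (e / 4) r e4.
  by exists w.
have [nx nxP] := choice step.
(* centres whose moduli increase by at least 1 at each step *)
pose u := fix u n := if n is m.+1 then nx (normc (u m) + 1) else nx 0.
have uP n : e < nrm (K (fkern (ltW p1) (u n))) /\ nrm (K (fkern (ltW p1) (u n)) - g) < e / 4.
  by case: n => [|n]; [case: (nxP 0)|case: (nxP (normc (u n) + 1))].
have sep j : normc (u j) + 1 <= normc (u j.+1) by case: (nxP (normc (u j) + 1)) => /ltW.
have ng : e * 3 / 4 <= nrm g.
  have [h1 h2] := uP 0%N; have := nrmD (K (fkern (ltW p1) (u 0%N)) - g) g.
  by rewrite subrK; move: h1 h2; lra.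
have [M M0 KM] := compact_operator_bounded cK.
pose S : R := 5 * expR 2^-1.
have S0 : 0 < S by rewrite mulr_gt0// expR_gt0.
pose s n : fock (ltW p1) := \sum_(j < n) fkern (ltW p1) (u j).
have sE n : (s n : C -> C) = (fun z => \sum_(j < n) kern (u j) z).
  by apply/funext => z; rewrite fock_sumE.
have es n : entire (fun z => \sum_(j < n) kern (u j) z).
  by rewrite -sE; exact: fock_entire.
have fs n z : fmod (fun z => \sum_(j < n) kern (u j) z) z <= S.
  apply: le_trans (separated_gauss_sum (normc z) n sep).
  apply: (@le_trans _ _ (\sum_(j < n) fmod (kern (u j)) z)).
    by rewrite /fmod -mulr_suml ler_wpM2r ?expR_ge0// normc_sum.
  apply: ler_sum => j _; rewrite fmod_kern ler_expR lerN2 ler_wpM2r ?invr_ge0//.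
  rewrite -[leLHS]real_normK ?num_real// lerXn2r ?nnegrE ?normc_ge0//.
  exact: normc_lerB.
pose B := p * S `^ (p - 1).
have B0 : 0 < B by rewrite mulr_gt0// powR_gt0.
have sn n : nrm (s n) <= (B * n%:R) `^ p^-1.
  have I := fock_int_interpolation ltr01 (ltW p1) (es n) (fs n).
  have n0 : 0 <= n%:R :> R by [].
  have J : (fock_norm 1 (fun z => (\sum_(j < n) kern (u j) z)%R) <= n%:R%:E)%E.
    have := @fock_norm_sum _ (index_enum 'I_n) 1 (fun j : 'I_n => kern (u j)) 1 (lexx _) ler01.
    rewrite mulr1 -sum1_size big_const_ord iter_addn_0 mul1n; apply.
      by move=> j; exact: entire_kern.
    by move=> j; rewrite fock_norm_kern.
  have /(fock_norm_le _ ltr01 n0) {}J := J; rewrite powRr1// in J.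
  rewrite -lee_fin fock_nrm sE; apply/(fock_norm_le _ p0 (powR_ge0 _ _)).
  have Bn : 0 <= B * n%:R by rewrite mulr_ge0// ltW.
  rewrite -powRrM mulVf ?gt_eqF// powRr1//.
  apply: (@le_trans _ _ (B%:E * ((1 / (2 * pi))%:E * fock_int 1 (fun z => (\sum_(j < n) kern (u j) z)%R)))%E).
    rewrite muleA -EFinM.
    have -> : B * (1 / (2 * pi)) = p / (2 * pi) * S `^ (p - 1) by rewrite /B; ring.
    rewrite (EFinM (p / (2 * pi))) -muleA; apply: lee_wpmul2l I.
    by rewrite lee_fin divr_ge0 ?mulr_ge0 ?(ltW p0)// ltW// pi_gt0.
  by rewrite EFinM; apply: lee_wpmul2l J; rewrite lee_fin ltW.
have Ks n : n%:R * (e / 2) <= M * (B * n%:R) `^ p^-1.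
  apply: (@le_trans _ _ (nrm (K (s n)))); last first.
    apply: le_trans (linear_nrm_le (ltW M0) KM (s n)) _.
    by rewrite ler_wpM2l// ltW.
  have E1 : n%:R *: g = K (s n) - \sum_(j < n) (K (fkern (ltW p1) (u j)) - g) :> Y.
    by rewrite sumrB /s linear_sum /= opprB addrC subrK sumr_const card_ord scaler_nat.
  have E2 : nrm (n%:R *: g) = n%:R * nrm g.
    by rewrite nrmZ -(rmorph_nat (@real_complex R)) normc_real ger0_norm.
  have E3 : nrm (\sum_(j < n) (K (fkern (ltW p1) (u j)) - g)) <= n%:R * (e / 4).
    apply: le_trans (nrm_sum _ _ _) _.
    apply: (@le_trans _ _ (\sum_(j < n) (e / 4))).
      by apply: ler_sum => j _; case: (uP j) => _ /ltW.
    by rewrite sumr_const card_ord mulr_natl.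
  have := nrmD (K (s n)) (- \sum_(j < n) (K (fkern (ltW p1) (u j)) - g)).
  rewrite -E1 E2 nrmN.
  have : n%:R * (e * 3 / 4) <= n%:R * nrm g by rewrite ler_wpM2l.
  by move: E3; lra.
pose T := M `^ p * B / (e / 2) `^ p.
have ep : 0 < (e / 2) `^ p by rewrite powR_gt0// divr_gt0.
have T0 : 0 < T by rewrite divr_gt0// mulr_gt0// powR_gt0.
pose n := (Num.truncn (T `^ (p - 1)^-1)).+1.
have nT : T `^ (p - 1)^-1 < n%:R by exact: truncnS_gt.
have p10 : 0 < p - 1 by rewrite subr_gt0.
have n0 : 0 < n%:R :> R by [].
have : T < n%:R `^ (p - 1).
  have {1}-> : T = (T `^ (p - 1)^-1) `^ (p - 1).
    by rewrite -powRrM mulVf ?gt_eqF// powRr1// ltW.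
  by apply: gt0_ltr_powR => //; rewrite ?nnegrE ?powR_ge0 ?ltW.
have := Ks n; have Bn : 0 <= B * n%:R by rewrite mulr_ge0 ?(ltW B0).
have L0 : 0 <= n%:R * (e / 2) by rewrite mulr_ge0// divr_ge0// ltW.
have R0 : 0 <= M * (B * n%:R) `^ p^-1 by rewrite mulr_ge0 ?powR_ge0// ltW.
move=> /(ge0_ler_powR (ltW p0) L0 R0).
rewrite (powRM p (ltW n0)) ?(divr_ge0 (ltW e0))// (powRM p (ltW M0)) ?powR_ge0//.
rewrite -powRrM mulVf ?gt_eqF// (powRr1 Bn).
have -> : n%:R `^ p = n%:R `^ (p - 1) * n%:R :> R.
  by rewrite -{3}(powRr1 (ltW n0)) -powRD ?subrK// gt_eqF// implybT.
rewrite -mulrA (mulrC n%:R) !mulrA ler_pM2r// -ler_pdivlMr// => h1 h2.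
by have := lt_le_trans h2 h1; rewrite /T /B !mulrA ltxx.
Qed.

End kernels.

(** * The essential norm *)
Section operator_norms.
Variables (R : realType) (X Y : normedModType R[i]).

Lemma opnorm_ub (T : X -> Y) x : nrm x <= 1 -> ((nrm (T x))%:E <= opnorm T)%E.
Proof.
move=> x1; apply: ereal_sup_ubound; exists x => //=.
by rewrite nrmE lecR.
Qed.

Lemma opnorm_le (T : X -> Y) (M : R) :
  (forall x, nrm x <= 1 -> nrm (T x) <= M) -> (opnorm T <= M%:E)%E.
Proof.
move=> TM; apply: ge_ereal_sup => _ [x /= x1 <-].
by rewrite lee_fin; apply: TM; rewrite -lecR -nrmE.
Qed.

End operator_norms.

Section weighted_composition.
Variable R : realType.
Local Notation C := (cplx R).
Variables (psi phi : C -> C).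

(** [W] acts on [fmod] as multiplication by the weight and composition with [phi]. *)
Lemma fmod_weighted_composition f z :
  fmod (weighted_composition psi phi f) z = mz psi phi z * fmod f (phi z).
Proof.
rewrite /fmod /weighted_composition /mz normcM -[LHS]mulrA -[RHS]mulrA; congr (_ * _).
by rewrite [RHS]mulrCA -expRD; congr (_ * expR _); field.
Qed.

Lemma mz_ge0 z : 0 <= mz psi phi z.
Proof. by rewrite mulr_ge0 ?normc_ge0 ?expR_ge0. Qed.

Lemma limsup_mz_ge0 : (0 <= limf_esup (fun z => (mz psi phi z)%:E) (@cinfty R))%E.
Proof.
apply: limf_esup_ge0 => [[r _ r0]|z]; last by rewrite lee_fin mz_ge0.
have h : r < normc ((`|r| + 1)%:C : C).
  by rewrite normc_real ger0_norm ?addr_ge0// (le_lt_trans (ler_norm r))// ltrDl.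
exact: (r0 _ h).
Qed.

End weighted_composition.

Section lower_bound.
Variables (R : realType) (p q : R) (p1 : 1 < p) (q1 : 1 <= q).
Local Notation C := (cplx R).
Variables (psi phi : C -> C) (a b : C).
Variable W : {linear fock (ltW p1) -> fock q1}.
Hypothesis phiE : forall z, phi z = a * z + b.
Hypothesis a0 : 0 < normc a.
Hypothesis WE : forall f, W f = weighted_composition psi phi f :> (C -> C).

(** The kernel centred at [phi z] has [fmod] equal to 1 at [phi z]. *)
Lemma mz_le_nrm_kernel z : mz psi phi z <= nrm (W (fkern (ltW p1) (phi z))).
Proof.
apply: le_trans (fock_fmod_le (W (fkern (ltW p1) (phi z))) z).
rewrite WE fmod_weighted_composition /= fmod_kern subrr normc0 expr0n mul0r oppr0 expR0.
by rewrite mulr1.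
Qed.

Lemma limsup_mz_le_essential_norm :
  (limf_esup (fun z => (mz psi phi z)%:E) (@cinfty R) <= essential_norm W)%E.
Proof.
apply: le_ereal_inf_tmp => _ [K cK <-]; apply/lee_addgt0Pr => e e0.
have [r rK] := compact_kernel_null cK e0.
pose s := (r + normc b) / normc a.
have phi_far z : s < normc z -> r < normc (phi z).
  rewrite ltr_pdivrMr// mulrC -normcM => h; rewrite phiE.
  have := le_normcD (a * z + b) (- b); rewrite addrK normcN; move: h; lra.
apply: (@le_trans _ _ (ereal_sup ((fun z => (mz psi phi z)%:E) @` [set z : C | s < normc z]))).
  by apply: ereal_inf_lbound; exists [set z : C | s < normc z] => //; exists s.
apply: ge_ereal_sup => _ [z /= sz <-].
pose k := fkern (ltW p1) (phi z).
have k1 : nrm k <= 1 by rewrite nrm_fkern.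
have Wk : mz psi phi z <= nrm (W k - K k) + e.
  apply: le_trans (mz_le_nrm_kernel z) _.
  rewrite -[X in nrm X <= _](subrK (K k)); apply: le_trans (nrmD _ _) _.
  by rewrite lerD2l; apply: rK; exact: phi_far.
apply: le_trans (_ : ((nrm (W k - K k) + e)%:E <= _)%E); first by rewrite lee_fin.
rewrite EFinD leeD2r//.
exact: (opnorm_ub (fun x => W x - K x) k1).
Qed.

End lower_bound.

Section fejer_operator.
Variables (R : realType) (p : R) (p1 : 1 <= p).
Local Notation C := (cplx R).
Let p0 : 0 < p. Proof. exact: lt_le_trans p1. Qed.

Lemma fock_norm_fejer_mean_lty n (f : fock p1) : (fock_norm p (fejer_mean n f) < +oo)%E.
Proof.
apply: le_lt_trans (fock_norm_fejer_mean n p1 (@fock_entire _ _ _ f)) _.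
by rewrite -fock_nrm ltry.
Qed.

Definition fejer_op n (f : fock p1) : fock p1 :=
  mkfock p1 (@entire_fejer_mean R n f) (fock_norm_fejer_mean_lty n f).

Lemma nrm_fejer_op n f : nrm (fejer_op n f) <= nrm f.
Proof.
rewrite -lee_fin (fock_nrm (fejer_op n f)) (fock_nrm f).
exact: (fock_norm_fejer_mean n p1 (@fock_entire _ _ _ f)).
Qed.

Lemma fejer_op_linear n : linear (fejer_op n).
Proof.
move=> c f g; apply: val_inj; apply/funext => z.
have ef := @fock_entire _ _ _ f; have eg := @fock_entire _ _ _ g.
have P l : psum (fun z => c * f z + g z) l z = c * psum f l z + psum g l z.
  rewrite /psum mulr_sumr -big_split /=; apply: eq_bigr => m _.
  by rewrite (tcoefD m (@entireZ _ c _ ef) eg) (tcoefZ m c ef) mulrDl mulrA.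
change (fejer_mean n (fun z => c * f z + g z) z = c * fejer_mean n f z + fejer_mean n g z).
rewrite /fejer_mean mulrCA -mulrDr; congr (_ * _).
by rewrite mulr_sumr -big_split /=; apply: eq_bigr => l _; exact: P.
Qed.

HB.instance Definition _ n :=
  GRing.isLinear.Build R[i] (fock p1) (fock p1) *:%R (fejer_op n) (fejer_op_linear n).

(** [x^m <= (m+1)^m e^x] and [x - x^2/4 <= 1] trade the power for half of the
    Gaussian weight. *)
Lemma fmod_monomial m (z : C) :
  fmod (fun z => z ^+ m) z <= m.+1%:R ^+ m * expR 1 * expR (- (normc z ^+ 2 / 4)).
Proof.
rewrite /fmod normcX -mulrA -expRD; set x := normc z.
have x0 : 0 <= x by exact: normc_ge0.
have N0 : 0 < m.+1%:R :> R by [].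
have h : x ^+ m <= m.+1%:R ^+ m * expR x.
  apply: (@le_trans _ _ ((m.+1%:R * expR (x / m.+1%:R)) ^+ m)).
    apply: lerXn2r; rewrite ?nnegrE ?mulr_ge0 ?expR_ge0//.
    by rewrite mulrC -ler_pdivrMr//; apply: le_trans (expR_ge1Dx _); rewrite lerDr.
  rewrite exprMn -expRM_natl ler_wpM2l ?exprn_ge0// ler_expR.
  by rewrite mulrCA ler_piMr// ler_pdivrMr// mul1r ler_nat.
apply: le_trans (ler_wpM2r (expR_ge0 _) h) _.
rewrite -mulrA -expRD ler_wpM2l ?exprn_ge0// ler_expR.
have := sqr_ge0 (x / 2 - 1); rewrite sqrrB1 exprMn; lra.
Qed.

Lemma fock_norm_monomial_lty m : (fock_norm p (fun z : C => (z ^+ m)%R) < +oo)%E.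
Proof.
pose B : R := m.+1%:R ^+ m * expR 1.
have B0 : 0 <= B by rewrite mulr_ge0 ?exprn_ge0 ?expR_ge0.
have em : entire (fun z : C => z ^+ m) by exact: entireX.
rewrite fock_norm_int//.
suff h : (fock_int p (fun z : C => (z ^+ m)%R) <= (B `^ p * (pi / (p / 4)))%:E)%E.
  have c0 : 0 <= p / (2 * pi) by rewrite divr_ge0 ?mulr_ge0 ?(ltW p0) ?pi_ge0.
  apply: (@le_lt_trans _ _ (((p / (2 * pi))%:E * (B `^ p * (pi / (p / 4)))%:E) `^ p^-1)%E).
    apply: ler_poweR; first by rewrite invr_ge0 ltW.
      by apply: mule_ge0; [rewrite lee_fin|exact: fock_int_ge0].
    by apply: lee_wpmul2l => //; rewrite lee_fin.
  by rewrite -EFinM poweR_EFin ltry.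
have cg : continuous (fun z : C => expR (- (p / 4 * normc z ^+ 2))).
  have -> : (fun z : C => expR (- (p / 4 * normc z ^+ 2))) =
      (fun z => expR (- (normc z ^+ 2 / 2)) `^ (p / 2)).
    by apply/funext => z; rewrite -expRM; congr expR; field.
  have p20 : 0 < p / 2 by rewrite divr_gt0.
  exact: (continuous_powR p20 (fun z : C => expR_ge0 _) (@continuous_gauss_weight R)).
have mg : measurable_fun setT (fun w : measurableTypeR R * measurableTypeR R =>
    (expR (- (p / 4 * normc (w.1 +i* w.2) ^+ 2)))%:E).
  apply/measurable_EFinP; apply: continuous_measurable_plane.
  exact: (continuous_compC cg (@continuous_complex_of_pair R)).
rewrite EFinM -(int_dA_gauss (c := p / 4)) ?divr_gt0// /int_dA -ge0_integralZl//; last first.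
  by rewrite lee_fin powR_ge0.
apply: ge0_le_integral => //.
- by move=> w _; rewrite lee_fin powR_ge0.
- apply/measurable_EFinP; apply: continuous_measurable_plane.
  exact: (continuous_compC (continuous_fmodp p0 em) (@continuous_complex_of_pair R)).
- by apply: measurable_funeM.
move=> w _; rewrite -EFinM lee_fin.
have -> : expR (- (p / 4 * normc (w.1 +i* w.2) ^+ 2)) = expR (- (normc (w.1 +i* w.2) ^+ 2 / 4)) `^ p.
  by rewrite -expRM; congr expR; ring.
rewrite -powRM ?expR_ge0//; apply: ge0_ler_powR; rewrite ?nnegrE ?fmod_ge0 ?(ltW p0)//.
  by rewrite mulr_ge0 ?expR_ge0.
exact: fmod_monomial.
Qed.

Definition fmonomial m : fock p1 := mkfock p1 (@entireX R m) (fock_norm_monomial_lty m).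

(** The functionals [f |-> tcoef f m] are kept apart from the averaging weights,
    which are attached to the monomials: [fejer_op_compact] then only has to bound
    the former. *)
Lemma fejer_op_expansion n f : fejer_op n f =
  \sum_(m < n.+1) tcoef f m *: ((n.+1%:R^-1 * \sum_(l < n.+1) (m <= l)%N%:R) *: fmonomial m).
Proof.
apply: val_inj; apply/funext => z; rewrite [RHS]fock_sumE.
change (fejer_mean n f z = \sum_(m < n.+1)
  tcoef f m * ((n.+1%:R^-1 * \sum_(l < n.+1) (m <= l)%N%:R) * z ^+ m)).
have P (l : 'I_n.+1) : psum f l z = \sum_(m < n.+1) (m <= l)%N%:R * (tcoef f m * z ^+ m).
  rewrite /psum (big_ord_widen n.+1 (fun m => tcoef f m * z ^+ m)) ?ltnS ?leq_ord//.
  rewrite big_mkcond; apply: eq_bigr => m _; rewrite ltnS.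
  by case: leqP; rewrite ?mul1r ?mul0r.
rewrite /fejer_mean (eq_bigr _ (fun l _ => P l)) exchange_big mulr_sumr; apply: eq_bigr => m _.
by rewrite -mulr_suml; ring.
Qed.

Lemma fock_tcoef_le (f : fock p1) m : normc (tcoef f m) <= expR 2^-1 * nrm f.
Proof.
have := @normc_tcoef R f m 1 (expR 2^-1 * nrm f) (@fock_entire _ _ _ f) ltr01.
rewrite expr1n mulr1; apply => w w1.
have := fock_fmod_le f w; rewrite /fmod => h.
apply: le_trans (_ : expR 2^-1 * (normc (f w) * expR (- (normc w ^+ 2 / 2))) <= _); last first.
  by rewrite ler_wpM2l ?expR_ge0.
rewrite mulrCA -expRD ler_peMr ?normc_ge0// -[leLHS]expR0 ler_expR.
have : normc w ^+ 2 <= 1 by rewrite expr_le1 ?normc_ge0.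
lra.
Qed.

Lemma fejer_op_compact n (Y : normedModType R[i]) (W : {linear fock p1 -> Y}) :
  compact_operator (W \o fejer_op n).
Proof.
apply: (@finite_rank_compact R (fock p1) Y n.+1 _ (fun m f => tcoef f m)
  (fun m => W ((n.+1%:R^-1 * \sum_(l < n.+1) (m <= l)%N%:R) *: fmonomial m)) (expR 2^-1)).
  move=> f; rewrite /= fejer_op_expansion linear_sum; apply: eq_bigr => m _.
  by rewrite linearZ.
by move=> m f; exact: fock_tcoef_le.
Qed.

(** On the unit ball, [|f| <= e^(|v|^2/2)], and [|v|^2/2 <= 2 r^2] on the disc of
    radius [2 r] on which [normc_fejer_meanB] asks for a bound. *)
Lemma fejer_op_remainder n (f : fock p1) (r : R) (w : C) : nrm f <= 1 -> 0 < r -> normc w <= r ->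
  normc (f w - fejer_op n f w) <= 2 * expR (2 * r ^+ 2) / n.+1%:R.
Proof.
move=> f1 r0 wr; rewrite -[X in normc X]opprB normcN.
have := @normc_fejer_meanB R f r (expR (2 * r ^+ 2)) w n (@fock_entire _ _ _ f) r0.
apply => // v vr.
have := le_trans (fock_fmod_le f v) f1; rewrite /fmod => h.
apply: le_trans (_ : expR (2 * r ^+ 2) * (normc (f v) * expR (- (normc v ^+ 2 / 2))) <= _); last first.
  by rewrite ler_piMr ?expR_ge0.
rewrite mulrCA -expRD ler_peMr ?normc_ge0// -[leLHS]expR0 ler_expR.
have : normc v ^+ 2 <= (2 * r) ^+ 2 by rewrite lerXn2r ?nnegrE ?normc_ge0 ?mulr_ge0 ?(ltW r0).
rewrite exprMn; lra.
Qed.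

End fejer_operator.

(** [x^q = x x^(q-1) <= x (x+y)^(q-1)]. *)
Lemma powRD_le (R : realType) (q x y : R) : 1 <= q -> 0 <= x -> 0 <= y ->
  x `^ q + y `^ q <= (x + y) `^ q.
Proof.
move=> q1 x0 y0; have q0 : 0 < q by rewrite (lt_le_trans _ q1).
have E (u : R) : 0 <= u -> u `^ q = u * u `^ (q - 1).
  move=> u0; have [->|un] := eqVneq u 0; first by rewrite powR0 ?gt_eqF// mul0r.
  by rewrite -{2}(powRr1 u0) -powRD ?un ?implybT// addrC subrK.
rewrite !E ?addr_ge0// mulrDl; apply: lerD; apply: ler_wpM2l => //;
  apply: ge0_ler_powR; rewrite ?nnegrE ?subr_ge0 ?addr_ge0//.
  by rewrite lerDl.
by rewrite lerDr.
Qed.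

Section upper_bound.
Variables (R : realType) (p q : R) (p1 : 1 <= p) (pq : p <= q).
Local Notation C := (cplx R).
Let q1 : 1 <= q := le_trans p1 pq.
Variables (psi : fock q1) (phi : C -> C) (a b : C).
Hypothesis phiE : forall z, phi z = a * z + b.
Hypothesis a0 : 0 < normc a.

Let p0 : 0 < p. Proof. exact: lt_le_trans p1. Qed.
Let q0 : 0 < q. Proof. exact: lt_le_trans q1. Qed.
Let an0 : a != 0. Proof. by apply/eqP => a00; move: a0; rewrite a00 normc0 ltxx. Qed.

(** The disc of radius [r] contributes the first term, since [g o phi] is small
    there, and the complement the second one, since the weight is. Extending each
    bound to the whole plane avoids integrals over subsets. *)
Lemma fock_int_weighted_composition (g : C -> C) (r d L : R) : entire g ->
  0 <= d -> 0 <= L ->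
  (forall z, normc z <= r -> normc (g (phi z)) <= d) ->
  (forall z, r < normc z -> mz psi phi z <= L) ->
  (fock_int q (weighted_composition psi phi g) <=
    (d `^ q)%:E * fock_int q psi + (L `^ q * normc a ^- 2)%:E * fock_int q g)%E.
Proof.
move=> eg d0 L0 gd mL.
have near_part z : normc z <= r -> fmod (weighted_composition psi phi g) z <= d * fmod psi z.
  move=> zr; rewrite /fmod /weighted_composition normcM mulrAC mulrC.
  by apply: ler_wpM2r (gd z zr); rewrite mulr_ge0 ?normc_ge0 ?expR_ge0.
have epsi := @fock_entire _ _ _ psi.
have ephi : entire phi.
  by have -> : phi = (fun z => a * z + b) by [exact/funext]; exact: entire_affine.
have egphi := entire_comp eg ephi.
have eW : entire (weighted_composition psi phi g) by exact: entireM.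
have cphi := continuous_compC (continuous_fmodp q0 eg) (entire_continuous ephi).
have M1 : measurable_fun setT (fun w : measurableTypeR R * measurableTypeR R =>
    fmod psi (w.1 +i* w.2) `^ q).
  apply: continuous_measurable_plane.
  exact: (continuous_compC (continuous_fmodp q0 epsi) (@continuous_complex_of_pair R)).
have M2 : measurable_fun setT (fun w : measurableTypeR R * measurableTypeR R =>
    fmod g (phi (w.1 +i* w.2)) `^ q).
  apply: continuous_measurable_plane.
  exact: (continuous_compC cphi (@continuous_complex_of_pair R)).
have M3 : measurable_fun setT (fun w : measurableTypeR R * measurableTypeR R =>
    fmod (weighted_composition psi phi g) (w.1 +i* w.2) `^ q).
  apply: continuous_measurable_plane.
  exact: (continuous_compC (continuous_fmodp q0 eW) (@continuous_complex_of_pair R)).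
have -> : ((L `^ q * normc a ^- 2)%:E * fock_int q g =
    (L `^ q)%:E * int_dA (fun z => (fmod g (phi z) `^ q)%:E))%E.
  rewrite EFinM -muleA; congr (_ * _)%E.
  have := int_dA_affine b an0 (continuous_fmodp q0 eg) (fun z => powR_ge0 _ _).
  rewrite /fock_int => <-; congr int_dA; apply/funext => z.
  by rewrite phiE.
have N1 (w : measurableTypeR R * measurableTypeR R) : setT w ->
    (0 <= (fmod psi (w.1 +i* w.2) `^ q)%:E)%E by rewrite lee_fin powR_ge0.
have N2 (w : measurableTypeR R * measurableTypeR R) : setT w ->
    (0 <= (fmod g (phi (w.1 +i* w.2)) `^ q)%:E)%E by rewrite lee_fin powR_ge0.
have d1 : (0 <= (d `^ q)%:E)%E by rewrite lee_fin powR_ge0.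
have L1 : (0 <= (L `^ q)%:E)%E by rewrite lee_fin powR_ge0.
move/measurable_EFinP in M1; move/measurable_EFinP in M2; move/measurable_EFinP in M3.
rewrite /fock_int /int_dA -(ge0_integralZl _ measurableT M1 N1 d1).
rewrite -(ge0_integralZl _ measurableT M2 N2 L1).
have N3 (w : measurableTypeR R * measurableTypeR R) : setT w ->
    (0 <= (d `^ q)%:E * (fmod psi (w.1 +i* w.2) `^ q)%:E)%E by move=> wT; exact: mule_ge0 (N1 w wT).
have N4 (w : measurableTypeR R * measurableTypeR R) : setT w ->
    (0 <= (L `^ q)%:E * (fmod g (phi (w.1 +i* w.2)) `^ q)%:E)%E by move=> wT; exact: mule_ge0 (N2 w wT).
have M4 := @measurable_funeM _ _ _ _ _ (d `^ q)%:E M1.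
have M5 := @measurable_funeM _ _ _ _ _ (L `^ q)%:E M2.
rewrite -(ge0_integralD _ measurableT N3 M4 N4 M5).
apply: ge0_le_integral; [exact: measurableT| |exact: M3|exact: (emeasurable_funD M4 M5)|].
  by move=> w _; rewrite lee_fin powR_ge0.
move=> w _; set z := w.1 +i* w.2.
rewrite -(EFinM (d `^ q)) -(EFinM (L `^ q)) -EFinD lee_fin.
rewrite -(powRM _ d0 (fmod_ge0 _ _)) -(powRM _ L0 (fmod_ge0 _ _)).
have [zr|rz] := leP (normc z) r.
  apply: ler_wpDr; first exact: powR_ge0.
  apply: (ge0_ler_powR (ltW q0) (fmod_ge0 _ _) (mulr_ge0 d0 (fmod_ge0 _ _))).
  exact: near_part.
apply: ler_wpDl; first exact: powR_ge0.
apply: (ge0_ler_powR (ltW q0) (fmod_ge0 _ _) (mulr_ge0 L0 (fmod_ge0 _ _))).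
by rewrite fmod_weighted_composition; apply: ler_wpM2r (fmod_ge0 _ _) _ _ (mL z rz).
Qed.

(* 2 bounds the norm of [g = f - fejer_op n f]. *)
Let c := 2 * (q / (p * normc a ^+ 2)) `^ q^-1.

Lemma fock_norm_weighted_composition (g : fock p1) (r d L : R) :
  nrm g <= 2 -> 0 <= d -> 0 <= L ->
  (forall z, normc z <= r -> normc (g (phi z)) <= d) ->
  (forall z, r < normc z -> mz psi phi z <= L) ->
  (fock_norm q (weighted_composition psi phi g) <= (c * L + d * nrm psi)%:E)%E.
Proof.
move=> g2 d0 L0 gd mL; have eg := @fock_entire _ _ _ g.
have pa0 : 0 < q / (p * normc a ^+ 2) by rewrite divr_gt0 ?mulr_gt0 ?exprn_gt0.
have c0 : 0 <= c by rewrite mulr_ge0 ?powR_ge0.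
have cL0 : 0 <= c * L by rewrite mulr_ge0.
have dp0 : 0 <= d * nrm psi by rewrite mulr_ge0 ?nrm_ge0.
have k0 : (0 <= (q / (2 * pi))%:E :> \bar R)%E.
  by rewrite lee_fin divr_ge0 ?mulr_ge0 ?(ltW q0) ?pi_ge0.
apply/fock_norm_le => //; first by rewrite addr_ge0.
apply: (@le_trans _ _ ((d * nrm psi) `^ q + (c * L) `^ q)%:E); last first.
  by rewrite lee_fin addrC powRD_le.
have I := fock_int_weighted_composition eg d0 L0 gd mL.
apply: le_trans (lee_wpmul2l k0 I) _.
rewrite ge0_muleDr ?mule_ge0 ?fock_int_ge0 ?lee_fin ?powR_ge0 ?mulr_ge0 ?invr_ge0 ?exprn_ge0 ?normc_ge0 ?powR_ge0//.
rewrite EFinD; apply: leeD.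
  rewrite muleCA (powRM _ d0 (nrm_ge0 psi)) (EFinM (d `^ q)).
  apply: lee_wpmul2l; first by rewrite lee_fin powR_ge0.
  by apply/(fock_norm_le _ q0 (nrm_ge0 _)); rewrite (fock_nrm psi).
have h : (fock_norm p g <= 2%:E)%E by rewrite -fock_nrm lee_fin.
have /(fock_norm_le _ q0) := fock_norm_embed p1 pq eg (ler0n _ 2) h.
rewrite mulr_ge0 ?powR_ge0// => /(_ isT) H.
rewrite muleCA; apply: le_trans (lee_wpmul2l _ H) _.
  by rewrite lee_fin mulr_ge0 ?powR_ge0 ?invr_ge0 ?exprn_ge0 ?normc_ge0.
have Q0 : 0 <= q / p by rewrite divr_ge0 ?ltW.
rewrite -EFinM lee_fin (powRM _ c0 L0) /c (powRM _ (ler0n _ 2) (powR_ge0 _ _)).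
rewrite (powRM _ (powR_ge0 _ _) (ler0n _ 2)) -!powRrM mulVf ?gt_eqF//.
rewrite (powRr1 (ltW pa0)) (powRr1 Q0).
have nn : normc a != 0 by rewrite gt_eqF.
have pn : p != 0 by rewrite gt_eqF.
rewrite le_eqVlt; apply/orP; left; apply/eqP; field.
by rewrite nn pn.
Qed.

Variable W : {linear fock p1 -> fock q1}.
Hypothesis WE : forall f, W f = weighted_composition psi phi f :> (C -> C).

(** Subtract the compact operator [W \o fejer_op n], with [n] so large that the
    contribution of the disc is at most [e]. *)
Lemma essential_norm_le (r L : R) : 0 <= L ->
  (forall z, r < normc z -> mz psi phi z <= L) -> (essential_norm W <= (c * L)%:E)%E.
Proof.
move=> L0 mL; apply/lee_addgt0Pr => e e0.
(* [phi] maps the disc of radius [r] into the disc of radius [s > 0] *)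
pose s := normc a * `|r| + normc b + 1.
have s0 : 0 < s by rewrite ltr_wpDl// addr_ge0 ?mulr_ge0 ?normc_ge0.
pose B := 2 * expR (2 * s ^+ 2).
have B0 : 0 < B by rewrite mulr_gt0 ?expR_gt0.
pose n := Num.truncn (B * nrm psi / e).
pose d := B / n.+1%:R.
have de : d * nrm psi <= e.
  rewrite /d mulrAC ler_pdivrMr// [e * _]mulrC -ler_pdivrMr// ltW//.
  exact: truncnS_gt.
have d0 : 0 <= d by rewrite divr_ge0 ?(ltW B0).
pose K : {linear fock p1 -> fock q1} := W \o fejer_op n.
have KW : (essential_norm W <= opnorm (fun x => (W x - K x)%R))%E.
  by apply: ereal_inf_lbound; exists K => //; exact: fejer_op_compact.
apply: le_trans KW _.
rewrite -EFinD; apply: opnorm_le => f f1.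
apply: le_trans (_ : c * L + d * nrm psi <= _); last by rewrite lerD2l.
rewrite /= -linearB -lee_fin fock_nrm WE.
apply: (@fock_norm_weighted_composition _ r) => //.
  apply: le_trans (nrmD _ _) _; rewrite nrmN.
  by have := lerD f1 (le_trans (nrm_fejer_op n f) f1).
move=> z zr; apply: (fejer_op_remainder n f1 s0).
rewrite phiE; apply: le_trans (le_normcD _ _) _.
rewrite normcM /s -addrA lerD ?lerDl ?ler_wpM2l ?normc_ge0//.
by rewrite (le_trans zr)// ler_norm.
Qed.

Lemma essential_norm_le_limsup_mz :
  (essential_norm W <= c%:E * limf_esup (fun z => (mz psi phi z)%:E) (@cinfty R))%E.
Proof.
have c0 : 0 < c by rewrite mulr_gt0// powR_gt0// divr_gt0 ?mulr_gt0 ?exprn_gt0.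
have := limsup_mz_ge0 psi phi.
case E : (limf_esup _ _) => [t| |]//; last by move=> _; rewrite gt0_muley ?leey ?lte_fin.
rewrite lee_fin => t0; apply/lee_addgt0Pr => e e0.
have : (limf_esup (fun z => (mz psi phi z)%:E) (@cinfty R) < (t + e / c)%:E)%E.
  by rewrite E lte_fin ltrDl divr_gt0.
move=> /ereal_inf_lt [_ [V [r _ rV] <-] Vt].
have -> : (c%:E * t%:E + e%:E = (c * (t + e / c))%:E :> \bar R)%E.
  by rewrite -EFinM -EFinD; congr EFin; field; rewrite gt_eqF.
apply: (@essential_norm_le r).
  by rewrite addr_ge0// divr_ge0// ltW.
move=> z rz; rewrite -lee_fin; apply: le_trans (ltW Vt).
by apply: ereal_sup_ubound; exists z => //; exact: rV.
Qed.

End upper_bound.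

Theorem theorem3p7 (R : realType) (p q : R) (p1 : 1 < p) (pq : p <= q)
    (psi : fock (le_trans (ltW p1) pq)) (a b : cplx R)
    (phi : cplx R -> cplx R)
    (W : {linear fock (ltW p1) -> fock (le_trans (ltW p1) pq)}) :
  psi != 0 ->
  (forall z, phi z = a * z + b) ->
  0 < normc a -> normc a <= 1 ->
  (forall f, W f = weighted_composition psi phi f :> (cplx R -> cplx R)) ->
  bounded_operator W ->
  let limsup_mz := limf_esup (fun z => (mz psi phi z)%:E) (@cinfty R) in
  (limsup_mz <= essential_norm W)%E /\
  (essential_norm W <=
    (2 * (q / (p * normc a ^+ 2)) `^ q^-1)%:E * limsup_mz)%E.
Proof.
move=> _ phiE a0 _ WE _ /=; split.
  exact: (limsup_mz_le_essential_norm phiE a0 WE).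
exact: (essential_norm_le_limsup_mz phiE a0 WE).
Qed.
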